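(* Let $\mathcal{X}$ be a finite set, $p_X\in\mathscr{P}(\mathcal{X})$, and $\mathbf{g}:\mathscr{P}(\mathcal{X})\to\mathbb{R}^d$ twice continuously differentiable. Let $g_t'(x):=\partial g_t(q_X)/\partial q_X(x)|_{q_X=p_X}$ for $t=1,\dots,d$, $\mathbf{g}'(x):=(g_1'(x),\dots,g_d'(x))^T$, and for $X\sim p_X$ let $\mathbf{V}:=\mathrm{Cov}(\mathbf{g}'(X))$. Assume $\mathrm{rank}(\mathbf{V})\ge1$ and $\xi:=\mathsf{E}[\|\mathbf{g}'(X)-\mathsf{E}\mathbf{g}'(X)\|_2^3]<\infty$. Let $\kappa:=\max_{1\le t\le d}\|\nabla^2_{p_X}g_t(p_X)\|_2$ (spectral norm of the Hessian) and $b_n:=(\kappa+1)\log n/n$. Let $X^n=(X_1,\dots,X_n)$ be i.i.d. with law $p_X$ and $P_{X^n}$ its type. Then for any fixed $\mathbf{z}\in\mathbb{R}^d$, $$\mathsf{P}\Big(\mathbf{g}(P_{X^n})\ge\mathbf{g}(p_X)+\frac{\mathbf{z}}{\sqrt n}-b_n\mathbf{1}\Big)\ge\mathsf{P}(\mathbf{Z}\ge\mathbf{z})+O\Big(\frac{\log n}{\sqrt n}\Big),$$ where $\mathbf{Z}\sim\mathcal{N}(\mathbf{0},\mathbf{V})$.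
   Context: $\mathscr{P}(\mathcal{X})$ is the probability simplex on the finite set $\mathcal{X}$, viewed as a subset of $\mathbb{R}^{|\mathcal{X}|}$. The type of $x^n$ is the empirical distribution $P_{x^n}(a):=\frac1n|\{k:x_k=a\}|$. Vector inequalities are componentwise, $\mathbf{1}$ is the all-ones vector, logarithms are base 2. $O(\log n/\sqrt n)$ denotes a term bounded in absolute value by $C\log n/\sqrt n$ for some constant $C$ independent of $n$. *)

(* Defs.v *)
From HB Require Import structures.
From mathcomp Require Import all_boot all_order all_algebra.
From mathcomp Require Import all_classical all_reals all_analysis.
Set Implicit Arguments. Unset Strict Implicit. Unset Printing Implicit Defensive.
Import Order.TTheory GRing.Theory Num.Theory.
Import numFieldNormedType.Exports.
Local Open Scope classical_set_scope.
Local Open Scope ring_scope.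

Section Defs.
Variable R : realType.

(* The finite alphabet X is identified with 'I_m; distributions on it are
   row vectors q : 'rV[R]_m, q ord0 x = q(x). *)

Definition in_simplex m (q : 'rV[R]_m) : Prop :=
  (forall x, 0 <= q ord0 x) /\ \sum_(x < m) q ord0 x = 1.

Definition ebasis m (x : 'I_m) : 'rV[R]_m := delta_mx ord0 x.

Definition pderiv m (f : 'rV[R]_m -> R) (x : 'I_m) : 'rV[R]_m -> R :=
  fun q => derive f q (ebasis x).

Definition C2_on m (U : set 'rV[R]_m) (f : 'rV[R]_m -> R) : Prop :=
  open U /\
  forall q, U q ->
    {for q, continuous f} /\
    forall x y,
      derivable f q (ebasis x) /\
      {for q, continuous (pderiv f x)} /\
      derivable (pderiv f x) q (ebasis y) /\
      {for q, continuous (pderiv (pderiv f x) y)}.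

Definition gder m d (g : 'I_d -> 'rV[R]_m -> R) (p : 'rV[R]_m) t x : R :=
  pderiv (g t) x p.

Definition gmean m d (g : 'I_d -> 'rV[R]_m -> R) (p : 'rV[R]_m) t : R :=
  \sum_(x < m) p ord0 x * gder g p t x.

Definition covV m d (g : 'I_d -> 'rV[R]_m -> R) (p : 'rV[R]_m) : 'M[R]_d :=
  \matrix_(s < d, t < d)
    \sum_(x < m) p ord0 x * (gder g p s x - gmean g p s)
                          * (gder g p t x - gmean g p t).

Definition hessian m (f : 'rV[R]_m -> R) (p : 'rV[R]_m) : 'M[R]_m :=
  \matrix_(x < m, y < m) pderiv (pderiv f x) y p.

Definition l2norm m (v : 'cV[R]_m) : R := Num.sqrt (\sum_(i < m) v i ord0 ^+ 2).

Definition specnorm m (A : 'M[R]_m) : R :=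
  sup [set l2norm (A *m v) | v in [set v : 'cV[R]_m | l2norm v = 1]].

Definition kappa m d (g : 'I_d -> 'rV[R]_m -> R) (p : 'rV[R]_m) : R :=
  \big[Num.max/0]_(t < d) specnorm (hessian (g t) p).

Definition log2 (x : R) : R := ln x / ln 2.

Definition bn m d (g : 'I_d -> 'rV[R]_m -> R) (p : 'rV[R]_m) (n : nat) : R :=
  (kappa g p + 1) * log2 n%:R / n%:R.

Definition ptype m n (xs : {ffun 'I_n -> 'I_m}) : 'rV[R]_m :=
  \row_(a < m) (#|[set k | xs k == a]|%:R / n%:R).

Definition prob_event m d (g : 'I_d -> 'rV[R]_m -> R) (p : 'rV[R]_m)
    (z : 'I_d -> R) (n : nat) : R :=
  \sum_(xs : {ffun 'I_n -> 'I_m} |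
          [forall t, g t p + z t / Num.sqrt n%:R - bn g p n <= g t (ptype xs)])
     \prod_(k < n) p ord0 (xs k).

Definition gauss1 (s2 : R) : set R -> \bar R :=
  if s2 == 0 then \d_(0 : R) else normal_prob 0 (Num.sqrt s2).

End Defs.

Definition centered_gaussian (R : realType) (dO : measure_display)
    (O : measurableType dO) (P : probability O R) (d : nat)
    (Z : 'I_d -> {RV P >-> R}) (V : 'M[R]_d) : Prop :=
  forall (u : 'I_d -> R) (B : set R), measurable B ->
    P [set w | B (\sum_(t < d) u t * Z t w)] =
    gauss1 (\sum_(s < d) \sum_(t < d) u s * V s t * u t) B.

(* Main.v *)
Require Import Defs.
From HB Require Import structures.
From mathcomp Require Import all_boot all_order all_algebra.
From mathcomp Require Import all_classical all_reals all_analysis.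
From mathcomp Require Import measurable_realfun zify ring lra.
Import Order.TTheory GRing.Theory Num.Theory.
Import numFieldNormedType.Exports.
Local Open Scope classical_set_scope.
Local Open Scope ring_scope.

(** Write [Y_a] for the centered gradient vector at the letter [a] and
    [S = sum_k Y_(X_k)]. A second-order Taylor expansion shows that the event
    contains [S >= sqrt n * z] as soon as [n |P_n - p|^2 <= 2 log2 n], which
    fails with probability [O(n^-1/2)] because [E exp(|n (P_n - p)|^2 / (5 n))]
    is bounded.

    For the orthant probability of [S], let [T f x = E f (x + Y)] and
    [Q_s f x = E f (x + sqrt s Z)]. Telescoping,
    [T^n Q_1 f - Q_(n+1) f = sum_k (T - Q_1) Q_(n-k) T^k f].
    Every atom of positive mass lies in the range of [V], so the Gaussian Stein
    identity bounds derivatives of [Q_s h] along it by powers of [s^(-1/2)]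
    even for singular [V]. If [f] is a smoothed orthant indicator, then [T^k f]
    is Lipschitz at scale 1 with constant [O(k^(-1/2))], since the scalar
    coordinates of the walk do not concentrate (Fejer kernel); hence the [k]-th
    term is [O(k^(-1/2) / (n - k))] and the sum is [O(log n / sqrt n)].

    The Gaussian vector is only known through its linear marginals, i.e.
    through its characteristic function. The test functions are therefore
    trigonometric polynomials: products of iterated smoothsteps of sines, with
    a period so large that periodicity is never seen. *)

Set Implicit Arguments.
Unset Strict Implicit.
Unset Printing Implicit Defensive.

(** * Integration against the normal density *)

(** The extra unit of Gaussian noise [Q_1] keeps every semigroup time n - k at least 1, so no
    derivative bound is used near its singularity. Its price is a threshold shift of order ln n,
    beyond which the noise has mass O(1/n); on the scale of z this is ln n / sqrt n, and Gaussian
    anticoncentration pays for it. The telescoped sum costs the same order. Only Lipschitz control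
    at scale 1 can be hoped for, since a lattice walk never smooths an indicator below its mesh.

    Coordinates of zero variance do not spread out and are left out of the test functions: there Z_t
    = 0 almost surely, so z_t > 0 makes the Gaussian probability vanish, while z_t <= 0 makes the
    linearized constraint automatic for words of positive weight.

    The constants of b_n are met exactly: the Taylor remainder (kappa + 1) |P_n - p|^2 / 2 is at
    most b_n when n |P_n - p|^2 <= 2 log2 n, and the tail exponent 2 / (5 ln 2) is at least 1/2
    because ln 2 <= 4/5. This is why the factor 5 in the exponential moment may not exceed 4 / ln
    2. *)

Section normal_density_integral.
Variables (R : realType) (s : R).
Local Notation mu := (@lebesgue_measure R).
Local Notation nu := (normal_prob 0 s).
Local Open Scope ereal_scope.

Lemma integral_normal_prob (f : R -> \bar R) :
  nu.-integrable setT f ->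
  \int[nu]_x f x = \int[mu]_x (f x * (normal_pdf 0 s x)%:E).
Proof.
move=> intf; have mf := measurable_int _ intf.
rewrite -(Radon_Nikodym_change_of_variables (normal_prob_dominates 0 s))//=.
apply: ae_eq_integral => //.
- apply: emeasurable_funM => //; apply: (measurable_int mu).
  by apply: Radon_Nikodym_integrable; exact: normal_prob_dominates.
- apply: emeasurable_funM => //=; apply/measurable_EFinP.
  exact: measurable_normal_pdf.
- apply: ae_eqe_mul2l => /=.
  rewrite Radon_NikodymE//=; first exact: normal_prob_dominates.
  move=> abmu; case: cid => /= h [h1 h2 h3].
  apply: integral_ae_eq => //=.
    by apply/measurable_EFinP; exact: measurable_normal_pdf.
  by move=> E _ mE; rewrite -h3.
Qed.

Lemma ge0_integral_normal_prob (f : R -> \bar R) :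
  (forall x, 0 <= f x) -> measurable_fun setT f ->
  \int[nu]_x f x = \int[mu]_x (f x * (normal_pdf 0 s x)%:E).
Proof.
move=> f0 mf.
rewrite -(@Radon_Nikodym_SigmaFinite.change_of_variables _ _ _ nu mu)//; last first.
  exact: normal_prob_dominates.
apply: ae_eq_integral => //.
- apply: emeasurable_funM => //; apply: (measurable_int mu).
  apply: Radon_Nikodym_SigmaFinite.f_integrable; exact: normal_prob_dominates.
- apply: emeasurable_funM => //=; apply/measurable_EFinP.
  exact: measurable_normal_pdf.
- apply: ae_eqe_mul2l => /=.
  apply: integral_ae_eq => //=.
  + apply: Radon_Nikodym_SigmaFinite.f_integrable; exact: normal_prob_dominates.
  + by apply/measurable_EFinP; exact: measurable_normal_pdf.
  + move=> E _ mE; rewrite -Radon_Nikodym_SigmaFinite.f_integral//.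
    exact: normal_prob_dominates.
Qed.

Lemma integrable_normal_prob (f : R -> R) :
  nu.-integrable setT (EFin \o f) ->
  mu.-integrable setT (EFin \o (fun x => f x * normal_pdf 0 s x)%R).
Proof.
move=> /integrableP[mf intf].
have {}mf : measurable_fun setT f by exact/measurable_EFinP.
apply/integrableP; split.
  apply/measurable_EFinP; apply: measurable_funM => //.
  exact: measurable_normal_pdf.
rewrite ge0_integral_normal_prob// in intf; last first.
  by apply: measurableT_comp => //; exact/measurable_EFinP.
apply: le_lt_trans intf; rewrite le_eqVlt; apply/predU1P; left.
apply: eq_integral => x _.
by rewrite /= -EFinM normrM (ger0_norm (normal_pdf_ge0 _ _ _)).
Qed.

End normal_density_integral.

Section gaussian_moments.
Variables (R : realType) (s : R).
Hypothesis s0 : s != 0.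
Local Notation mu := (@lebesgue_measure R).
Local Notation nu := (normal_prob 0 s).

Let s' := Num.sqrt 2 * s.

Let s'0 : s' != 0.
Proof. by rewrite mulf_neq0// gt_eqF// sqrtr_gt0. Qed.

(* |x| - x^2/(2 s^2) <= s^2 - x^2/(4 s^2) *)
Lemma expR_normr_normal_pdf_le (x : R) :
  expR `|x| * normal_pdf 0 s x <=
  expR (s ^+ 2) * normal_peak s / normal_peak s' * normal_pdf 0 s' x.
Proof.
rewrite !normal_pdfE// !mulrA divfK ?gt_eqF ?normal_peak_gt0//.
rewrite mulrAC [leRHS]mulrAC ler_wpM2r ?normal_peak_ge0// /normal_fun -!expRD ler_expR.
rewrite !subr0 /s' exprMn sqr_sqrtr// -[s ^+ 2 *+ 2]mulr_natl -[(2 * s ^+ 2) *+ 2]mulr_natl.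
rewrite -(real_normK (num_real x)); set y := `|x|.
rewrite -subr_ge0.
suff -> : s ^+ 2 + - y ^+ 2 / (2 * (2 * s ^+ 2)) - (y + - y ^+ 2 / (2 * s ^+ 2)) =
  (y / (2 * s) - s) ^+ 2 by rewrite sqr_ge0.
by field.
Qed.

Lemma integral_expR_normr_normal_lty :
  (\int[nu]_x (expR `|x|)%:E < +oo)%E.
Proof.
have mE : measurable_fun setT (fun x : R => (expR `|x|)%:E).
  by apply/measurable_EFinP; apply: measurableT_comp.
rewrite ge0_integral_normal_prob//.
pose C := expR (s ^+ 2) * normal_peak s / normal_peak s'.
apply: (@le_lt_trans _ _ (\int[mu]_x (C * normal_pdf 0 s' x)%:E)%E); last first.
  under eq_integral do rewrite EFinM.
  rewrite integralZl//; last exact: integrable_normal_pdf.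
  by rewrite integral_normal_pdf mule1 ltry.
apply: ge0_le_integral => //=.
- by move=> x _; rewrite -EFinM lee_fin mulr_ge0 ?expR_ge0 ?normal_pdf_ge0.
- under eq_fun do rewrite -EFinM; apply/measurable_EFinP; apply: measurable_funM.
    by apply: measurableT_comp => //.
  exact: measurable_normal_pdf.
- by apply/measurable_EFinP; apply: measurable_funM => //; exact: measurable_normal_pdf.
- by move=> x _; rewrite -EFinM lee_fin expR_normr_normal_pdf_le.
Qed.

End gaussian_moments.

Section integral_derivative.
Variable R : realType.
Local Notation mu := (@lebesgue_measure R).

(** The fundamental theorem on [-n, n] followed by dominated convergence. It serves as integration
    by parts on the whole line, [F] being a product that vanishes at infinity. *)
Lemma integral_derive_eq0 (F f : R -> R) :
  (forall x : R, is_derive x 1 F (f x)) -> continuous f ->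
  mu.-integrable setT (EFin \o f) ->
  F n%:R @[n --> \oo] --> 0 -> F (- n%:R) @[n --> \oo] --> 0 ->
  (\int[mu]_x (f x)%:E = 0)%E.
Proof.
move=> dF cf intf F0 FN0.
have mf : measurable_fun setT f by exact: continuous_measurable_fun.
pose D (n : nat) : set R := `[- n%:R, n%:R]%classic.
pose f_ (n : nat) (x : R) : \bar R := (f x * \1_(D n) x)%:E.
have [] := @dominated_convergence _ _ _ mu _ measurableT f_ (EFin \o f)
  (fun x => `|(f x)%:E|%E).
- move=> n; apply/measurable_EFinP; apply: measurable_funM => //.
  by apply: measurable_indic; exact: measurable_itv.
- exact/measurable_EFinP.
- apply: aeW => x _; apply: cvg_near_cst; near=> n.
  rewrite /f_ indicE mem_set ?mulr1// /D /= in_itv/= -ler_norml.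
  by near: n; exact: nbhs_infty_ger.
- by apply/integrable_abse.
- apply: aeW => x n _; rewrite /f_/= lee_fin normrM ler_piMr// indicE.
  by case: (_ \in _); rewrite ?normr1 ?normr0.
move=> _ _ lim.
(* The shift to [n.+1] keeps the interval nondegenerate, as the fundamental theorem requires. *)
have {}lim : (F n.+1%:R - F (- n.+1%:R))%:E @[n --> \oo] --> (\int[mu]_x (f x)%:E)%E.
  move: lim; rewrite -(cvg_shiftS _) /=.
  apply: cvg_trans; apply: near_eq_cvg; near=> n.
  rewrite (_ : \int[mu]_x f_ n.+1 x = \int[mu]_(x in D n.+1) (f x)%:E)%E; last first.
    rewrite [RHS]integral_mkcond; apply: eq_integral => x _.
    rewrite /f_ patchE indicE; case: ifPn => _; by rewrite ?mulr1 ?mulr0.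
  rewrite (@continuous_FTC2 _ f F)//.
  - by rewrite gtrN ?ltr0n.
  - by apply: continuous_subspaceT => x; exact: cf.
  - have cF : continuous F.
      move=> x; apply: differentiable_continuous; apply/derivable1_diffP.
      by have [] := dF x.
    split.
    + by move=> x _; have [] := dF x.
    + by apply: cvg_at_right_filter; exact: cF.
    + by apply: cvg_at_left_filter; exact: cF.
  - by move=> x _; rewrite derive1E; apply: derive_val.
have lim0 : (F n.+1%:R - F (- n.+1%:R))%:E @[n --> \oo] --> (0 : R)%:E.
  apply: cvg_EFin; first exact: nearW.
  rewrite -[X in _ --> X](subrr (0 : R)); apply: cvgB.
    by rewrite (cvg_shiftS (fun n => F n%:R)).
  by rewrite (cvg_shiftS (fun n => F (- n%:R))).
exact: (cvg_unique _ lim lim0).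
Unshelve. all: by end_near. Qed.

End integral_derivative.

Section bounded_integrable.
Context d (T : measurableType d) (R : realType) (P : probability T R).

Lemma bounded_integrable (f : T -> R) (K : R) :
  measurable_fun setT f -> (forall w, `|f w| <= K) ->
  P.-integrable setT (EFin \o f).
Proof.
move=> mf fK; apply: (@le_integrable _ _ _ P _ measurableT _ (EFin \o cst K)).
- exact/measurable_EFinP.
- by move=> x _ /=; rewrite lee_fin (le_trans (fK x))// ler_norm.
- exact: finite_measure_integrable_cst.
Qed.

Lemma integrable_of_le_normr (f g : T -> R) :
  measurable_fun setT f -> (forall w, `|f w| <= g w) ->
  P.-integrable setT (EFin \o g) ->
  P.-integrable setT (EFin \o f).
Proof.
move=> mf fg intg; apply: (le_integrable _ _ _ intg) => //.
- exact/measurable_EFinP.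
- by move=> x _ /=; rewrite lee_fin (le_trans (fg x))// ler_norm.
Qed.

End bounded_integrable.

(** * Characteristic function of the normal law through the Stein identity *)

Section normal_characteristic_function.
Variables (R : realType) (s : R).
Hypothesis s0 : s != 0.
Local Notation mu := (@lebesgue_measure R).
Local Notation nu := (normal_prob 0 s).

Lemma normal_integrable_expR_normr :
  nu.-integrable setT (EFin \o (fun x : R => expR `|x|)).
Proof.
apply/integrableP; split.
  by apply/measurable_EFinP; apply: measurableT_comp.
under eq_integral do rewrite /= ger0_norm ?expR_ge0//.
exact: integral_expR_normr_normal_lty.
Qed.

Lemma normal_integrable_normr :
  nu.-integrable setT (EFin \o (fun x : R => `|x|)).
Proof.
apply: integrable_of_le_normr normal_integrable_expR_normr.
  exact: measurableT_comp.
by move=> x; rewrite normr_id; have := expR_ge1Dx `|x|; lra.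
Qed.

Let mcos t c : measurable_fun setT (fun x : R => cos (t * x + c)).
Proof.
apply: measurableT_comp; first by apply: continuous_measurable_fun; exact: continuous_cos.
by apply: measurable_funD => //; exact: measurable_funM.
Qed.

Let msin t c : measurable_fun setT (fun x : R => sin (t * x + c)).
Proof.
apply: measurableT_comp; first by apply: continuous_measurable_fun; exact: continuous_sin.
by apply: measurable_funD => //; exact: measurable_funM.
Qed.

Let icos t c : nu.-integrable setT (EFin \o (fun x : R => cos (t * x + c))).
Proof. by apply: (@bounded_integrable _ _ _ _ _ 1) => [|x]; [exact: mcos|exact: cos_max]. Qed.

Let ixsin t c : nu.-integrable setT (EFin \o (fun x : R => x * sin (t * x + c))).
Proof.
apply: integrable_of_le_normr normal_integrable_normr.
  by apply: measurable_funM => //; exact: msin.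
by move=> x; rewrite normrM ler_piMr// sin_max.
Qed.

Let is_derive_pdf (x : R) : is_derive x 1 (normal_pdf 0 s)
  (- (x / s ^+ 2) * normal_pdf 0 s x).
Proof.
rewrite normal_pdfE// /normal_fun.
have -> : (fun x : R => normal_peak s * expR (- (x - 0) ^+ 2 / (s ^+ 2 *+ 2))) =
   (fun x : R => normal_peak s * expR (- (2 * s ^+ 2)^-1 * x ^+ 2)).
  apply/funext => y; rewrite subr0 -[s ^+ 2 *+ 2]mulr_natl; congr (_ * expR _).
  by rewrite mulNr mulNr mulrC.
apply: is_derive_eq.
rewrite subr0 -[s ^+ 2 *+ 2]mulr_natl /GRing.scale/=.
rewrite (_ : - x ^+ 2 / (2 * s ^+ 2) = - (2 * s ^+ 2)^-1 * x ^+ 2); last first.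
  by rewrite mulNr mulNr mulrC.
by field.
Qed.

(** Since the density satisfies phi' = - (x / s^2) phi, the difference of the two integrands of the
    Stein identity is an exact derivative. *)
Let stein_density t c (x : R) : is_derive x 1
  (fun x => - s ^+ 2 * (sin (t * x + c) * normal_pdf 0 s x))
  (x * sin (t * x + c) * normal_pdf 0 s x - s ^+ 2 * t * (cos (t * x + c) * normal_pdf 0 s x)).
Proof.
have := is_derive_pdf x => ?.
apply: is_derive_eq.
by rewrite /GRing.scale/=; field.
Qed.

Let pdf_le_expR : exists2 C : R, 0 <= C & forall x, normal_pdf 0 s x <= C * expR (- `|x|).
Proof.
have [C C0 H] : exists2 C : R, 0 <= C & forall x, expR `|x| * normal_pdf 0 s x <= C.
  pose s' := Num.sqrt 2 * s.
  have s'0 : s' != 0 by rewrite mulf_neq0// gt_eqF// sqrtr_gt0.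
  exists (expR (s ^+ 2) * normal_peak s / normal_peak s' * normal_peak s').
    by rewrite !mulr_ge0 ?invr_ge0 ?expR_ge0 ?normal_peak_ge0.
  move=> x; apply: le_trans (expR_normr_normal_pdf_le s0 x) _.
  rewrite ler_wpM2l ?normal_pdf_ub//.
  by rewrite !mulr_ge0 ?invr_ge0 ?expR_ge0 ?normal_peak_ge0.
exists C => // x; have := H x.
by rewrite expRN ler_pdivlMr ?expR_gt0// mulrC.
Qed.

Let pdf_cvg0 (x_ : nat -> R) : (forall n, `|x_ n| = n%:R) ->
  forall t c, (- s ^+ 2 * (sin (t * x_ n + c) * normal_pdf 0 s (x_ n))) @[n --> \oo] --> 0.
Proof.
move=> xn t c; have [C C0 H] := pdf_le_expR.
rewrite -[X in _ --> X](mulr0 (- s ^+ 2)); apply: cvgMr.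
apply: norm_cvg0.
apply: (@squeeze_cvgr _ _ _ _ (cst 0) (fun n => C * (n.+1%:R)^-1)).
- near=> n; rewrite normr_ge0/= normrM (@le_trans _ _ (normal_pdf 0 s (x_ n)))//.
    by rewrite (ger0_norm (normal_pdf_ge0 _ _ _)) ler_piMl ?normal_pdf_ge0// sin_max.
  apply: le_trans (H _) _; rewrite ler_wpM2l// xn expRN lef_pV2 ?posrE ?expR_gt0//.
  by have := expR_ge1Dx (n%:R : R); rewrite -natr1; lra.
- exact: cvg_cst.
- rewrite -[X in _ --> X](mulr0 C); apply: cvgMr.
  exact: cvg_harmonic.
Unshelve. all: by end_near. Qed.

Lemma normal_stein_sin t c :
  \int[nu]_x (x * sin (t * x + c)) = s ^+ 2 * t * \int[nu]_x (cos (t * x + c)).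
Proof.
have sE : (\int[nu]_x (x * sin (t * x + c))%:E =
    \int[mu]_x (x * sin (t * x + c) * normal_pdf 0 s x)%:E)%E.
  by rewrite integral_normal_prob//; exact: ixsin.
have cE : (\int[nu]_x (cos (t * x + c))%:E =
    \int[mu]_x (cos (t * x + c) * normal_pdf 0 s x)%:E)%E.
  by rewrite integral_normal_prob//; exact: icos.
have i1 := integrable_normal_prob (ixsin t c).
have i2 := integrable_normal_prob (icos t c).
have i3 : mu.-integrable setT (EFin \o (fun x => s ^+ 2 * t * (cos (t * x + c) * normal_pdf 0 s x))).
  by have := integrableZl measurableT (s ^+ 2 * t) i2; apply: eq_integrable => // x _.
have : (\int[mu]_x (x * sin (t * x + c) * normal_pdf 0 s x -
   s ^+ 2 * t * (cos (t * x + c) * normal_pdf 0 s x))%:E = 0)%E.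
  apply: (integral_derive_eq0 (stein_density t c)).
  - move=> x; have cpdf := @continuous_normal_pdf _ 0 s s0 x.
    have ct : {for x, continuous (fun x : R => t * x + c)}.
      by apply: cvgD; [apply: cvgMr; exact: cvg_id|exact: cvg_cst].
    have csin : {for x, continuous (fun x : R => sin (t * x + c))}.
      by apply: (cvg_comp _ sin ct); exact: continuous_sin.
    have ccos : {for x, continuous (fun x : R => cos (t * x + c))}.
      by apply: (cvg_comp _ cos ct); exact: continuous_cos.
    apply: cvgB.
      apply: cvgM => //; apply: cvgM => //; exact: cvg_id.
    by apply: cvgMr; apply: cvgM.
  - by have := integrableB measurableT i1 i3; apply: eq_integrable => // x _.
  - by apply: pdf_cvg0 => n; rewrite ger0_norm.
  - by apply: pdf_cvg0 => n; rewrite normrN ger0_norm.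
move=> /(congr1 fine) /=; rewrite -/(Rintegral _ _ _) RintegralB// RintegralZl//.
by move=> /eqP; rewrite subr_eq0 => /eqP; rewrite /Rintegral sE cE.
Qed.

(** Differentiation under the integral produces the left side of [normal_stein_sin], hence the
    linear equation psi' = - s^2 t psi. The free phase [c] treats cosine and sine together. *)
Lemma is_derive_normal_char (t c : R) :
  is_derive t 1 (fun t => \int[nu]_x (cos (t * x + c)))
    (- (s ^+ 2 * t * \int[nu]_x (cos (t * x + c)))).
Proof.
pose f (t : R) (x : R) := cos (t * x + c).
have df (u x : R) : is_derive u 1 (f ^~ x) (- (x * sin (u * x + c))).
  by apply: is_derive_eq; rewrite /GRing.scale/=; ring.
have dfE u x : partial1of2 f u x = - (x * sin (u * x + c)).
  by rewrite partial1of2E; apply: derive_val.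
have It : [set` `]t - 1, t + 1[ ] t by rewrite /= in_itv/=; lra.
have H1 : forall x, [set` `]t - 1, t + 1[ ] x -> nu.-integrable setT (EFin \o f x).
  by move=> x _; exact: icos.
have H2 : forall u x, [set` `]t - 1, t + 1[ ] u -> [set: R] x -> derivable (f ^~ x) u 1.
  by move=> u x _ _; have [] := df u x.
have H3 : forall u x, [set` `]t - 1, t + 1[ ] u -> [set: R] x -> `|partial1of2 f u x| <= `|x|.
  by move=> u x _ _; rewrite dfE normrN normrM ler_piMr// sin_max.
have dd := @derivable_under_integral R _ _ nu f setT measurableT t (t - 1) (t + 1) It H1 H2
  (fun x => `|x|) (fun x => normr_ge0 x) normal_integrable_normr H3.
have := @differentiation_under_integral R _ _ nu f setT measurableT t (t - 1) (t + 1) It H1 H2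
  (fun x => `|x|) (fun x => normr_ge0 x) normal_integrable_normr H3.
rewrite derive1E => de; apply: DeriveDef => //; rewrite de.
under eq_Rintegral do rewrite dfE.
rewrite -normal_stein_sin -mulN1r -(RintegralZl _ measurableT (ixsin t c)).
by apply: eq_Rintegral => x _; rewrite mulN1r.
Qed.

Lemma normal_char (t c : R) :
  \int[nu]_x (cos (t * x + c)) = expR (- (s ^+ 2 * t ^+ 2 / 2)) * cos c.
Proof.
pose psi (t : R) := \int[nu]_x (cos (t * x + c)).
have H (u : R) : is_derive u 1 (fun t => expR (s ^+ 2 * t ^+ 2 / 2) * psi t) 0.
  have := is_derive_normal_char u c => ?.
  apply: is_derive_eq; by rewrite /GRing.scale/= -/(psi _); field.
have := is_derive_0_is_cst t 0 H.
rewrite {2}/psi expr0n/= mulr0 mul0r expR0 mul1r.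
under eq_Rintegral do rewrite mul0r add0r.
rewrite Rintegral_cst//; have -> : fine (nu setT) = 1.
  by rewrite (_ : nu setT = 1%E)//; exact: (integral_normal_pdf 0 s).
rewrite mulr1 -/(psi t) => <-.
by rewrite mulrA -expRD addNr expR0 mul1r.
Qed.

End normal_characteristic_function.

(** * Gaussian laws *)

Section gaussian_law.
Context (R : realType) (dO : measure_display) (O : measurableType dO) (P : probability O R).
Variables (X : O -> R) (v : R).
Hypothesis mX : measurable_fun setT X.
Hypothesis v0 : 0 <= v.
Hypothesis lawX : forall B : set R, measurable B -> P (X @^-1` B) = gauss1 v B.

(* [normal_prob] lives on [measurableTypeR R], whose display differs from the
   default one of [R]. *)
Let mX' : @measurable_fun _ _ O (measurableTypeR R) setT X.
Proof. exact: mX. Qed.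

Let Y : {RV P >-> measurableTypeR R} := @mfun_Sub _ _ O (measurableTypeR R) X (mem_set mX').

Let lawE (f : measurableTypeR R -> \bar R) : v != 0 ->
  (\int[distribution P Y]_x f x = \int[normal_prob 0 (Num.sqrt v)]_x f x)%E.
Proof.
move=> vn0; apply: eq_measure_integral => A mA _.
by rewrite [LHS]lawX// /gauss1 (negbTE vn0).
Qed.

Let lawE0 (f : measurableTypeR R -> \bar R) : v = 0 -> measurable_fun setT f ->
  (\int[distribution P Y]_x f x)%E = f (0 : R)%R.
Proof.
move=> vn0 mf; rewrite (@eq_measure_integral _ _ _ _ \d_((0 : R) : measurableTypeR R)).
  by rewrite integral_dirac// diracT mul1e.
by move=> A mA _; rewrite [LHS]lawX// /gauss1 vn0 eqxx.
Qed.

Let sv0 : v != 0 -> Num.sqrt v != 0.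
Proof. by move=> vn0; rewrite gt_eqF// sqrtr_gt0 lt_neqAle eq_sym vn0. Qed.

Lemma gaussian_integrable_expR_normr :
  P.-integrable setT (EFin \o (fun w => expR `|X w|)).
Proof.
have mE : measurable_fun setT (fun x : R => (expR `|x|)%:E).
  by apply/measurable_EFinP; apply: measurableT_comp.
apply/integrableP; split.
  apply: (measurableT_comp mE); exact: mX.
under eq_integral do rewrite /= ger0_norm ?expR_ge0//.
rewrite -(@ge0_integral_distribution _ _ _ _ _ P Y (fun x : R => (expR `|x|)%:E))//.
have [vn0|vn0] := eqVneq v 0; first by rewrite lawE0// ltry.
by rewrite lawE// integral_expR_normr_normal_lty// sv0.
Qed.

Lemma gaussian_char c :
  \int[P]_w (cos (X w + c)) = expR (- (v / 2)) * cos c.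
Proof.
have mE : measurable_fun setT (fun x : R => (cos (1 * x + c))%:E).
  apply/measurable_EFinP; apply: measurableT_comp.
    by apply: continuous_measurable_fun; exact: continuous_cos.
  by apply: measurable_funD => //; exact: measurable_funM.
have <- : \int[distribution P Y]_x (cos (1 * x + c)) = \int[P]_w (cos (X w + c)).
  rewrite /Rintegral integral_distribution//.
    by congr fine; apply: eq_integral => x _; rewrite /= mul1r.
  apply: (@bounded_integrable _ _ _ _ _ 1) => [|w].
    by apply/measurable_EFinP; apply: (measurableT_comp mE); exact: mX.
  exact: cos_max.
rewrite /Rintegral; have [vn0|vn0] := eqVneq v 0.
  by rewrite lawE0//= vn0 mul0r oppr0 expR0 mulr0 add0r mul1r.
rewrite lawE// -/(Rintegral _ _ _) normal_char ?sv0// sqr_sqrtr//.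
by rewrite expr1n mulr1.
Qed.

Lemma gaussian_anticoncentration (a b : R) : v != 0 -> a <= b ->
  (P (X @^-1` `[a, b]) <= ((b - a) * normal_peak (Num.sqrt v))%:E)%E.
Proof.
move=> vn0 ab; rewrite lawX// /gauss1 (negbTE vn0) /normal_prob.
apply: (@le_trans _ _ (\int[lebesgue_measure]_(x in `[a, b]) (normal_peak (Num.sqrt v))%:E))%E.
  apply: ge0_le_integral => //=.
  - by move=> x _; rewrite lee_fin normal_pdf_ge0.
  - apply/measurable_EFinP; apply: measurable_funTS; exact: measurable_normal_pdf.
  - by move=> x _; rewrite lee_fin normal_pdf_ub// sv0.
rewrite integral_cst//= lebesgue_measure_itv/= lte_fin.
case: ltP => [_|_]; last by rewrite mule0 lee_fin mulr_ge0 ?subr_ge0 ?normal_peak_ge0.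
by rewrite -EFinD -EFinM mulrC.
Qed.

(** Markov's inequality for exp |X|. This rate suffices because [l] will be ln n, so that the tail
    is O(1/n). *)
Lemma gaussian_tail (l : R) :
  (P [set w | (l <= `|X w|)%R] <= ((\int[P]_w expR `|X w|)%R * expR (- l))%:E)%E.
Proof.
have iE := gaussian_integrable_expR_normr.
have mS : measurable [set w | l <= `|X w|].
  rewrite (_ : [set w | _] = (fun w => `|X w|) @^-1` `[l, +oo[%classic).
    by rewrite -[X in measurable X]setTI; apply: measurableT_comp.
  by apply/seteqP; split => w /=; rewrite in_itv/= andbT.
rewrite EFinM muleC expRN lee_pdivlMl ?expR_gt0//.
rewrite /Rintegral fineK ?integrable_fin_num// -integral_cst//.
rewrite integral_mkcond; apply: ge0_le_integral => //.
- by move=> w _; rewrite patchE; case: ifP => // _; rewrite lee_fin expR_ge0.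
- by apply/(measurable_restrictT _ _).1.
- by have /integrableP[] := iE.
- move=> w _; rewrite patchE; case: ifPn => [|_]; last by rewrite lee_fin expR_ge0.
  by rewrite inE/= => lX; rewrite lee_fin ler_expR.
Qed.

End gaussian_law.

(** * Gaussian vectors *)

Section dot_product.
Variables (R : realType) (d : nat).
Implicit Types (u v w : 'rV[R]_d) (a : R).

Definition dot u v : R := \sum_(t < d) u 0 t * v 0 t.

Lemma dotC u v : dot u v = dot v u.
Proof. by apply: eq_bigr => t _; rewrite mulrC. Qed.

Lemma dotDr u v w : dot u (v + w) = dot u v + dot u w.
Proof. by rewrite -big_split; apply: eq_bigr => t _; rewrite /= mxE mulrDr. Qed.

Lemma dotDl u v w : dot (u + v) w = dot u w + dot v w.
Proof. by rewrite dotC dotDr !(dotC w). Qed.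

Lemma dotZr a u v : dot u (a *: v) = a * dot u v.
Proof. by rewrite mulr_sumr; apply: eq_bigr => t _; rewrite mxE mulrCA. Qed.

Lemma dotZl a u v : dot (a *: u) v = a * dot u v.
Proof. by rewrite dotC dotZr dotC. Qed.

Lemma dot0r u : dot u 0 = 0.
Proof. by rewrite -(scale0r 0) dotZr mul0r. Qed.

Lemma dot0l u : dot 0 u = 0.
Proof. by rewrite dotC dot0r. Qed.

Lemma dotNr u v : dot u (- v) = - dot u v.
Proof. by rewrite -scaleN1r dotZr mulN1r. Qed.

Lemma dot_mulmx u v (V : 'M[R]_d) : dot u (v *m V^T) = dot (u *m V) v.
Proof.
rewrite /dot; under eq_bigr do rewrite mxE mulr_sumr.
rewrite exchange_big; apply: eq_bigr => t _; rewrite mxE mulr_suml.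
by apply: eq_bigr => k _; rewrite mxE; ring.
Qed.

Lemma dot_delta u t : dot (delta_mx 0 t) u = u 0 t.
Proof.
rewrite /dot (bigD1 t)//= mxE !eqxx mul1r big1 ?addr0// => k kt.
by rewrite mxE (negbTE kt) andbF mul0r.
Qed.

End dot_product.

Section gaussian_vector.
Context (R : realType) (dO : measure_display) (O : measurableType dO) (P : probability O R).
Variables (d : nat) (Z : 'I_d -> {RV P >-> R}) (V : 'M[R]_d).
Hypothesis HG : centered_gaussian Z V.
Hypothesis Vsym : V^T = V.
Hypothesis Vpsd : forall u, 0 <= dot u (u *m V).

Definition zvec (w : O) : 'rV[R]_d := \row_t Z t w.

Lemma measurable_dot_zvec u : measurable_fun setT (fun w => dot u (zvec w)).
Proof.
apply: measurable_sum => t.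
by apply: measurable_funM => //; under eq_fun do rewrite mxE; exact: measurable_funPT.
Qed.

Lemma dot_zvec_law u B : measurable B ->
  P ((fun w => dot u (zvec w)) @^-1` B) = gauss1 (dot u (u *m V)) B.
Proof.
move=> mB; have := HG (fun t => u 0 t) mB.
rewrite (_ : [set w | _] = (fun w => \sum_t u 0 t * Z t w) @^-1` B)//.
rewrite (_ : (fun w => \sum_t u 0 t * Z t w) = fun w => dot u (zvec w)); last first.
  apply/funext => w /=.
  by apply: eq_bigr => t _; rewrite mxE.
move=> ->; congr gauss1; rewrite exchange_big; apply: eq_bigr => t _.
by rewrite mxE mulr_sumr; apply: eq_bigr => k _; rewrite mulrC mulrA.
Qed.

Lemma dot_zvec_expR_integrable u :
  P.-integrable setT (EFin \o (fun w => expR `|dot u (zvec w)|)).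
Proof.
exact: (gaussian_integrable_expR_normr (measurable_dot_zvec u) (Vpsd u) (@dot_zvec_law u)).
Qed.

Lemma dot_zvec_char u c :
  \int[P]_w (cos (dot u (zvec w) + c)) = expR (- (dot u (u *m V) / 2)) * cos c.
Proof.
exact: (gaussian_char (measurable_dot_zvec u) (Vpsd u) (@dot_zvec_law u)).
Qed.

Lemma dot_zvec_integrable u :
  P.-integrable setT (EFin \o (fun w => `|dot u (zvec w)|)).
Proof.
apply: integrable_of_le_normr (dot_zvec_expR_integrable u).
  by apply: measurableT_comp => //; exact: measurable_dot_zvec.
by move=> w; rewrite normr_id; have := expR_ge1Dx `|dot u (zvec w)|; lra.
Qed.

Lemma dot_zvec_sqr_integrable u :
  P.-integrable setT (EFin \o (fun w => dot u (zvec w) ^+ 2)).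
Proof.
have i2 : P.-integrable setT (EFin \o (fun w => 2 * expR `|dot u (zvec w)|)).
  have := integrableZl measurableT 2 (dot_zvec_expR_integrable u).
  by apply: eq_integrable => // w _.
apply: integrable_of_le_normr i2.
  by apply: measurable_funX; exact: measurable_dot_zvec.
move=> w; rewrite ger0_norm ?sqr_ge0// -(real_normK (num_real _)).
have := @expR_ge1Dxn R `|dot u (zvec w)| 1 (normr_ge0 _).
by rewrite (_ : 2`!%:R = 2 :> R)//; lra.
Qed.

Lemma dot_zvecM_integrable u v :
  P.-integrable setT (EFin \o (fun w => `|dot u (zvec w)| * `|dot v (zvec w)|)).
Proof.
have i2 := integrableD measurableT (dot_zvec_sqr_integrable u) (dot_zvec_sqr_integrable v).
have {}i2 : P.-integrable setT (EFin \o (fun w => dot u (zvec w) ^+ 2 + dot v (zvec w) ^+ 2)).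
  by apply: eq_integrable i2 => // w _.
apply: integrable_of_le_normr i2.
  by apply: measurable_funM; apply: measurableT_comp => //; exact: measurable_dot_zvec.
move=> w; rewrite ger0_norm ?mulr_ge0//.
rewrite -(real_normK (num_real (dot u _))) -(real_normK (num_real (dot v _))).
by have := sqr_ge0 (`|dot u (zvec w)| - `|dot v (zvec w)|); nra.
Qed.

Let quadD w u h : dot (w + h *: u) ((w + h *: u) *m V) =
  dot w (w *m V) + h * (2 * dot w (u *m V)) + h ^+ 2 * dot u (u *m V).
Proof.
rewrite mulmxDl -scalemxAl !dotDl !dotDr !dotZl !dotZr.
have -> : dot u (w *m V) = dot w (u *m V).
  by rewrite -[in LHS]Vsym dot_mulmx dotC.
by ring.
Qed.

(** Derivative at h = 0 of the characteristic function at frequency w + h u: under the integral it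
    gives the left side, on the closed formula the right side. This yields Gaussian integration by
    parts from the linear marginals alone. *)
Lemma dot_zvec_stein u w c :
  \int[P]_o (dot u (zvec o) * cos (dot w (zvec o) + c)) =
  - (dot w (u *m V) * expR (- (dot w (w *m V) / 2)) * sin c).
Proof.
pose f (h : R) (o : O) := sin (dot (w + h *: u) (zvec o) + c).
have fE h o : f h o = sin (dot w (zvec o) + h * dot u (zvec o) + c).
  by rewrite /f dotDl dotZl.
(* A sine is a cosine with phase shifted by pi / 2, so [dot_zvec_char] covers it. *)
have fc h o : f h o = cos (dot (w + h *: u) (zvec o) + (c - pi / 2)).
  by rewrite addrA cosBpihalf.
have df (h : R) o : is_derive h 1 (f ^~ o) (dot u (zvec o) * cos (dot w (zvec o) + h * dot u (zvec o) + c)).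
  rewrite (_ : f ^~ o = fun h => sin (dot w (zvec o) + h * dot u (zvec o) + c)); last first.
    by apply/funext => k.
  by apply: is_derive_eq; rewrite /GRing.scale/=; ring.
have dfE h o : partial1of2 f h o = dot u (zvec o) * cos (dot w (zvec o) + h * dot u (zvec o) + c).
  by rewrite partial1of2E; apply: derive_val.
have I0 : [set` `](-1 : R), 1[ ] 0 by rewrite /= in_itv/=; lra.
have H1 : forall h, [set` `](-1 : R), 1[ ] h -> P.-integrable setT (EFin \o f h).
  move=> h _; apply: (@bounded_integrable _ _ _ _ _ 1) => [|o]; last exact: sin_max.
  apply: measurableT_comp; first by apply: continuous_measurable_fun; exact: continuous_sin.
  by apply: measurable_funD => //; exact: measurable_dot_zvec.
have H2 : forall h o, [set` `](-1 : R), 1[ ] h -> [set: O] o -> derivable (f ^~ o) h 1.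
  by move=> h o _ _; have [] := df h o.
have H3 : forall h o, [set` `](-1 : R), 1[ ] h -> [set: O] o ->
    `|partial1of2 f h o| <= `|dot u (zvec o)|.
  by move=> h o _ _; rewrite dfE normrM ler_piMr// cos_max.
have := @differentiation_under_integral R _ _ P f setT measurableT 0 (-1) 1 I0 H1 H2
  _ (fun o => normr_ge0 _) (dot_zvec_integrable u) H3.
under [X in _ = X -> _]eq_Rintegral do rewrite dfE mul0r addr0.
move=> <-; rewrite (_ : (fun h => \int[P]_o f h o) = fun h =>
   expR (- ((dot w (w *m V) + h * (2 * dot w (u *m V)) + h ^+ 2 * dot u (u *m V)) / 2)) * sin c).
  rewrite derive1E; apply: derive_val.
  apply: is_derive_eq; rewrite /GRing.scale/= mul0r expr0n/= mul0r !addr0.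
  by field.
apply/funext => h; under eq_Rintegral do rewrite fc.
by rewrite dot_zvec_char quadD cosBpihalf.
Qed.

Lemma dot_zvec_mean u : \int[P]_o (dot u (zvec o)) = 0.
Proof.
have := dot_zvec_stein u 0 0; rewrite dot0l mul0r mul0r oppr0 => <-.
by apply: eq_Rintegral => o _; rewrite dot0l add0r cos0 mulr1.
Qed.

End gaussian_vector.

(** * Trigonometric polynomials *)

Section taylor01.
Variable R : realType.

Lemma mvt01_bound (f f' : R -> R) (B x : R) :
  (forall x : R, is_derive x 1 f (f' x)) ->
  (forall y, 0 <= y <= 1 -> `|f' y| <= B) -> 0 <= x <= 1 ->
  `|f x - f 0| <= B.
Proof.
move=> df Bf /andP[x0 x1].
have B0 : 0 <= B by apply: le_trans (Bf 0 _); rewrite ?lexx ?ler01.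
have [c] := @MVT_segment R f f' 0 x x0 (fun y _ => df y)
  (derivable_within_continuous (fun y _ => @ex_derive _ _ _ _ _ _ _ (df y))).
rewrite in_itv/= => /andP[c0 cx] ->; rewrite subr0 normrM (ger0_norm x0).
by rewrite -[leRHS]mulr1; apply: ler_pM => //; apply: Bf; rewrite c0 (le_trans cx).
Qed.

(** Subtracting the linear term reduces the claim to the mean value bound for the derivative. The
    factorials are given up, here and at third order, since only the order of the error matters for
    the telescope. *)
Lemma taylor2_01_bound (f f1 f2 : R -> R) (B x : R) :
  (forall x : R, is_derive x 1 f (f1 x)) -> (forall x : R, is_derive x 1 f1 (f2 x)) ->
  (forall y, 0 <= y <= 1 -> `|f2 y| <= B) -> 0 <= x <= 1 ->
  `|f x - f 0 - x * f1 0| <= B.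
Proof.
move=> df df1 Bf x01.
have := @mvt01_bound (fun x => f x - x * f1 0) (fun x => f1 x - f1 0) B x.
rewrite mul0r subr0 addrAC; apply => // [y|y y01]; last exact: (mvt01_bound df1).
by apply: is_derive_eq; rewrite /GRing.scale/= mulr0 add0r mulr1.
Qed.

Lemma taylor3_01_bound (f f1 f2 f3 : R -> R) (B : R) :
  (forall x : R, is_derive x 1 f (f1 x)) -> (forall x : R, is_derive x 1 f1 (f2 x)) ->
  (forall x : R, is_derive x 1 f2 (f3 x)) ->
  (forall y, 0 <= y <= 1 -> `|f3 y| <= B) ->
  `|f 1 - f 0 - f1 0 - f2 0 / 2| <= B.
Proof.
move=> df df1 df2 Bf.
have := @mvt01_bound (fun x => f x - x * f1 0 - x ^+ 2 * (f2 0 / 2))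
  (fun x => f1 x - f1 0 - x * f2 0) B 1.
rewrite mul0r expr0n/= mul0r !subr0 expr1n !mul1r.
rewrite (_ : f 1 - f1 0 - f2 0 / 2 - f 0 = f 1 - f 0 - f1 0 - f2 0 / 2); last by ring.
apply => // [y|y y01|]; last by rewrite ler01 lexx.
  by apply: is_derive_eq; rewrite /GRing.scale/=; field.
exact: (taylor2_01_bound df1 df2).
Qed.

End taylor01.

Section trig_poly.
Variables (R : realType) (d : nat).
Implicit Types (l : seq (R * 'rV[R]_d * R)) (x y u : 'rV[R]_d).

(* The entry [(a, u, c)] stands for the function [x |-> a * cos (<u, x> + c)]. *)
Definition tpeval l x : R := \sum_(i <- l) i.1.1 * cos (dot i.1.2 x + i.2).

Definition is_tp (f : 'rV[R]_d -> R) := exists l, f = tpeval l.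

Lemma is_tp_cos u c : is_tp (fun x => cos (dot u x + c)).
Proof.
by exists [:: (1, u, c)]; apply/funext => x; rewrite /tpeval big_seq1 mul1r.
Qed.

Lemma is_tp_cst (a : R) : is_tp (fun=> a).
Proof.
exists [:: (a, 0, 0)]; apply/funext => x.
by rewrite /tpeval big_seq1/= dot0l addr0 cos0 mulr1.
Qed.

Lemma is_tpD f g : is_tp f -> is_tp g -> is_tp (fun x => f x + g x).
Proof.
move=> [lf ->] [lg ->]; exists (lf ++ lg); apply/funext => x.
by rewrite /tpeval big_cat.
Qed.

(** The product formula cos a cos b = (cos (a + b) + cos (a - b)) / 2, applied to each pair of
    entries. *)
Lemma is_tpM f g : is_tp f -> is_tp g -> is_tp (fun x => f x * g x).
Proof.
move=> [lf ->] [lg ->].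
exists (flatten [seq flatten [seq [:: (i.1.1 * j.1.1 / 2, i.1.2 + j.1.2, i.2 + j.2);
    (i.1.1 * j.1.1 / 2, i.1.2 - j.1.2, i.2 - j.2)] | j <- lg] | i <- lf]).
apply/funext => x; rewrite /tpeval big_flatten big_map mulr_suml.
apply: eq_bigr => i _; rewrite big_flatten big_map mulr_sumr.
apply: eq_bigr => j _; rewrite big_cons big_seq1/= !dotDl -scaleN1r dotZl mulN1r.
set a := dot i.1.2 x; set b := dot j.1.2 x.
rewrite (_ : a + b + (i.2 + j.2) = (a + i.2) + (b + j.2)); last by ring.
rewrite (_ : a - b + (i.2 - j.2) = (a + i.2) - (b + j.2)); last by ring.
rewrite (cosD (a + i.2)) cosB.
by field.
Qed.

Lemma is_tpZ (a : R) f : is_tp f -> is_tp (fun x => a * f x).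
Proof. exact/is_tpM/is_tp_cst. Qed.

Lemma is_tp_prod (I : Type) (r : seq I) (f : I -> 'rV[R]_d -> R) :
  (forall i, is_tp (f i)) -> is_tp (fun x => \prod_(i <- r) f i x).
Proof.
move=> H; elim: r => [|i r IH].
  by under eq_fun do rewrite big_nil; exact: is_tp_cst.
by under eq_fun do rewrite big_cons; exact: is_tpM.
Qed.

(** Directional derivative along [y]; writing - sin as a cosine of phase pi / 2 keeps derivatives
    inside the representation. *)
Definition tpD y l := [seq (i.1.1 * dot i.1.2 y, i.1.2, i.2 + pi / 2) | i <- l].

Lemma tpeval_derive l x y (h : R) :
  is_derive h 1 (fun h => tpeval l (x + h *: y)) (tpeval (tpD y l) (x + h *: y)).
Proof.
elim: l => [|i l IH].
  rewrite /tpeval /tpD/= big_nil (_ : (fun h => _) = cst 0); first exact: is_derive_cst.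
  by apply/funext => k; rewrite big_nil.
have -> : (fun h => tpeval (i :: l) (x + h *: y)) =
    (fun h => i.1.1 * cos (dot i.1.2 x + h * dot i.1.2 y + i.2) + tpeval l (x + h *: y)).
  by apply/funext => k; rewrite /tpeval big_cons dotDr dotZr.
apply: is_derive_eq.
rewrite [in RHS]/tpeval big_cons -/(tpeval _ _) -/(tpD _ _) /=; congr (_ + _).
by rewrite addrA cosDpihalf dotDr dotZr /GRing.scale/=; ring.
Qed.

Variable V : 'M[R]_d.
Local Notation q u := (dot u (u *m V)).

(* The Gaussian semigroup with covariance [s *: V] acts diagonally. *)
Definition tpQ (s : R) l := [seq (i.1.1 * expR (- (s * q i.1.2 / 2)), i.1.2, i.2) | i <- l].

(** The operator tr(V Hess), twice the generator of the semigroup: [tpQ V s] is exp (s L / 2). *)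
Definition tpL l := [seq (i.1.1 * - q i.1.2, i.1.2, i.2) | i <- l].

Lemma tpQ_add s t l : tpQ s (tpQ t l) = tpQ (s + t) l.
Proof.
rewrite /tpQ -map_comp; apply: eq_map => i /=; congr (_, _, _).
by rewrite -mulrA -expRD; congr (_ * expR _); ring.
Qed.

(** All these operators act frequency by frequency, as Fourier multipliers and phase shifts, so they
    commute already at the level of lists. No derivative has to be moved under a Gaussian
    integral. *)
Lemma tpQ_D s y l : tpQ s (tpD y l) = tpD y (tpQ s l).
Proof.
by rewrite /tpQ /tpD -!map_comp; apply: eq_map => i /=; congr (_, _, _); ring.
Qed.

Lemma tpQ_L s l : tpQ s (tpL l) = tpL (tpQ s l).
Proof.
by rewrite /tpQ /tpL -!map_comp; apply: eq_map => i /=; congr (_, _, _); ring.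
Qed.

Lemma tpL_D y l : tpL (tpD y l) = tpD y (tpL l).
Proof.
by rewrite /tpL /tpD -!map_comp; apply: eq_map => i /=; congr (_, _, _); ring.
Qed.

Lemma tpeval_Q0 l : tpeval (tpQ 0 l) = tpeval l.
Proof.
apply/funext => x; rewrite /tpeval big_map; apply: eq_bigr => i _ /=.
by rewrite !mul0r oppr0 expR0 mulr1.
Qed.

Lemma tpeval_Q_derive l x (s : R) :
  is_derive s 1 (fun s => tpeval (tpQ s l) x) (tpeval (tpL (tpQ s l)) x / 2).
Proof.
elim: l => [|i l IH].
  rewrite /tpeval /tpQ /tpL/= big_nil mul0r (_ : (fun h => _) = cst 0).
    exact: is_derive_cst.
  by apply/funext => k; rewrite ?big_nil.
have -> : (fun s => tpeval (tpQ s (i :: l)) x) =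
    (fun s => i.1.1 * expR (- (s * (q i.1.2 / 2))) * cos (dot i.1.2 x + i.2) + tpeval (tpQ s l) x).
  by apply/funext => k; rewrite /tpeval big_cons /= mulrA.
apply: is_derive_eq.
rewrite [in RHS]/tpeval big_cons -/(tpeval _ _) -/(tpL _) -/(tpQ _ _) /= mulrDl; congr (_ + _).
by rewrite /GRing.scale/= mulrA; ring.
Qed.

End trig_poly.

Section gaussian_trig_poly.
Context (R : realType) (dO : measure_display) (O : measurableType dO) (P : probability O R).
Variables (d : nat) (Z : 'I_d -> {RV P >-> R}) (V : 'M[R]_d).
Hypothesis HG : centered_gaussian Z V.
Hypothesis Vsym : V^T = V.
Hypothesis Vpsd : forall u, 0 <= dot u (u *m V).
Local Notation zvec := (zvec Z).
Implicit Types (l : seq (R * 'rV[R]_d * R)) (x y u : 'rV[R]_d).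

Lemma tpeval_cons (i : R * 'rV[R]_d * R) l x :
  tpeval (i :: l) x = i.1.1 * cos (dot i.1.2 x + i.2) + tpeval l x.
Proof. by rewrite /tpeval big_cons. Qed.

Lemma tpeval_nil x : tpeval [::] x = 0 :> R.
Proof. by rewrite /tpeval big_nil. Qed.

Lemma tpeval_bounded l : exists B, forall x, `|tpeval l x| <= B.
Proof.
exists (\sum_(i <- l) `|i.1.1|) => x; apply: le_trans (ler_norm_sum _ _ _) _.
by apply: ler_sum => i _; rewrite normrM ler_piMr// cos_max.
Qed.

Lemma measurable_tpeval l x (r : R) : measurable_fun setT (fun w => tpeval l (x + r *: zvec w)).
Proof.
elim: l => [|i l IH]; first by under eq_fun do rewrite tpeval_nil; exact: measurable_cst.
under eq_fun do rewrite tpeval_cons dotDr dotZr.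
apply: measurable_funD => //; apply: measurable_funM => //; apply: measurableT_comp.
  by apply: continuous_measurable_fun; exact: continuous_cos.
apply: measurable_funD => //; apply: measurable_funD => //; apply: measurable_funM => //.
exact: measurable_dot_zvec.
Qed.

Lemma tpeval_integrable l x (r : R) :
  P.-integrable setT (EFin \o (fun w => tpeval l (x + r *: zvec w))).
Proof.
have [B HB] := tpeval_bounded l.
by apply: (bounded_integrable _ (K := B)) => //; exact: measurable_tpeval.
Qed.

Lemma dot_tpeval_integrable u l x (r : R) :
  P.-integrable setT (EFin \o (fun w => dot u (zvec w) * tpeval l (x + r *: zvec w))).
Proof.
have [B HB] := tpeval_bounded l.
have i2 : P.-integrable setT (EFin \o (fun w => B * `|dot u (zvec w)|)).
  have := integrableZl measurableT B (dot_zvec_integrable HG Vpsd u).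
  by apply: eq_integrable => // w _.
apply: integrable_of_le_normr i2.
  by apply: measurable_funM; [exact: measurable_dot_zvec|exact: measurable_tpeval].
by move=> w; rewrite normrM mulrC ler_wpM2r.
Qed.

(** The bridge between the formal multiplier and the given vector: each frequency is evaluated by
    the characteristic function at sqrt s times that frequency. *)
Lemma tpeval_Q_integral l x (s : R) : 0 <= s ->
  \int[P]_w tpeval l (x + Num.sqrt s *: zvec w) = tpeval (tpQ V s l) x.
Proof.
move=> s0; elim: l => [|i l IH].
  under eq_Rintegral do rewrite tpeval_nil.
  by rewrite Rintegral_cst// mul0r tpeval_nil.
under eq_Rintegral do rewrite tpeval_cons.
have i1 := tpeval_integrable [:: i] x (Num.sqrt s).
have i2 := tpeval_integrable l x (Num.sqrt s).
transitivity (\int[P]_w (tpeval [:: i] (x + Num.sqrt s *: zvec w) + tpeval l (x + Num.sqrt s *: zvec w))).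
  by apply: eq_Rintegral => w _; rewrite tpeval_cons tpeval_nil addr0.
rewrite RintegralD// IH /tpQ/= tpeval_cons -/(tpQ V s l); congr (_ + _) => /=.
transitivity (\int[P]_w (i.1.1 * (cos (dot (Num.sqrt s *: i.1.2) (zvec w) + (dot i.1.2 x + i.2))))).
  apply: eq_Rintegral => w _; rewrite tpeval_cons tpeval_nil addr0 dotDr dotZr dotZl.
  by congr (_ * cos _); ring.
rewrite RintegralZl//; last first.
  apply: (bounded_integrable _ (K := 1)) => [|w]; last exact: cos_max.
  apply: measurableT_comp; first by apply: continuous_measurable_fun; exact: continuous_cos.
  by apply: measurable_funD => //; exact: measurable_dot_zvec.
rewrite (dot_zvec_char HG Vpsd) -mulrA; congr (_ * (expR _ * _)).
by rewrite -scalemxAl dotZl dotZr mulrA -expr2 sqr_sqrtr.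
Qed.

(** A derivative is traded for multiplication by a Gaussian coordinate, which is what gives bounds
    free of derivatives of the function. Only directions [u *m V], in the range of [V], can be
    reached, so a singular [V] is harmless. *)
Lemma tpeval_stein u l x (s : R) : 0 <= s ->
  \int[P]_w (dot u (zvec w) * tpeval l (x + Num.sqrt s *: zvec w)) =
  Num.sqrt s * tpeval (tpD (u *m V) (tpQ V s l)) x.
Proof.
move=> s0; elim: l => [|i l IH].
  under eq_Rintegral do rewrite tpeval_nil mulr0.
  by rewrite Rintegral_cst// mul0r tpeval_nil mulr0.
have i1 := dot_tpeval_integrable u [:: i] x (Num.sqrt s).
have i2 := dot_tpeval_integrable u l x (Num.sqrt s).
transitivity (\int[P]_w (dot u (zvec w) * tpeval [:: i] (x + Num.sqrt s *: zvec w) +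
     dot u (zvec w) * tpeval l (x + Num.sqrt s *: zvec w))).
  by apply: eq_Rintegral => w _; rewrite !tpeval_cons tpeval_nil addr0 mulrDr.
rewrite RintegralD// IH /tpQ /tpD/= tpeval_cons -/(tpQ V s l) -/(tpD _ _) mulrDr; congr (_ + _) => /=.
transitivity (\int[P]_w (i.1.1 * (dot u (zvec w) *
    cos (dot (Num.sqrt s *: i.1.2) (zvec w) + (dot i.1.2 x + i.2))))).
  apply: eq_Rintegral => w _; rewrite tpeval_cons tpeval_nil addr0 dotDr dotZr dotZl mulrCA.
  by congr (_ * (_ * cos _)); ring.
rewrite RintegralZl//; last first.
  have := dot_tpeval_integrable u [:: (1, Num.sqrt s *: i.1.2, dot i.1.2 x + i.2)] 0 1.
  apply: eq_integrable => // w _ /=.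
  by rewrite tpeval_cons tpeval_nil addr0 mul1r/= add0r scale1r.
rewrite (dot_zvec_stein HG Vsym Vpsd) -scalemxAl !dotZl !dotZr addrA cosDpihalf.
rewrite (_ : Num.sqrt s * (Num.sqrt s * dot i.1.2 (i.1.2 *m V)) = s * dot i.1.2 (i.1.2 *m V)).
  by ring.
by rewrite mulrA -expr2 sqr_sqrtr.
Qed.

(** The sum of the constants needed by the two bounds below: the first moment for bounded functions,
    the weighted one for almost Lipschitz functions. *)
Definition steinC u := \int[P]_w (`|dot u (zvec w)|) +
  \int[P]_w (`|dot u (zvec w)| * (\sum_t `|zvec w 0 t| + 2)).

Lemma dot_norm1_integrable u : P.-integrable setT
  (EFin \o (fun w => `|dot u (zvec w)| * (\sum_t `|zvec w 0 t| + 2))).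
Proof.
have iD (f g : O -> R) : P.-integrable setT (EFin \o f) -> P.-integrable setT (EFin \o g) ->
    P.-integrable setT (EFin \o (fun w => f w + g w)).
  by move=> fi gi; have := integrableD measurableT fi gi; apply: eq_integrable.
have i2 : P.-integrable setT (EFin \o (fun w => 2 * `|dot u (zvec w)|)).
  have := integrableZl measurableT 2 (dot_zvec_integrable HG Vpsd u).
  by apply: eq_integrable => // w _.
have i1 (r : seq 'I_d) : P.-integrable setT
    (EFin \o (fun w => \sum_(t <- r) (`|dot u (zvec w)| * `|zvec w 0 t|))).
  elim: r => [|t r IH].
    rewrite (_ : (fun w => _) = cst 0); first exact: finite_measure_integrable_cst.
    by apply/funext => w; rewrite big_nil.
  rewrite (_ : (fun w => _) = fun w => `|dot u (zvec w)| * `|zvec w 0 t| +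
      \sum_(t <- r) `|dot u (zvec w)| * `|zvec w 0 t|).
    apply: iD => //; have := dot_zvecM_integrable HG Vpsd u (delta_mx 0 t).
    by apply: eq_integrable => // w _ /=; rewrite dot_delta.
  by apply/funext => w; rewrite big_cons.
have := iD _ _ (i1 (index_enum 'I_d)) i2.
by apply: eq_integrable => // w _ /=; rewrite mulrDr mulr_sumr [2 * _]mulrC.
Qed.

Lemma steinC_ge0 u : 0 <= steinC u.
Proof.
rewrite addr_ge0 ?Rintegral_ge0// => w _; rewrite mulr_ge0 ?addr_ge0 ?sumr_ge0//.
Qed.

Lemma tpD_bound u l (s B : R) : 0 < s -> (forall x, `|tpeval l x| <= B) ->
  forall x, `|tpeval (tpD (u *m V) (tpQ V s l)) x| <= steinC u / Num.sqrt s * B.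
Proof.
move=> s0 HB x; have ss0 : 0 < Num.sqrt s by rewrite sqrtr_gt0.
have B0 : 0 <= B by apply: le_trans (HB 0).
rewrite mulrAC ler_pdivlMr// mulrC -[X in X * _](gtr0_norm ss0) -normrM.
rewrite -(tpeval_stein _ _ _ (ltW s0)).
apply: le_trans (le_normr_Rintegral measurableT (dot_tpeval_integrable u l x (Num.sqrt s))) _.
have iu := dot_zvec_integrable HG Vpsd u.
have iuB : P.-integrable setT (EFin \o (fun w => `|dot u (zvec w)| * B)).
  by have := integrableZr measurableT B iu; apply: eq_integrable.
apply: (@le_trans _ _ (\int[P]_w (`|dot u (zvec w)| * B))).
  apply: le_Rintegral => //.
    have /integrable_abse := dot_tpeval_integrable u l x (Num.sqrt s).
    by apply: eq_integrable.
  by move=> w _; rewrite normrM ler_wpM2l.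
rewrite RintegralZr// ler_wpM2r// lerDl Rintegral_ge0// => w _.
by rewrite mulr_ge0 ?addr_ge0 ?sumr_ge0.
Qed.

(** Centering at [tpeval l x] leaves an increment of size sqrt s, which cancels the factor s^(-1/2)
    of the Stein identity. One derivative of an almost Lipschitz function therefore costs nothing in
    [s]. *)
Lemma tpD_lip_bound u l (s K : R) : 4^-1 <= s -> 0 <= K ->
  (forall x v, `|tpeval l (x + v) - tpeval l x| <= K * (\sum_t `|v 0 t| + 1)) ->
  forall x, `|tpeval (tpD (u *m V) (tpQ V s l)) x| <= steinC u * K.
Proof.
move=> s4 K0 HK x; have s0 : 0 < s by apply: lt_le_trans s4.
have ss0 : 0 < Num.sqrt s by rewrite sqrtr_gt0.
(* This absorbs the additive 1 of the hypothesis: sqrt s |Z| + 1 <= sqrt s (|Z| + 2), whence the 2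
   in [steinC] and the condition s >= 1/4. *)
have ss2 : 1 <= Num.sqrt s * 2.
  rewrite -[X in _ * X](@ger0_norm R 2)// -sqrtr_sqr -(sqrtrM _ (ltW s0)) -[leLHS]sqrtr1.
  by rewrite ler_sqrt; lra.
rewrite -(ler_pM2l ss0) -[X in X * _](gtr0_norm ss0) -normrM -(tpeval_stein _ _ _ (ltW s0)).
have iu := dot_zvec_integrable HG Vpsd u.
have iu0 : P.-integrable setT (EFin \o (fun w => dot u (zvec w))).
  by apply: integrable_of_le_normr iu => //; exact: measurable_dot_zvec.
have iux : P.-integrable setT (EFin \o (fun w => dot u (zvec w) * tpeval l x)).
  by have := integrableZr measurableT (tpeval l x) iu0; apply: eq_integrable.
have i1 := dot_tpeval_integrable u l x (Num.sqrt s).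
have i2 : P.-integrable setT
    (EFin \o (fun w => dot u (zvec w) * (tpeval l (x + Num.sqrt s *: zvec w) - tpeval l x))).
  have := integrableB measurableT i1 iux; apply: eq_integrable => // w _ /=.
  by rewrite mulrBr.
(* The subtracted constant is free because [dot u (zvec w)] has mean zero. *)
have -> : \int[P]_w (dot u (zvec w) * tpeval l (x + Num.sqrt s *: zvec w)) =
    \int[P]_w (dot u (zvec w) * (tpeval l (x + Num.sqrt s *: zvec w) - tpeval l x)).
  under [RHS]eq_Rintegral do rewrite mulrBr.
  by rewrite RintegralB// RintegralZr// (dot_zvec_mean HG Vsym Vpsd) mul0r subr0.
apply: le_trans (le_normr_Rintegral measurableT i2) _.
have i3 := dot_norm1_integrable u.
have i4 : P.-integrable setT (EFin \o (fun w => Num.sqrt s * K *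
    (`|dot u (zvec w)| * (\sum_t `|zvec w 0 t| + 2)))).
  by have := integrableZl measurableT (Num.sqrt s * K) i3; apply: eq_integrable.
apply: (@le_trans _ _ (\int[P]_w (Num.sqrt s * K *
    (`|dot u (zvec w)| * (\sum_t `|zvec w 0 t| + 2))))).
  apply: le_Rintegral => //.
    by have /integrable_abse := i2; apply: eq_integrable.
  move=> w _; rewrite normrM [leRHS]mulrCA ler_wpM2l//.
  apply: le_trans (HK _ _) _.
  under eq_bigr do rewrite mxE normrM (gtr0_norm ss0).
  rewrite -mulr_sumr mulrAC mulrC ler_wpM2r//.
  by rewrite mulrDr lerD2l.
rewrite RintegralZl// -mulrA (ler_wpM2l (ltW ss0))// mulrC ler_wpM2r// lerDr.
by rewrite Rintegral_ge0.
Qed.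

End gaussian_trig_poly.

(** * Random walks and the Lindeberg telescope *)

Section random_walk.
Variables (R : realType) (d m : nat) (p : 'I_m -> R) (y : 'I_m -> 'rV[R]_d).
Implicit Types (l : seq (R * 'rV[R]_d * R)).

Definition walkT (f : 'rV[R]_d -> R) x := \sum_a p a * f (x + y a).

(** The operator [walkT] on representations: translating by [y a] only changes phases, so it
    commutes with the Gaussian multiplier. *)
Definition tpT l := flatten [seq [seq (p a * i.1.1, i.1.2, i.2 + dot i.1.2 (y a)) | i <- l]
  | a <- index_enum 'I_m].

Lemma tpeval_T l : tpeval (tpT l) = walkT (tpeval l).
Proof.
apply/funext => x; rewrite /tpT /tpeval big_flatten big_map; apply: eq_bigr => a _.
rewrite big_map mulr_sumr; apply: eq_bigr => i _ /=.
by rewrite dotDr mulrA; congr (_ * cos _); ring.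
Qed.

Lemma tpQ_T V (s : R) l : tpQ V s (tpT l) = tpT (tpQ V s l).
Proof.
rewrite /tpQ /tpT map_flatten -map_comp; congr flatten; apply: eq_map => a /=.
by rewrite -!map_comp; apply: eq_map => i /=; rewrite mulrA.
Qed.

Lemma iter_tpeval_T k l : tpeval (iter k tpT l) = iter k walkT (tpeval l).
Proof. by elim: k => //= k IH; rewrite tpeval_T IH. Qed.

End random_walk.

Section lindeberg.
Context (R : realType) (dO : measure_display) (O : measurableType dO) (P : probability O R).
Variables (d : nat) (Z : 'I_d -> {RV P >-> R}) (V : 'M[R]_d).
Hypothesis HG : centered_gaussian Z V.
Hypothesis Vsym : V^T = V.
Hypothesis Vpsd : forall u, 0 <= dot u (u *m V).
Variables (m : nat) (p : 'I_m -> R) (y u : 'I_m -> 'rV[R]_d).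
Hypothesis p_ge0 : forall a, 0 <= p a.
Hypothesis p_sum1 : \sum_a p a = 1.
Hypothesis y_mean0 : forall w, \sum_a p a * dot w (y a) = 0.
Hypothesis y_cov : forall w, dot w (w *m V) = \sum_a p a * dot w (y a) ^+ 2.
Hypothesis y_range : forall a, p a != 0 -> y a = u a *m V.
Implicit Types (l : seq (R * 'rV[R]_d * R)) (x : 'rV[R]_d).

Local Notation Q := (tpQ V).
Local Notation L := (tpL V).
Local Notation walkT := (walkT p y).

Let b := \sum_a steinC Z (u a).

Let b_ge0 : 0 <= b.
Proof. by apply: sumr_ge0 => a _; exact: steinC_ge0. Qed.

Let steinC_le a : steinC Z (u a) <= b.
Proof. by rewrite /b (bigD1 a)//= lerDl sumr_ge0// => k _; exact: steinC_ge0. Qed.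

(** The additive 1 makes this a Lipschitz condition at scale 1 only. The test functions may be
    arbitrarily steep inside their transition band, and the walk need not smooth this out. *)
Definition almost_lip K (f : 'rV[R]_d -> R) :=
  forall x v, `|f (x + v) - f x| <= K * (\sum_t `|v 0 t| + 1).

Let D1_bound a l K s : p a != 0 -> 4^-1 <= s -> 0 <= K -> almost_lip K (tpeval l) ->
  forall x, `|tpeval (tpD (y a) (Q s l)) x| <= b * K.
Proof.
move=> pa s4 K0 HK x; rewrite (y_range pa).
apply: le_trans (tpD_lip_bound HG Vsym Vpsd _ s4 K0 HK _) _.
by rewrite ler_wpM2r.
Qed.

Let Dn_bound a l B s : p a != 0 -> 0 < s -> (forall x, `|tpeval l x| <= B) ->
  forall x, `|tpeval (tpD (y a) (Q s l)) x| <= b / Num.sqrt s * B.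
Proof.
move=> pa s0 HB x; rewrite (y_range pa).
apply: le_trans (tpD_bound HG Vsym Vpsd _ s0 HB _) _.
rewrite ler_wpM2r//; first by apply: le_trans (HB 0).
by rewrite ler_wpM2r// invr_ge0.
Qed.

(** The time [s] is split into thirds, one per derivative. The innermost uses the Lipschitz bound,
    the other two pay (s / 3)^(-1/2) each, hence the factor 3 / s. *)
Lemma tpD3_bound a l K s : p a != 0 -> 1 <= s -> 0 <= K -> almost_lip K (tpeval l) ->
  forall x, `|tpeval (tpD (y a) (tpD (y a) (tpD (y a) (Q s l)))) x| <= 3 * b ^+ 3 * K / s.
Proof.
move=> pa s1 K0 HK x.
have s3 : 0 < s / 3 by rewrite divr_gt0//; lra.
have -> : tpD (y a) (tpD (y a) (tpD (y a) (Q s l))) =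
    tpD (y a) (Q (s / 3) (tpD (y a) (Q (s / 3) (tpD (y a) (Q (s / 3) l))))).
  by rewrite !tpQ_D !tpQ_add; congr (tpD _ (tpD _ (tpD _ (Q _ _)))); field.
apply: le_trans (Dn_bound pa s3 (Dn_bound pa s3 (D1_bound pa _ K0 HK)) _) _; first lra.
rewrite le_eqVlt; apply/predU1P; left.
have ss : Num.sqrt (s / 3) ^+ 2 = s / 3 by rewrite sqr_sqrtr// ltW.
rewrite (_ : 3 * b ^+ 3 * K / s = b ^+ 3 * K / (s / 3)); last by field; lra.
have r0 : Num.sqrt (s / 3) != 0 by rewrite gt_eqF// sqrtr_gt0.
by set r := Num.sqrt (s / 3) in ss r0 *; rewrite -ss; field.
Qed.

(** With four quarters the cost is (s / 4)^(-3/2). As s / 4 >= 1/4, one root is at least 1/2, so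
    this is at most 8 / s, the order of the third derivatives. *)
Lemma tpD4_bound a c l K s : p a != 0 -> p c != 0 -> 1 <= s -> 0 <= K -> almost_lip K (tpeval l) ->
  forall x, `|tpeval (tpD (y a) (tpD (y a) (tpD (y c) (tpD (y c) (Q s l))))) x| <=
    8 * b ^+ 4 * K / s.
Proof.
move=> pa pc s1 K0 HK x.
have s4 : 0 < s / 4 by rewrite divr_gt0//; lra.
have -> : tpD (y a) (tpD (y a) (tpD (y c) (tpD (y c) (Q s l)))) =
    tpD (y a) (Q (s / 4) (tpD (y a) (Q (s / 4) (tpD (y c) (Q (s / 4) (tpD (y c) (Q (s / 4) l))))))).
  by rewrite !tpQ_D !tpQ_add; congr (tpD _ (tpD _ (tpD _ (tpD _ (Q _ _))))); field.
apply: le_trans (Dn_bound pa s4 (Dn_bound pa s4 (Dn_bound pc s4 (D1_bound pc _ K0 HK))) _) _; first lra.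
have ss0 : 0 < Num.sqrt (s / 4) by rewrite sqrtr_gt0.
have ss : Num.sqrt (s / 4) ^+ 2 = s / 4 by rewrite sqr_sqrtr// ltW.
have ss2 : 1 <= 2 * Num.sqrt (s / 4).
  rewrite -(@ler_pXn2r _ 2)// ?nnegrE ?mulr_ge0// ?sqrtr_ge0// exprMn ss; lra.
set r := Num.sqrt (s / 4) in ss0 ss ss2 *.
rewrite (_ : 8 * b ^+ 4 * K / s = b ^+ 4 * K * 2 / r ^+ 2); last by rewrite ss; field; lra.
rewrite (_ : b / r * (b / r * (b / r * (b * K))) = b ^+ 4 * K / r ^+ 3); last by field; lra.
rewrite exprS invfM mulrA ler_wpM2r ?invr_ge0 ?sqr_ge0//.
rewrite ler_wpM2l ?mulr_ge0 ?exprn_ge0// -div1r ler_pdivrMr//.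
Qed.

(** The equality of covariances: the generator is an average of second derivatives along the steps
    of the walk. This is the matching of second moments in the Lindeberg method. *)
Lemma tpL_eval l x : tpeval (L l) x = \sum_a p a * tpeval (tpD (y a) (tpD (y a) l)) x.
Proof.
rewrite /tpeval; under [RHS]eq_bigr do rewrite mulr_sumr !big_map.
rewrite exchange_big big_map; apply: eq_bigr => i _ /=.
rewrite y_cov -mulrA mulNr mulr_suml mulrN mulr_sumr -sumrN; apply: eq_bigr => a _.
rewrite !addrA cosDpihalf sinDpihalf; ring.
Qed.

Lemma tpD_mean l x : \sum_a p a * tpeval (tpD (y a) l) x = 0.
Proof.
rewrite /tpeval; under eq_bigr do rewrite mulr_sumr big_map.
rewrite exchange_big big1// => i _ /=.
under eq_bigr do rewrite mulrA mulrCA.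
by rewrite -mulr_suml -mulr_sumr y_mean0 mulr0 mul0r.
Qed.

Let C := 3 * b ^+ 3 + 8 * b ^+ 4.

(** Taylor expansion in time along the heat equation. The second time derivative is a quarter of
    [L (L _)], an average of fourth derivatives along pairs of steps. *)
Let step_time l K s : 1 <= s -> 0 <= K -> almost_lip K (tpeval l) -> forall x,
  `|tpeval (Q (s + 1) l) x - tpeval (Q s l) x - tpeval (L (Q s l)) x / 2| <= 8 * b ^+ 4 * K / s.
Proof.
move=> s1 K0 HK x.
pose G t := tpeval (Q t (Q s l)) x.
pose G1 t := tpeval (L (Q t (Q s l))) x / 2.
pose G2 t := tpeval (L (L (Q t (Q s l)))) x / 2 / 2.
have dG (t : R) : is_derive t 1 G (G1 t) by exact: tpeval_Q_derive.
have dG1 (t : R) : is_derive t 1 G1 (G2 t).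
  rewrite /G1 (_ : (fun t => _) = (fun t => 2^-1 * tpeval (Q t (L (Q s l))) x)); last first.
    by apply/funext => r; rewrite tpQ_L mulrC.
  have H := tpeval_Q_derive V (L (Q s l)) x t.
  by apply: is_derive_eq; rewrite /GRing.scale/= tpQ_L /G2 mulrC.
have BG2 t : 0 <= t <= 1 -> `|G2 t| <= 8 * b ^+ 4 * K / s.
  move=> /andP[t0 t1]; rewrite /G2 tpQ_add.
  set B := 8 * b ^+ 4 * K / s.
  have B0 : 0 <= B by rewrite divr_ge0 ?mulr_ge0 ?exprn_ge0//; lra.
  suff H : `|tpeval (L (L (Q (t + s) l))) x| <= B.
    by rewrite !normrM (@ger0_norm _ 2^-1)//; nra.
  rewrite tpL_eval; apply: le_trans (ler_norm_sum _ _ _) _.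
  rewrite -[leRHS]mul1r -p_sum1 mulr_suml; apply: ler_sum => a _.
  rewrite normrM (ger0_norm (p_ge0 a)).
  have [->|pa] := eqVneq (p a) 0; first by rewrite !mul0r.
  rewrite ler_wpM2l// -!tpL_D tpL_eval; apply: le_trans (ler_norm_sum _ _ _) _.
  rewrite -[leRHS]mul1r -p_sum1 mulr_suml; apply: ler_sum => c _.
  rewrite normrM (ger0_norm (p_ge0 c)).
  have [->|pc] := eqVneq (p c) 0; first by rewrite !mul0r.
  rewrite ler_wpM2l//; apply: le_trans (tpD4_bound pc pa _ K0 HK _) _; first lra.
  rewrite /B ler_wpM2l ?mulr_ge0 ?exprn_ge0// lef_pV2 ?posrE; lra.
have := @taylor2_01_bound R G G1 G2 _ 1 dG dG1 BG2.
rewrite ler01 lexx mul1r /G /G1 tpQ_add tpeval_Q0 tpQ_add add0r [1 + s]addrC.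
exact.
Qed.

(** One step of the walk and one unit of Gaussian time both have the expansion F + L F / 2; the
    first remainder is of third order in space, the second is [step_time]. *)
Lemma lindeberg_step l K s : 1 <= s -> 0 <= K -> almost_lip K (tpeval l) -> forall x,
  `|walkT (tpeval (Q s l)) x - tpeval (Q (s + 1) l) x| <= C * K / s.
Proof.
move=> s1 K0 HK x; set F := Q s l.
have sp : `|walkT (tpeval F) x - tpeval F x - tpeval (L F) x / 2| <= 3 * b ^+ 3 * K / s.
  have -> : walkT (tpeval F) x - tpeval F x - tpeval (L F) x / 2 =
      \sum_a p a * (tpeval F (x + y a) - tpeval F x - tpeval (tpD (y a) F) x -
        tpeval (tpD (y a) (tpD (y a) F)) x / 2).
    under eq_bigr do rewrite !mulrBr mulrA.
    by rewrite !sumrB -!mulr_suml p_sum1 mul1r tpD_mean subr0 -tpL_eval.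
  apply: le_trans (ler_norm_sum _ _ _) _.
  rewrite -[leRHS]mul1r -[X in X * _]p_sum1 mulr_suml; apply: ler_sum => a _.
  rewrite normrM (ger0_norm (p_ge0 a)).
  have [->|pa] := eqVneq (p a) 0; first by rewrite !mul0r.
  rewrite ler_wpM2l//.
  have := @taylor3_01_bound R (fun h => tpeval F (x + h *: y a))
    (fun h => tpeval (tpD (y a) F) (x + h *: y a))
    (fun h => tpeval (tpD (y a) (tpD (y a) F)) (x + h *: y a))
    (fun h => tpeval (tpD (y a) (tpD (y a) (tpD (y a) F))) (x + h *: y a)) (3 * b ^+ 3 * K / s).
  have x0 : x + 0 *: y a = x by rewrite scale0r addr0.
  have x1 : x + 1 *: y a = x + y a by rewrite scale1r.
  rewrite /= x0 x1 => H; apply: H => [r|r|r|r _].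
  - exact: tpeval_derive.
  - exact: tpeval_derive.
  - exact: tpeval_derive.
  - exact: (tpD3_bound pa s1 K0 HK).
have tm := step_time s1 K0 HK x.
rewrite /C (_ : (3 * b ^+ 3 + 8 * b ^+ 4) * K / s = 3 * b ^+ 3 * K / s + 8 * b ^+ 4 * K / s); last first.
  by ring.
apply: le_trans (lerD sp tm); rewrite -/F.
apply: le_trans (ler_normB _ _); rewrite le_eqVlt; apply/predU1P; left.
by rewrite (_ : _ - _ - (_ - _ - _) = walkT (tpeval F) x - tpeval (Q (s + 1) l) x)//; ring.
Qed.

Lemma lindeberg_telescope l (K : nat -> R) n :
  (forall k, 0 <= K k) ->
  (forall k, (k < n)%N -> almost_lip (K k) (iter k walkT (tpeval l))) ->
  `|iter n walkT (tpeval (Q 1 l)) 0 - tpeval (Q n.+1%:R l) 0| <=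
    C * \sum_(0 <= k < n) K k / (n - k)%:R.
Proof.
move=> K0 HK.
(* The unit of Gaussian time left at k = n makes the step from k to k + 1 an instance of
   [lindeberg_step] with s = n - k >= 1. *)
pose a k := tpeval (Q (n.+1 - k)%:R (iter k (tpT p y) l)) 0.
have -> : iter n walkT (tpeval (Q 1 l)) 0 - tpeval (Q n.+1%:R l) 0 = a n - a 0%N.
  rewrite /a subn0 /= subSnn; congr (_ - _); rewrite -iter_tpeval_T; congr (tpeval _ _).
  by elim: (n) => //= k ->; rewrite tpQ_T.
rewrite -telescope_sumr// mulr_sumr; apply: le_trans (ler_norm_sum _ _ _) _.
rewrite !big_nat; apply: ler_sum => k /andP[_ kn].
rewrite /a /= subSS subSn ?(ltnW kn)// tpQ_T tpeval_T -natr1 mulrA.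
apply: lindeberg_step => //; first by rewrite ler1n subn_gt0.
by rewrite iter_tpeval_T; exact: HK.
Qed.

End lindeberg.

(** * Anticoncentration of the walk *)

Section sine_bounds.
Variable R : realType.
Implicit Types x : R.

Lemma sin_mvt x : 0 <= x -> exists2 c, 0 <= c <= x & sin x = cos c * x.
Proof.
move=> x0; have [c] := @MVT_segment R sin cos 0 x x0 (fun y _ => is_derive_sin y)
  (derivable_within_continuous (fun y _ => @ex_derive _ _ _ _ _ _ _ (is_derive_sin y))).
by rewrite in_itv/= sin0 !subr0 => cx ->; exists c.
Qed.

Lemma normr_sin_le x : `|sin x| <= `|x|.
Proof.
wlog x0 : x / 0 <= x.
  move=> H; have [/H//|/ltW x0] := leP 0 x.
  by rewrite -(opprK x) sinN !(normrN (- x)) normrN; apply: H; rewrite oppr_ge0.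
have [c _ ->] := sin_mvt x0.
by rewrite normrM ler_piMl// cos_max.
Qed.

Lemma cos_double_angle x : cos x = 1 - 2 * sin (x / 2) ^+ 2.
Proof.
rewrite [in LHS](_ : x = x / 2 + x / 2); last by field.
by rewrite cosD -!expr2 cos2sin2; ring.
Qed.

Lemma cos_ge_quadratic x : 1 - x ^+ 2 / 2 <= cos x.
Proof.
rewrite cos_double_angle.
have : sin (x / 2) ^+ 2 <= (x / 2) ^+ 2.
  rewrite -(real_normK (num_real (sin _))) -(real_normK (num_real (x / 2))).
  by rewrite ler_sqr ?nnegrE// normr_sin_le.
by nra.
Qed.

Lemma sin_ge_linear x : 0 <= x <= 2^-1 -> 7 / 8 * x <= sin x.
Proof.
move=> /andP[x0 x2]; have [c /andP[c0 cx] ->] := sin_mvt x0.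
by have := cos_ge_quadratic c; nra.
Qed.

(** Half-angle formula with sin (z / 2) >= 7 z / 16; twice the square of 7 / 16 exceeds 1 / 4. *)
Lemma cos_le_quadratic x : `|x| <= 1 -> cos x <= 1 - x ^+ 2 / 4.
Proof.
rewrite -cos_norm -(real_normK (num_real x)); have := normr_ge0 x.
set z := `|x| => z0 z1; rewrite cos_double_angle.
have /sin_ge_linear H : 0 <= z / 2 <= 2^-1 by apply/andP; lra.
by nra.
Qed.

Lemma normr_sin_mulrn x n : `|sin (x *+ n)| <= n%:R * `|sin x|.
Proof.
elim: n => [|n IH]; first by rewrite mulr0n sin0 normr0 mul0r.
rewrite mulrS sinD -natr1 mulrDl mul1r addrC.
apply: le_trans (ler_normD _ _) _; rewrite !normrM lerD//.
  by apply: le_trans IH; rewrite ler_piMl// cos_max.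
by rewrite ler_piMr// cos_max.
Qed.

Lemma sin_dist x y : `|sin x - sin y| <= `|x - y|.
Proof.
wlog xy : x y / y <= x.
  move=> H; have [/H//|/ltW/H] := leP y x.
  by rewrite distrC (distrC y).
have [c _ ->] := @MVT_segment R sin cos y x xy (fun y _ => is_derive_sin y)
  (derivable_within_continuous (fun y _ => @ex_derive _ _ _ _ _ _ _ (is_derive_sin y))).
by rewrite normrM ler_piMl// cos_max.
Qed.

End sine_bounds.

Section walk_operator.
Variables (R : realType) (d m : nat) (p : 'I_m -> R) (y : 'I_m -> 'rV[R]_d).
Hypothesis p_ge0 : forall a, 0 <= p a.
Hypothesis p_sum1 : \sum_a p a = 1.
Local Notation walkT := (walkT p y).
Implicit Types (f g : 'rV[R]_d -> R) (k : nat).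

Lemma iter_walkT_le k f g : (forall x, f x <= g x) ->
  forall x, iter k walkT f x <= iter k walkT g x.
Proof.
move=> fg; elim: k => //= k IH x.
by apply: ler_sum => a _; rewrite ler_wpM2l.
Qed.

Lemma iter_walkT_cst k (c : R) : iter k walkT (fun=> c) = fun=> c.
Proof.
elim: k => //= k ->; apply/funext => x.
by rewrite /walkT -mulr_suml p_sum1 mul1r.
Qed.

Lemma iter_walkTD k f g :
  iter k walkT (fun x => f x + g x) = fun x => iter k walkT f x + iter k walkT g x.
Proof.
elim: k => //= k ->; apply/funext => x.
by rewrite /walkT -big_split; apply: eq_bigr => a _; rewrite mulrDr.
Qed.

Lemma iter_walkTZ k (c : R) f :
  iter k walkT (fun x => c * f x) = fun x => c * iter k walkT f x.
Proof.
elim: k => //= k ->; apply/funext => x.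
by rewrite /walkT mulr_sumr; apply: eq_bigr => a _; rewrite mulrCA.
Qed.

Lemma iter_walkT_sum k (I : Type) (r : seq I) (F : I -> 'rV[R]_d -> R) :
  iter k walkT (fun x => \sum_(i <- r) F i x) = fun x => \sum_(i <- r) iter k walkT (F i) x.
Proof.
elim: r => [|i r IH].
  rewrite (_ : (fun x => _) = fun=> 0); last by apply/funext => x; rewrite big_nil.
  by rewrite iter_walkT_cst; apply/funext => x; rewrite big_nil.
rewrite (_ : (fun x => _) = fun x => F i x + \sum_(i <- r) F i x); last first.
  by apply/funext => x; rewrite big_cons.
by rewrite iter_walkTD IH; apply/funext => x; rewrite big_cons.
Qed.

Lemma iter_walkT_shift k f v x :
  iter k walkT (fun x => f (x + v)) x = iter k walkT f (x + v).
Proof.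
elim: k x => //= k IH x.
by apply: eq_bigr => a _; rewrite IH addrAC.
Qed.

Lemma iter_walkT_norm k f x : `|iter k walkT f x| <= iter k walkT (fun x => `|f x|) x.
Proof.
elim: k x => //= k IH x; apply: le_trans (ler_norm_sum _ _ _) _.
by apply: ler_sum => a _; rewrite normrM (ger0_norm (p_ge0 a)) ler_wpM2l.
Qed.

Lemma iter_walkTB k f g x :
  iter k walkT (fun x => f x - g x) x = iter k walkT f x - iter k walkT g x.
Proof.
have -> : (fun x => f x - g x) = fun x => f x + (- 1) * g x.
  by apply/funext => z; rewrite mulN1r.
by rewrite iter_walkTD iter_walkTZ mulN1r.
Qed.

Variable t : 'I_d.
(** [A] and [B] are the real and imaginary parts of the characteristic function of coordinate [t] of
    one step. *)
Let A (u : R) := \sum_a p a * cos (u * y a 0 t).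
Let B (u : R) := \sum_a p a * sin (u * y a 0 t).

(** The plane spanned by cos (u x_t) and sin (u x_t) is invariant. On it the operator is
    multiplication by a complex number of squared modulus A^2 + B^2, expressed here without complex
    numbers. *)
Lemma iter_walkT_trig u k (al be : R) : exists al' be',
  iter k walkT (fun x => al * cos (u * x 0 t) + be * sin (u * x 0 t)) =
    (fun x => al' * cos (u * x 0 t) + be' * sin (u * x 0 t)) /\
  al' ^+ 2 + be' ^+ 2 = (A u ^+ 2 + B u ^+ 2) ^+ k * (al ^+ 2 + be ^+ 2).
Proof.
elim: k => [|k [a' [b' [/= -> E]]]]; first by exists al, be; rewrite mul1r.
exists (a' * A u + b' * B u), (b' * A u - a' * B u); split; last first.
  by rewrite [_ ^+ k.+1]exprS -mulrA -E; ring.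
apply/funext => x; rewrite /walkT /A /B !mulr_sumr -!big_split/= -sumrB !mulr_suml -big_split/=.
apply: eq_bigr => a _; by rewrite mxE (mulrDr u) cosD sinD; ring.
Qed.

Lemma iter_walkT_cos_le u k c x (r : R) : A u ^+ 2 + B u ^+ 2 <= r ^+ 2 -> 0 <= r ->
  iter k walkT (fun x => cos (u * x 0 t + c)) x <= r ^+ k.
Proof.
move=> Hr r0.
have -> : (fun x : 'rV[R]_d => cos (u * x 0 t + c)) =
    (fun x => cos c * cos (u * x 0 t) + (- sin c) * sin (u * x 0 t)).
  by apply/funext => z; rewrite cosD; ring.
have [a' [b' [-> E]]] := iter_walkT_trig u k (cos c) (- sin c).
apply: le_trans (ler_norm _) _.
rewrite -(@ler_pXn2r _ 2)// ?nnegrE ?exprn_ge0// real_normK ?num_real//.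
have -> : (r ^+ k) ^+ 2 = (r ^+ 2) ^+ k by rewrite -!exprM mulnC.
apply: (@le_trans _ _ (a' ^+ 2 + b' ^+ 2)).
  have := cos2Dsin2 (u * x 0 t); set C := cos _; set S := sin _ => CS.
  rewrite -subr_ge0 (_ : _ - _ = (a' * S - b' * C) ^+ 2) ?sqr_ge0//.
  by rewrite -[X in X - _]mulr1 -CS; ring.
by rewrite E sqrrN cos2Dsin2 mulr1 lerXn2r// ?nnegrE ?addr_ge0 ?sqr_ge0.
Qed.

End walk_operator.

(** * The Fejer kernel and the sums it produces *)

Section kernel_sums.
Variable R : realType.

Lemma sum_dist_le (b : nat -> R) J j : (forall i, 0 <= b i) -> (j < J)%N ->
  \sum_(0 <= l < J) b `|j - l|%N <= 2 * \sum_(0 <= i < J) b i.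
Proof.
move=> b0 jJ.
have mono n : (n <= J)%N -> \sum_(0 <= i < n) b i <= \sum_(0 <= i < J) b i.
  move=> nJ; rewrite (big_cat_nat (n := n) (p := J))//= lerDl.
  by apply: sumr_ge0.
rewrite (big_cat_nat (n := j.+1))//= (_ : 2 = 1 + 1)// mulrDl !mul1r lerD//.
  apply: le_trans (mono j.+1 jJ); rewrite big_nat_rev/= add0n.
  rewrite !big_nat; apply: ler_sum => i /andP[_ ij].
  by rewrite subSS distnEl ?leq_subr// subKn.
rewrite -{1}(add0n j.+1) big_addn.
apply: le_trans (mono (J - j)%N (leq_subr _ _)).
rewrite [leRHS](_ : _ = b 0%N + \sum_(0 <= i < J - j.+1) b i.+1); last first.
  by rewrite -(subnSK jJ) big_nat_recl.
apply: ler_wpDl => //; rewrite !big_nat; apply: ler_sum => i _.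
by rewrite distnEr ?addnS ?leqW ?leq_addl// subSn ?leq_addl// addnK.
Qed.

(* 1/(1 + i^2 h^2) <= 2/(1 + i h)^2, which telescopes. *)
Lemma sum_inv_quadratic_le (h : R) J : 0 < h ->
  \sum_(0 <= i < J) (1 + h ^+ 2 * i%:R ^+ 2)^-1 <= 1 + 2 / h.
Proof.
move=> h0; case: J => [|J].
  by rewrite big_geq// addr_ge0// divr_ge0// ltW.
rewrite big_nat_recl// expr0n mulr0 addr0 invr1 lerD2l.
pose g i : R := - (2 / h) / (1 + h * i%:R).
apply: (@le_trans _ _ (\sum_(0 <= i < J) (g i.+1 - g i))).
  apply: ler_sum => i _; rewrite /g -natr1.
  set k : R := i%:R; have k0 : 0 <= k by rewrite /k.
  have e0 : 0 < 1 + h * k by nra.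
  have e1 : 0 < 1 + h * (k + 1) by nra.
  have -> : - (2 / h) / (1 + h * (k + 1)) - - (2 / h) / (1 + h * k) =
     2 / ((1 + h * (k + 1)) * (1 + h * k)).
    by field; rewrite !gt_eqF.
  have e2 : 0 < 1 + h ^+ 2 * (k + 1) ^+ 2 by nra.
  rewrite -[X in X <= _]mul1r ler_pdivrMr// mulrAC ler_pdivlMr ?mulr_gt0// mul1r.
  by have := sqr_ge0 (1 - h * (k + 1)); nra.
rewrite telescope_sumr// /g mulr0 addr0 divr1 opprK.
have : 0 <= 2 / h by rewrite divr_ge0 // ltW.
have : 0 <= (1 + h * J%:R)^-1 by rewrite invr_ge0 addr_ge0// mulr_ge0// ltW.
by nra.
Qed.

(** The squared modulus of the sum of exp (i j th) over j < J, that is, J times the Fejer kernel. *)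
Definition fejer J (th : R) : R :=
  (\sum_(0 <= j < J) cos (j%:R * th)) ^+ 2 + (\sum_(0 <= j < J) sin (j%:R * th)) ^+ 2.

Lemma fejerE J th : fejer J th =
  \sum_(0 <= j < J) \sum_(0 <= l < J) cos ((j%:R - l%:R) * th).
Proof.
rewrite /fejer !expr2 !mulr_suml -big_split; apply: eq_bigr => j _ /=.
rewrite !mulr_sumr -big_split; apply: eq_bigr => l _ /=.
by rewrite mulrBl cosB.
Qed.

Lemma fejer_ge0 J th : 0 <= fejer J th.
Proof. by rewrite addr_ge0// sqr_ge0. Qed.

(** Here |sin (j th)| <= j |sin th| <= 1/2, so every cosine in the sum is at least 1/2. Doubling the
    angle gives the kernel the period pi of |sin th|, so that all zeros of the sine are covered at
    once. *)
Lemma fejer_ge J th : (0 < J)%N -> `|sin th| <= (2 * J%:R)^-1 ->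
  J%:R ^+ 2 / 4 <= fejer J (2 * th).
Proof.
move=> J0 sth; rewrite /fejer; apply: ler_wpDr; first exact: sqr_ge0.
have -> : J%:R ^+ 2 / 4 = (J%:R / 2) ^+ 2 :> R by field.
have JR : 0 < J%:R :> R by rewrite ltr0n.
have key : J%:R / 2 <= \sum_(0 <= j < J) cos (j%:R * (2 * th)).
  rewrite (_ : J%:R / 2 = \sum_(0 <= j < J) 2^-1); last first.
    by rewrite big_const_nat subn0 iter_addr_0 mulr_natl.
  rewrite !big_nat; apply: ler_sum => j /andP[_ jJ].
  rewrite cos_double_angle (_ : j%:R * (2 * th) / 2 = th *+ j); last first.
    by rewrite -mulr_natl; field.
  have H : `|sin (th *+ j)| <= 2^-1.
    apply: le_trans (normr_sin_mulrn _ _) _.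
    apply: (@le_trans _ _ (J%:R * (2 * J%:R)^-1)).
      by apply: ler_pM => //; rewrite ler_nat ltnW.
    by rewrite invfM mulrCA divff ?mulr1// gt_eqF.
  rewrite -(real_normK (num_real (sin _))).
  by have := normr_ge0 (sin (th *+ j)); nra.
have J2 : 0 <= J%:R / 2 :> R by rewrite divr_ge0.
by rewrite ler_sqr ?nnegrE//; apply: le_trans key.
Qed.

End kernel_sums.

Section concentration.
Variables (R : realType) (d m : nat) (p : 'I_m -> R) (y : 'I_m -> 'rV[R]_d) (t : 'I_d).
Hypothesis p_ge0 : forall a, 0 <= p a.
Hypothesis p_sum1 : \sum_a p a = 1.
Hypothesis y_mean0 : \sum_a p a * y a 0 t = 0.
Let v := \sum_a p a * y a 0 t ^+ 2.
Hypothesis v_gt0 : 0 < v.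
Local Notation walkT := (walkT p y).

(** Up to this frequency all angles u (y_a - y_b) lie in [-1, 1], where the quadratic bound on the
    cosine holds. *)
Let u0 : R := (1 + 2 * \sum_a `|y a 0 t|)^-1.

Let Sy_ge0 : 0 <= \sum_a `|y a 0 t|. Proof. exact: sumr_ge0. Qed.

Let u0_gt0 : 0 < u0.
Proof. by have H := Sy_ge0; rewrite /u0 invr_gt0; lra. Qed.

Let u0_le1 : u0 <= 1.
Proof. by have H := Sy_ge0; rewrite /u0 invf_le1; lra. Qed.

(** Symmetrization: the squared modulus is E cos (u (Y - Y')) for an independent copy Y', and Y - Y'
    has second moment 2 v. *)
Let char_bound u : `|u| <= u0 ->
  (\sum_a p a * cos (u * y a 0 t)) ^+ 2 + (\sum_a p a * sin (u * y a 0 t)) ^+ 2 <=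
  1 - u ^+ 2 * v / 2.
Proof.
move=> uu0.
have -> : (\sum_a p a * cos (u * y a 0 t)) ^+ 2 + (\sum_a p a * sin (u * y a 0 t)) ^+ 2 =
    \sum_a p a * \sum_b p b * cos (u * (y a 0 t - y b 0 t)).
  rewrite !expr2 !mulr_suml -big_split; apply: eq_bigr => a _ /=.
  rewrite -!mulrA -mulrDr; congr (_ * _).
  rewrite !mulr_sumr -big_split; apply: eq_bigr => b _ /=.
  by rewrite mulrBr cosB; ring.
have -> : 1 - u ^+ 2 * v / 2 =
    \sum_a p a * \sum_b p b * (1 - (u * (y a 0 t - y b 0 t)) ^+ 2 / 4).
  have inner a : \sum_b p b * (1 - (u * (y a 0 t - y b 0 t)) ^+ 2 / 4) =
      1 - u ^+ 2 / 4 * (y a 0 t ^+ 2 + v).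
    rewrite (_ : _ - _ = \sum_b p b * 1 - (u ^+ 2 / 4 * y a 0 t ^+ 2 * \sum_b p b
       - u ^+ 2 / 2 * y a 0 t * \sum_b p b * y b 0 t + u ^+ 2 / 4 * v)); last first.
      by rewrite y_mean0 -mulr_suml p_sum1; ring.
    rewrite /v !mulr_sumr -sumrB -big_split -sumrB; apply: eq_bigr => b _ /=.
    by field.
  under eq_bigr do rewrite inner.
  rewrite (_ : 1 - u ^+ 2 * v / 2 = \sum_a p a - (u ^+ 2 / 4 * v + u ^+ 2 / 4 * v * \sum_a p a)); last first.
    by rewrite p_sum1; field.
  have vE : v = \sum_a p a * y a 0 t ^+ 2 by [].
  rewrite [X in u ^+ 2 / 4 * X + _]vE; move: (v) => w.
  rewrite !mulr_sumr -big_split -sumrB; apply: eq_bigr => a _ /=.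
  by ring.
apply: ler_sum => a _; rewrite ler_wpM2l//; apply: ler_sum => b _; rewrite ler_wpM2l//.
apply: cos_le_quadratic; rewrite normrM.
have ya c : `|y c 0 t| <= \sum_a `|y a 0 t|.
  by rewrite (bigD1 c)//= lerDl sumr_ge0.
have H : `|y a 0 t - y b 0 t| <= 2 * \sum_a `|y a 0 t|.
  apply: le_trans (ler_normB _ _) _.
  by rewrite (_ : 2 = 1 + 1)// mulrDl !mul1r lerD.
apply: (@le_trans _ _ (u0 * (2 * \sum_a `|y a 0 t|))); first exact: ler_pM.
by have H0 := Sy_ge0; rewrite /u0 mulrC ler_pdivrMr ?mul1r; lra.
Qed.

(** With z = u^2 v / 4 the modulus is at most 1 - z <= 1 / (1 + z), and Bernoulli's inequality
    bounds its k-th power by 1 / (1 + k z). Quadratic decay in [u] is all that the frequency sum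
    needs. *)
Let cos_decay u k c x : `|u| <= u0 ->
  iter k walkT (fun x => cos (u * x 0 t + c)) x <= (1 + k%:R * v * u ^+ 2 / 4)^-1.
Proof.
move=> uu0; have H := char_bound uu0.
have uv0 : 0 <= u ^+ 2 * v by rewrite mulr_ge0 ?sqr_ge0// ltW.
have uv2 : u ^+ 2 * v / 2 <= 1.
  have : 0 <= 1 - u ^+ 2 * v / 2 by apply: le_trans H; rewrite addr_ge0// sqr_ge0.
  by lra.
pose z := u ^+ 2 * v / 4.
have z0 : 0 <= z by rewrite /z; lra.
apply: (@le_trans _ _ ((1 - z) ^+ k)).
  apply: iter_walkT_cos_le => //; last by rewrite /z; lra.
  by apply: le_trans H _; rewrite /z; have := sqr_ge0 (u ^+ 2 * v); nra.
apply: (@le_trans _ _ ((1 + z)^-1 ^+ k)).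
  rewrite lerXn2r// ?nnegrE ?invr_ge0; [by rewrite /z; lra|by lra|].
  by rewrite -[leRHS]div1r ler_pdivlMr; nra.
have zE (r : R) : r * v * u ^+ 2 / 4 = r * z by rewrite /z; field.
rewrite exprVn lef_pV2 ?posrE ?zE.
- elim: k => [|k IH]; first by rewrite expr0 mul0r addr0.
  rewrite exprS -natr1.
  have k0 : 0 <= k%:R :> R by [].
  have : (1 + z) * (1 + k%:R * z) <= (1 + z) * (1 + z) ^+ k by rewrite ler_wpM2l//; lra.
  by apply: le_trans; have := mulr_ge0 k0 (mulr_ge0 z0 z0); nra.
- by rewrite exprn_gt0//; lra.
- have : 0 <= k%:R * z by rewrite mulr_ge0.
  by lra.
Qed.

Let C := 32 / u0 * (1 + 2 / Num.sqrt v).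

(** An Esseen-type smoothing argument: the indicator is dominated by a normalized Fejer kernel of
    degree about M / rho, whose frequencies all lie where [cos_decay] applies. The sum over
    frequencies contributes 1/M + k^(-1/2), and the assumption on M removes the first term. *)
Let conc_pos k (M b rho : R) x : (0 < k)%N -> Num.sqrt k%:R <= M -> 1 <= rho ->
  iter k walkT (fun x => (`|sin ((x 0 t - b) / M)| <= rho / M)%R%:R) x <= C * rho / Num.sqrt k%:R.
Proof.
move=> k0 kM rho1.
have sk : 0 < Num.sqrt k%:R :> R by rewrite sqrtr_gt0 ltr0n.
have M0 : 0 < M by apply: lt_le_trans kM.
have sv : 0 < Num.sqrt v by rewrite sqrtr_gt0.
have CE : 32 / u0 <= C by rewrite /C ler_peMr ?divr_ge0 ?ltW// ltrDl divr_gt0.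
(* An integer J <= X satisfies both requirements on the degree: frequencies 2 |j - l| / M stay below
   [u0], and rho / M <= 1 / (2 J). *)
pose X := M * u0 / (2 * rho).
have X0 : 0 <= X by rewrite divr_ge0 ?mulr_ge0 ?ltW//; lra.
(* If X < 1 no degree is available, but then sqrt k <= M < 2 rho / u0 and the trivial bound 1
   suffices. *)
have [X1|X1] := ltP X 1.
  apply: (@le_trans _ _ 1).
    rewrite -[leRHS](congr1 (fun f => f x) (iter_walkT_cst y p_sum1 k 1)).
    by apply: iter_walkT_le => // z; rewrite lern1 leq_b1.
  rewrite ler_pdivlMr// mul1r; apply: le_trans kM _.
  apply: (@le_trans _ _ (32 / u0 * rho)); last by rewrite ler_wpM2r//; lra.
  rewrite mulrAC ler_pdivlMr//.
  by move: X1; rewrite /X ltr_pdivrMr; lra.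
pose J := Num.trunc X.
have /andP[JX XJ] := Num.Theory.trunc_itv X0.
have J1 : (0 < J)%N by rewrite Num.Theory.trunc_gt0.
have JR : 1 <= J%:R :> R by rewrite ler1n.
have JR2 : X <= 2 * J%:R by move: XJ; rewrite -natr1 -/J; lra.
have JM : J%:R * (2 * rho) <= M * u0 by rewrite -ler_pdivlMr//; lra.
have J0 : 0 < J%:R :> R by lra.
have MU : M * u0 <= M by rewrite ler_piMr// ltW.
pose F (z : 'rV[R]_d) := 4 / J%:R ^+ 2 * fejer J (2 * ((z 0 t - b) / M)).
apply: (@le_trans _ _ (iter k walkT F x)).
  apply: iter_walkT_le => // z; rewrite /F; case: (boolP (`|sin _| <= _)) => /= [H|_]; last first.
    by rewrite mulr_ge0 ?fejer_ge0// divr_ge0// sqr_ge0.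
  have /(fejer_ge J1) : `|sin ((z 0 t - b) / M)| <= (2 * J%:R)^-1.
    apply: le_trans H _; rewrite -[leRHS]div1r ler_pdivlMr ?mulr_gt0//.
    by rewrite mulrAC ler_pdivrMr//; lra.
  have J4 : 0 <= 4 / J%:R ^+ 2 :> R by rewrite divr_ge0// sqr_ge0.
  move=> /(ler_wpM2l J4).
  by apply: le_trans; rewrite le_eqVlt; apply/predU1P; left; field; lra.
pose h := Num.sqrt (k%:R * v) / M.
(* At frequency 2 i / M the bound of [cos_decay] is exactly 1 / (1 + h^2 i^2). *)
have h0 : 0 < h by rewrite divr_gt0// sqrtr_gt0 mulr_gt0// ltr0n.
have h2 : h ^+ 2 = k%:R * v / M ^+ 2.
  by rewrite /h expr_div_n sqr_sqrtr// mulr_ge0// ltW.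
pose bd (i : nat) : R := (1 + h ^+ 2 * i%:R ^+ 2)^-1.
have bd0 i : 0 <= bd i by rewrite invr_ge0 addr_ge0// mulr_ge0 ?sqr_ge0.
have FE : F = fun z => 4 / J%:R ^+ 2 * \sum_(0 <= j < J) \sum_(0 <= l < J)
    cos ((j%:R - l%:R) * 2 / M * z 0 t - (j%:R - l%:R) * 2 / M * b).
  apply/funext => z; rewrite /F fejerE; congr (_ * _).
  by apply: eq_bigr => j _; apply: eq_bigr => l _; congr cos; ring.
have -> : iter k walkT F x = 4 / J%:R ^+ 2 * \sum_(0 <= j < J) \sum_(0 <= l < J)
    iter k walkT (fun z => cos ((j%:R - l%:R) * 2 / M * z 0 t - (j%:R - l%:R) * 2 / M * b)) x.
  rewrite FE iter_walkTZ; congr (_ * _).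
  rewrite (iter_walkT_sum y p_sum1) ; apply: eq_bigr => j _.
  by rewrite (iter_walkT_sum y p_sum1).
apply: (@le_trans _ _ (4 / J%:R ^+ 2 * (J%:R * (2 * (1 + 2 / h))))).
  rewrite ler_wpM2l ?divr_ge0 ?sqr_ge0//.
  rewrite [leRHS](_ : _ = \sum_(0 <= j < J) (2 * (1 + 2 / h))); last first.
    by rewrite big_const_nat subn0 iter_addr_0 mulr_natl.
  rewrite !big_nat; apply: ler_sum => j /andP[_ jJ].
  apply: (@le_trans _ _ (\sum_(0 <= l < J) bd `|j - l|%N)).
    rewrite !big_nat; apply: ler_sum => l /andP[_ lJ].
    have jl : `|j%:R - l%:R| = (`|j - l|%N)%:R :> R.
      by rewrite natr_absz intr_norm rmorphB.
    apply: le_trans (cos_decay _ _ _ _) _.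
      rewrite normrM normrM jl (ger0_norm (ler0n R 2)) normfV (gtr0_norm M0) ler_pdivrMr//.
      have : (`|j - l|%N)%:R <= J%:R :> R.
        by rewrite ler_nat; have [jl'|lj'] := leqP j l;
          rewrite ?(distnEr jl') ?(distnEl (ltnW lj')) (leq_trans (leq_subr _ _))// ltnW.
      by nra.
    rewrite le_eqVlt; apply/predU1P; left; congr (_^-1); congr (1 + _).
    rewrite h2 -jl real_normK ?num_real//; field; lra.
  apply: le_trans (sum_dist_le bd0 jJ) _.
  by rewrite ler_wpM2l// sum_inv_quadratic_le.
have hE : 2 / h = 2 * M / (Num.sqrt k%:R * Num.sqrt v).
  by rewrite /h sqrtrM//; field; lra.
apply: (@le_trans _ _ (8 / J%:R * (1 + 2 / h))).
  by rewrite le_eqVlt; apply/predU1P; left; field; lra.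
have J8 : 8 / J%:R <= 32 * rho / (M * u0).
  rewrite ler_pdivrMr// mulrAC ler_pdivlMr ?mulr_gt0//.
  have rho0 : 0 < 2 * rho by lra.
  by move: JR2; rewrite /X ler_pdivrMr//; lra.
apply: (@le_trans _ _ (32 * rho / (M * u0) * (1 + 2 / h))).
  by rewrite ler_wpM2r// addr_ge0// divr_ge0// ltW.
rewrite hE.
have un : u0 != 0 by rewrite gt_eqF.
have Mn : M != 0 by rewrite gt_eqF.
have skn : Num.sqrt k%:R != 0 :> R by rewrite gt_eqF.
have svn : Num.sqrt v != 0 by rewrite gt_eqF.
have -> : 32 * rho / (M * u0) * (1 + 2 * M / (Num.sqrt k%:R * Num.sqrt v)) =
    32 / u0 * rho * (M^-1 + 2 / (Num.sqrt k%:R * Num.sqrt v)).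
  by move: u0 un => w un; field; rewrite ?un ?Mn ?skn ?svn.
have -> : C * rho / Num.sqrt k%:R = 32 / u0 * rho * ((Num.sqrt k%:R)^-1 + 2 / (Num.sqrt k%:R * Num.sqrt v)).
  by rewrite /C; move: u0 un => w un; field; rewrite ?un ?Mn ?skn ?svn.
have r0 : 0 <= rho by lra.
have u00 := ltW u0_gt0.
apply: ler_wpM2l; first by rewrite mulr_ge0// divr_ge0.
by rewrite lerD2r lef_pV2 ?posrE.
Qed.

(** The root of k + 1 lets k = 0 be included, where the bound is trivial; the change of index costs
    at most a factor 2. Linearity in [rho] is what later yields a Lipschitz bound. *)
Lemma walk_concentration : exists2 C : R, 0 <= C & forall k (M b rho : R) x,
  Num.sqrt k.+1%:R <= M -> 1 <= rho ->
  iter k walkT (fun x => (`|sin ((x 0 t - b) / M)| <= rho / M)%R%:R) x <=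
    C * rho / Num.sqrt k.+1%:R.
Proof.
have sv : 0 < Num.sqrt v by rewrite sqrtr_gt0.
have u00 := ltW u0_gt0.
have C0 : 0 <= C by rewrite /C mulr_ge0 ?divr_ge0// addr_ge0// divr_ge0// ltW.
exists (2 * C + 1); first by rewrite addr_ge0// mulr_ge0.
move=> [|k] M b rho x kM rho1.
  rewrite sqrtr1 divr1 /=; apply: (@le_trans _ _ 1); first by rewrite lern1 leq_b1.
  have Cr : 0 <= C * rho by rewrite mulr_ge0//; lra.
  by lra.
have s1 : 0 < Num.sqrt k.+1%:R :> R by rewrite sqrtr_gt0.
have s2 : 0 < Num.sqrt k.+2%:R :> R by rewrite sqrtr_gt0.
have s12 : Num.sqrt k.+1%:R <= Num.sqrt k.+2%:R :> R by rewrite ler_sqrt// ler_nat.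
have s21 : Num.sqrt k.+2%:R <= 2 * Num.sqrt k.+1%:R :> R.
  rewrite -[X in X * _](@ger0_norm R 2)// -sqrtr_sqr -sqrtrM ?sqr_ge0//.
  by rewrite ler_sqrt// -natrX -natrM ler_nat; lia.
apply: le_trans (conc_pos _ _ _ _ rho1) _ => //; first exact: le_trans kM.
rewrite ler_pdivrMr// [leRHS]mulrAC ler_pdivlMr//.
have Cr : 0 <= C * rho by rewrite mulr_ge0//; lra.
have : C * rho * Num.sqrt k.+2%:R <= C * rho * (2 * Num.sqrt k.+1%:R) by rewrite ler_wpM2l.
have : 0 <= rho * Num.sqrt k.+1%:R by rewrite mulr_ge0//; lra.
by lra.
Qed.

End concentration.

(** * Smooth test functions *)

Section smoothstep.
Variable R : realType.
Implicit Types x : R.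

(** The cubic 3 x^2 - 2 x^3, with attracting fixed points 0 and 1 and a repelling one at 1/2,
    written in the form to which [is_tpM] and [is_tpD] apply. *)
Definition smoothstep x : R := x * x * (3 + (- 2) * x).

Lemma smoothstep01 x : 0 <= x <= 1 -> 0 <= smoothstep x <= 1.
Proof.
move=> /andP[x0 x1]; rewrite /smoothstep; apply/andP; split.
  by rewrite !mulr_ge0//; lra.
rewrite -subr_ge0 (_ : 1 - _ = (1 - x) ^+ 2 * (1 + 2 * x)); last by ring.
by rewrite mulr_ge0 ?sqr_ge0//; lra.
Qed.

Lemma iter_smoothstep01 n x : 0 <= x <= 1 -> 0 <= iter n smoothstep x <= 1.
Proof. by move=> x01; elim: n => //= n; exact: smoothstep01. Qed.

Lemma smoothstep_sym x : smoothstep (1 - x) = 1 - smoothstep x.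
Proof. by rewrite /smoothstep; ring. Qed.

Lemma iter_smoothstep_sym n x : iter n smoothstep (1 - x) = 1 - iter n smoothstep x.
Proof. by elim: n => //= n ->; exact: smoothstep_sym. Qed.

Lemma iter_smoothstep_decay (de : R) n x : 0 < de -> 0 <= x <= 2^-1 - de ->
  0 <= iter n smoothstep x <= (1 - de) ^+ n * 2^-1 /\ iter n smoothstep x <= 2^-1 - de.
Proof.
move=> de0 /andP[x0 xd].
have de1 : 0 <= 1 - de by lra.
elim: n => [|n [/andP[i0 i1] i2]] /=; first by rewrite expr0 mul1r x0 xd; split => //; lra.
set z := iter n smoothstep x in i0 i1 i2 *.
have H : smoothstep z <= (1 - de) * z.
  rewrite /smoothstep -subr_ge0.
  rewrite (_ : _ - _ = z * ((2^-1 - de - z) * (2 * (1 + de) - 2 * z) + 2 * de ^+ 2)); last by field.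
  by rewrite mulr_ge0// addr_ge0 ?mulr_ge0 ?sqr_ge0//; lra.
split; last by apply: le_trans H _; nra.
apply/andP; split; first by rewrite /smoothstep !mulr_ge0//; lra.
apply: le_trans H _; rewrite exprS -mulrA ler_wpM2l//.
Qed.

(** Iterating the cubic on (1 + r) / 2 drives it to 0 or 1 away from r = 0. The result is a
    polynomial, so it preserves trigonometric polynomials, and its symmetry about 1/2 reduces the
    right half to the left one. *)
Lemma exists_smooth_sign (ze et : R) : 0 < ze -> 0 < et -> exists q : R -> R, [/\
  forall r, -1 <= r <= 1 -> 0 <= q r <= 1,
  forall r, -1 <= r <= - ze -> q r <= et,
  forall r, ze <= r <= 1 -> 1 - et <= q r &
  forall d (f : 'rV[R]_d -> R), is_tp f -> is_tp (fun x : 'rV[R]_d => q (f x))].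
Proof.
move=> ze0 et0.
(* Bernoulli's inequality bounds the N-th power of 1 - ze / 2 by 1 / (1 + N ze / 2), which is then
   below [et]. *)
pose N := (Num.trunc (2 / (ze * et))).+1.
pose q r := iter N smoothstep (2^-1 + 2^-1 * r).
have small r : -1 <= r <= - ze -> q r <= et.
  move=> /andP[r1 rz].
  have [] := @iter_smoothstep_decay (ze / 2) N (2^-1 + 2^-1 * r); [lra|apply/andP; split; lra|].
  move=> /andP[_ H] _; apply: le_trans H _.
  have ze1 : ze / 2 <= 2^-1 by lra.
  apply: (@le_trans _ _ ((1 + ze / 2)^-1 ^+ N)).
    apply: (@le_trans _ _ ((1 - ze / 2) ^+ N)); first by rewrite ler_piMr ?exprn_ge0//; lra.
    by rewrite lerXn2r ?nnegrE ?invr_ge0; [|lra|lra|rewrite -[leRHS]div1r ler_pdivlMr; nra].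
  rewrite exprVn -[leLHS]div1r ler_pdivrMr ?exprn_gt0//; last lra.
  have B n : 1 + n%:R * (ze / 2) <= (1 + ze / 2) ^+ n.
    elim: n => [|n IH]; first by rewrite mul0r addr0 expr0.
    rewrite exprS -natr1; have n0 : 0 <= n%:R :> R by [].
    have : (1 + ze / 2) * (1 + n%:R * (ze / 2)) <= (1 + ze / 2) * (1 + ze / 2) ^+ n.
      by rewrite ler_wpM2l//; lra.
    by apply: le_trans; have := mulr_ge0 n0 (sqr_ge0 ze); nra.
  apply: (@le_trans _ _ (et * (1 + N%:R * (ze / 2)))); last by rewrite ler_wpM2l ?B// ltW.
  have zet : 0 < ze * et by rewrite mulr_gt0.
  have : 2 / (ze * et) <= N%:R by rewrite ltW// Num.Theory.truncnS_gt.
  rewrite ler_pdivrMr// => HN.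
  by rewrite mulrDr mulr1; nra.
have qN r : q (- r) = 1 - q r.
  by rewrite /q -iter_smoothstep_sym; congr iter; field.
exists q; split => //.
- move=> r /andP[r1 r2]; apply: iter_smoothstep01; apply/andP; split; lra.
- move=> r /andP[r1 r2]; have := small (- r); rewrite qN => H.
  suff : 1 - q r <= et by lra.
  by apply: H; apply/andP; split; lra.
- move=> d f tf; rewrite /q; move: (N) => N1; elim: N1 => [|n IH] /=.
    by apply: is_tpD; [exact: is_tp_cst|exact: is_tpZ].
  rewrite /smoothstep; apply: is_tpM; first exact: is_tpM.
  by apply: is_tpD; [exact: is_tp_cst|exact: is_tpZ].
Qed.

End smoothstep.

Section test_function.
Variables (R : realType) (d : nat).

(** The factors are replaced one at a time; all remaining factors are at most 1. *)
Lemma prod01_dist (I : Type) (r : seq I) (Q : pred I) (f g : I -> R) :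
  (forall i, 0 <= f i <= 1) -> (forall i, 0 <= g i <= 1) ->
  `|\prod_(i <- r | Q i) f i - \prod_(i <- r | Q i) g i| <= \sum_(i <- r | Q i) `|f i - g i|.
Proof.
move=> f01 g01.
have prod01 : 0 <= \prod_(i <- r | Q i) g i <= 1.
  apply/andP; split; first by apply: prodr_ge0 => i _; have /andP[] := g01 i.
  by apply: prodr_ile1 => i _; exact: g01.
elim: r prod01 => [|i r IH]; first by rewrite !big_nil subrr normr0.
rewrite !big_cons; case: ifP => Qi; last exact: IH.
have {}prod01 : 0 <= \prod_(i <- r | Q i) g i <= 1.
  apply/andP; split; first by apply: prodr_ge0 => j _; have /andP[] := g01 j.
  by apply: prodr_ile1 => j _; exact: g01.
move=> _; have {}IH := IH prod01.
set F := \prod_(i <- r | Q i) f i in IH *; set G := \prod_(i <- r | Q i) g i in prod01 IH *.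
rewrite (_ : f i * F - g i * G = (f i - g i) * G + f i * (F - G)); last by ring.
apply: le_trans (ler_normD _ _) _; rewrite !normrM lerD//.
  by have /andP[G0 G1] := prod01; rewrite (ger0_norm G0) ler_piMr.
have /andP[f0 f1] := f01 i; rewrite (ger0_norm f0).
by apply: le_trans IH; rewrite ler_piMl.
Qed.

Variables (q : R -> R) (ze et M : R).
Hypothesis M0 : 0 < M.
Hypothesis q01 : forall r, -1 <= r <= 1 -> 0 <= q r <= 1.
Hypothesis q_small : forall r, -1 <= r <= - ze -> q r <= et.
Hypothesis q_large : forall r, ze <= r <= 1 -> 1 - et <= q r.
Hypothesis ze0 : 0 < ze.
Hypothesis zeM : ze <= M^-1.
Hypothesis et0 : 0 < et.

(** The shift moves the sine by at most |v| / M. If the sine exceeds (|v| + 1) / M in absolute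
    value, both sines lie on the same side of the band of width [ze] and the values agree up to
    [et]; otherwise the indicator pays the trivial bound 1. *)
Lemma q_dist (a b v : R) : `|q (sin ((a + v - b) / M)) - q (sin ((a - b) / M))| <=
  et + (`|sin ((a - b) / M)| <= (`|v| + 1) / M)%R%:R.
Proof.
have sd := sin_dist ((a + v - b) / M) ((a - b) / M).
have vE : `|(a + v - b) / M - (a - b) / M| = `|v| / M.
  by rewrite -mulrBl normrM normfV (gtr0_norm M0); congr (`|_| / _); ring.
rewrite vE in sd.
set r1 := sin ((a + v - b) / M) in sd *; set r2 := sin ((a - b) / M) in sd *.
have r1b : -1 <= r1 <= 1 by rewrite sin_geN1 sin_le1.
have r2b : -1 <= r2 <= 1 by rewrite sin_geN1 sin_le1.
have /andP[q10 q11] := q01 r1b; have /andP[q20 q21] := q01 r2b.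
case: (leP `|r2| ((`|v| + 1) / M)) => /= [_|H].
  by have := et0; rewrite mulr1n ler_norml => et1; apply/andP; split; lra.
have Mv : (`|v| + 1) / M = `|v| / M + M^-1 by rewrite mulrDl mul1r.
rewrite Mv in H; have zM := zeM; have z0 := ze0; have e0 := et0.
rewrite addr0; move: sd; rewrite ler_norml => /andP[sd1 sd2].
have v0 : 0 <= `|v| / M by rewrite divr_ge0// ltW.
case/andP: r1b => r11 r12; case/andP: r2b => r21 r22.
have [r20|r20] := leP 0 r2.
  rewrite (ger0_norm r20) in H.
  have H2 : 1 - et <= q r2 by apply: q_large; apply/andP; split; lra.
  have H1 : 1 - et <= q r1 by apply: q_large; apply/andP; split; lra.
  by rewrite ler_norml; apply/andP; split; lra.
rewrite (ltr0_norm r20) in H.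
have H1 : q r1 <= et by apply: q_small; apply/andP; split; lra.
have H2 : q r2 <= et by apply: q_small; apply/andP; split; lra.
by rewrite ler_norml; apply/andP; split; lra.
Qed.

Definition testfun (Q : pred 'I_d) (b : 'I_d -> R) (x : 'rV[R]_d) : R :=
  \prod_(t | Q t) q (sin ((x 0 t - b t) / M)).

Let qs01 (z : R) : 0 <= q (sin z) <= 1.
Proof. by apply: q01; rewrite sin_geN1 sin_le1. Qed.

Lemma testfun01 Q b x : 0 <= testfun Q b x <= 1.
Proof.
apply/andP; split; first by apply: prodr_ge0 => t _; have /andP[] := qs01 ((x 0 t - b t) / M).
by apply: prodr_ile1 => t _; exact: qs01.
Qed.

Lemma testfun_dist (Q : pred 'I_d) b (x v : 'rV[R]_d) : `|testfun Q b (x + v) - testfun Q b x| <=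
  \sum_(t | Q t) (et + (`|sin ((x 0 t - b t) / M)| <= (`|v 0 t| + 1) / M)%R%:R).
Proof.
apply: le_trans (prod01_dist _ _ _ _) _ => [t|t|]; [exact: qs01|exact: qs01|].
by apply: ler_sum => t _; rewrite mxE q_dist.
Qed.

Lemma testfun_small (Q : pred 'I_d) b (x : 'rV[R]_d) t : Q t -> -1 <= sin ((x 0 t - b t) / M) <= - ze ->
  testfun Q b x <= et.
Proof.
move=> Qt H; rewrite /testfun (bigD1 t)//=.
apply: le_trans (q_small H).
have /andP[q0 q1] := qs01 ((x 0 t - b t) / M).
rewrite ler_piMr//; apply: prodr_ile1 => k _; exact: qs01.
Qed.

Lemma testfun_large (Q : pred 'I_d) b (x : 'rV[R]_d) : (forall t, Q t -> ze <= sin ((x 0 t - b t) / M)) ->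
  1 - d%:R * et <= testfun Q b x.
Proof.
move=> H.
have := @prod01_dist 'I_d (index_enum 'I_d) Q (fun=> 1) (fun t => q (sin ((x 0 t - b t) / M)))
  (fun=> _) (fun t => qs01 _).
rewrite big1// -/(testfun Q b x) => /(_ _)/wrap[]; first by rewrite ler01 lexx.
move=> H1; suff : \sum_(t | Q t) `|1 - q (sin ((x 0 t - b t) / M))| <= d%:R * et.
  by move: H1; rewrite ler_norml => /andP[_ H1]; lra.
apply: (@le_trans _ _ (\sum_(t < d) et)); last by rewrite sumr_const card_ord mulr_natl.
rewrite big_mkcond; apply: ler_sum => t _; case: ifP => Qt; last exact: ltW.
have /andP[q0 q1] := qs01 ((x 0 t - b t) / M).
rewrite ger0_norm ?subr_ge0//.
have := q_large (_ : ze <= sin ((x 0 t - b t) / M) <= 1).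
by rewrite H// sin_le1 => /(_ isT); lra.
Qed.

End test_function.

Section real_sums.
Variable R : realType.

Lemma ln2_ge_half : 2^-1 <= ln 2 :> R.
Proof.
have := @le_ln1Dx R (- 2^-1); rewrite (_ : 1 - 2^-1 = 2^-1); last by field.
by rewrite lnV ?posrE// => H; have := H (_ : -1 < - 2^-1); lra.
Qed.

Lemma ln_nat_ge_half n : (2 <= n)%N -> 2^-1 <= ln n%:R :> R.
Proof.
move=> n2; apply: le_trans ln2_ge_half _.
by rewrite ler_ln ?posrE ?ltr0n ?ler_nat//; lia.
Qed.

Lemma sum_inv_le n : (0 < n)%N -> \sum_(0 <= k < n) (k.+1%:R)^-1 <= 1 + ln n%:R :> R.
Proof.
case: n => // n _; elim: n => [|n IH].
  by rewrite big_nat1 invr1 ln1 addr0.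
rewrite big_nat_recr//=; apply: le_trans (lerD IH (lexx _)) _.
have n1 : 0 < n.+1%:R :> R by rewrite ltr0n.
have n2 : 0 < n.+2%:R :> R by rewrite ltr0n.
have := @le_ln1Dx R (- n.+2%:R^-1).
have -> : 1 - n.+2%:R^-1 = n.+1%:R / n.+2%:R :> R.
  have nn : n.+2%:R != 0 :> R by rewrite gt_eqF.
  by apply: (mulIf nn); rewrite mulrBl mulVf// mul1r divfK// -[n.+2%:R]natr1 addrK.
rewrite ln_div ?posrE// => H.
have : -1 < - n.+2%:R^-1 :> R by rewrite ltrN2 invf_lt1// ltr1n.
move=> /H; move: (ln n.+1%:R) (ln n.+2%:R) (n.+2%:R^-1 : R) => a b c.
by lra.
Qed.

Lemma sum_inv_sqrt_le n : \sum_(0 <= k < n) (Num.sqrt k.+1%:R)^-1 <= 2 * Num.sqrt n%:R :> R.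
Proof.
elim: n => [|n IH]; first by rewrite big_geq// sqrtr0 mulr0.
rewrite big_nat_recr//=; apply: le_trans (lerD IH (lexx _)) _.
set a := Num.sqrt n%:R; set b := Num.sqrt n.+1%:R.
have b0 : 0 < b by rewrite sqrtr_gt0 ltr0n.
have a0 : 0 <= a by rewrite sqrtr_ge0.
have ab : b ^+ 2 = a ^+ 2 + 1 by rewrite !sqr_sqrtr// natr1.
rewrite -lerBrDl -[leLHS]div1r ler_pdivrMr//.
by have := sqr_ge0 (a - b); nra.
Qed.

(** If 4 (k + 1) >= n, the root factor is at most 2 / sqrt n and a harmonic sum remains; otherwise n
    - k >= n / 2 and a sum of inverse roots remains. The constant 14 comes from 2 ln n + 6 <= 14 ln
    n, as ln n >= 1/2. *)
Lemma lindeberg_sum_le n : (2 <= n)%N ->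
  \sum_(0 <= k < n) (Num.sqrt k.+1%:R)^-1 / (n - k)%:R <=
    14 * (ln n%:R / Num.sqrt n%:R) :> R.
Proof.
move=> n2; have n0 : 0 < n%:R :> R by rewrite ltr0n; lia.
set s := Num.sqrt n%:R; have s0 : 0 < s by rewrite sqrtr_gt0.
have ss : s ^+ 2 = n%:R by rewrite sqr_sqrtr// ltW.
apply: (@le_trans _ _ (\sum_(0 <= k < n)
    (2 / s * (n - k)%:R^-1 + 2 / n%:R * (Num.sqrt k.+1%:R)^-1))).
  rewrite !big_nat; apply: ler_sum => k /andP[_ kn].
  set b := Num.sqrt k.+1%:R; set c : R := (n - k)%:R.
  have b0 : 0 < b by rewrite sqrtr_gt0 ltr0n.
  have c0 : 0 < c by rewrite ltr0n subn_gt0.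
  have bb : b ^+ 2 = k.+1%:R by rewrite sqr_sqrtr.
  have bi : 0 <= b^-1 by rewrite invr_ge0 ltW.
  have ci : 0 <= c^-1 by rewrite invr_ge0 ltW.
  have [nk|kn2] := leP n%:R (4 * k.+1%:R : R).
    have : b^-1 <= 2 / s.
      rewrite -[leLHS]div1r ler_pdivrMr// mulrAC ler_pdivlMr// mul1r.
      rewrite -(@ler_pXn2r _ 2)// ?nnegrE ?mulr_ge0 ?(ltW b0) ?(ltW s0)//.
      by rewrite exprMn ss bb; apply: le_trans nk _; rewrite ler_wpM2r//; lra.
    move=> /(ler_wpM2r ci) H; apply: le_trans H _.
    by rewrite lerDl mulr_ge0// divr_ge0.
  have : c^-1 <= 2 / n%:R.
    rewrite -[leLHS]div1r ler_pdivrMr// mulrAC ler_pdivlMr// mul1r.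
    move: kn2; rewrite -natrM ltr_nat => kn2.
    by rewrite -natrM ler_nat; lia.
  move=> /(ler_wpM2l bi) H; apply: le_trans H _.
  by rewrite mulrC lerDr mulr_ge0// divr_ge0// ltW.
rewrite big_split/= -!mulr_sumr.
have -> : \sum_(0 <= k < n) (n - k)%:R^-1 = \sum_(0 <= k < n) k.+1%:R^-1 :> R.
  rewrite big_nat_rev/= !big_nat; apply: eq_bigr => k /andP[_ kn].
  by congr (_%:R^-1); lia.
apply: le_trans (lerD (ler_wpM2l _ (sum_inv_le _)) (ler_wpM2l _ (sum_inv_sqrt_le n))) _.
- by rewrite divr_ge0// ltW.
- by lia.
- by rewrite divr_ge0.
rewrite -/s -ss (_ : 2 / s ^+ 2 * (2 * s) = 4 / s); last by field; rewrite gt_eqF.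
rewrite (_ : 2 / s * _ + 4 / s = (2 * (1 + ln (s ^+ 2)) + 4) / s); last by field; rewrite gt_eqF.
rewrite mulrA ler_wpM2r ?invr_ge0 ?(ltW s0)// ss.
by have := @ln_nat_ge_half n n2; move: (ln n%:R) => L; lra.
Qed.

End real_sums.

(** * Almost Lipschitz bounds for walk averages of the test functions *)

Section walk_testfun.
Variables (R : realType) (d m : nat) (p : 'I_m -> R) (y : 'I_m -> 'rV[R]_d).
Hypothesis p_ge0 : forall a, 0 <= p a.
Hypothesis p_sum1 : \sum_a p a = 1.
Hypothesis y_mean0 : forall t, \sum_a p a * y a 0 t = 0.
Local Notation walkT := (walkT p y).
Let Q (t : 'I_d) := 0 < \sum_a p a * y a 0 t ^+ 2.

Lemma is_tp_testfun (q : R -> R) (M : R) (b : 'I_d -> R) :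
  (forall f : 'rV[R]_d -> R, is_tp f -> is_tp (fun x => q (f x))) ->
  is_tp (testfun q M Q b).
Proof.
move=> Hq; rewrite /testfun.
rewrite (_ : (fun x => _) = fun x : 'rV[R]_d =>
  \prod_t (if Q t then q (sin ((x 0 t - b t) / M)) else 1)); last first.
  by apply/funext => x; rewrite big_mkcond.
apply: is_tp_prod => t; case: (Q t); last exact: is_tp_cst.
apply: Hq; rewrite (_ : (fun x => _) = fun x => cos (dot (M^-1 *: delta_mx 0 t) x + (- (b t / M) - pi / 2))).
  exact: is_tp_cos.
apply/funext => x; rewrite addrA cosBpihalf dotZl dot_delta mulrBl; congr sin.
by rewrite mulrC.
Qed.

(** [q_dist] reduces an increment to the probability that a coordinate lies near its threshold,
    within |v_t| + 1; [walk_concentration] bounds it with that width as [rho]. The constant depends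
    neither on [n] nor on [M], [ze], [et], [q] or [b]. *)
Lemma walk_testfun_lip : exists2 C : R, 0 <= C &
  forall n (M ze et : R) (q : R -> R) (b : 'I_d -> R), (0 < n)%N ->
  Num.sqrt n%:R <= M -> 0 < ze -> ze <= M^-1 -> 0 < et -> et <= (Num.sqrt n%:R)^-1 ->
  (forall r, -1 <= r <= 1 -> 0 <= q r <= 1) ->
  (forall r, -1 <= r <= - ze -> q r <= et) ->
  (forall r, ze <= r <= 1 -> 1 - et <= q r) ->
  forall k, (k < n)%N -> almost_lip (C / Num.sqrt k.+1%:R) (iter k walkT (testfun q M Q b)).
Proof.
have /choice [C HC] : forall t, exists C : R, 0 <= C /\ (Q t ->
    forall k (M b rho : R) x, Num.sqrt k.+1%:R <= M -> 1 <= rho ->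
    iter k walkT (fun x => (`|sin ((x 0 t - b) / M)| <= rho / M)%R%:R) x <=
      C * rho / Num.sqrt k.+1%:R).
  move=> t; case: (boolP (Q t)) => Qt; last by exists 0.
  by have [C C0 H] := walk_concentration p_ge0 p_sum1 (y_mean0 t) Qt; exists C.
exists (\sum_t (1 + C t)); first by apply: sumr_ge0 => t _; rewrite addr_ge0//; case: (HC t).
move=> n M ze et q b n0 nM ze0 zeM et0 etn q01 qs ql k kn x v.
have sn0 : 0 < Num.sqrt n%:R :> R by rewrite sqrtr_gt0 ltr0n.
have sk0 : 0 < Num.sqrt k.+1%:R :> R by rewrite sqrtr_gt0 ltr0n.
have skn : Num.sqrt k.+1%:R <= Num.sqrt n%:R :> R by rewrite ler_sqrt ?ler_nat.
have M0 : 0 < M by apply: lt_le_trans nM.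
have v0 : 0 <= \sum_t `|v 0 t| by exact: sumr_ge0.
have -> : iter k walkT (testfun q M Q b) (x + v) - iter k walkT (testfun q M Q b) x =
    iter k walkT (fun x => testfun q M Q b (x + v) - testfun q M Q b x) x.
  by rewrite iter_walkTB iter_walkT_shift.
apply: le_trans (iter_walkT_norm y p_ge0 _ _ _) _.
apply: le_trans (iter_walkT_le y p_ge0 k (fun x =>
   testfun_dist M0 q01 qs ql ze0 zeM et0 Q b x v) x) _.
rewrite [X in X <= _](_ : _ = \sum_(t | Q t) (et + iter k walkT
    (fun x => (`|sin ((x 0 t - b t) / M)| <= (`|v 0 t| + 1) / M)%R%:R) x)); last first.
  rewrite -big_filter; under eq_fun do rewrite -big_filter.
  rewrite (iter_walkT_sum y p_sum1); apply: eq_bigr => t _.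
  by rewrite iter_walkTD (iter_walkT_cst y p_sum1).
rewrite [leRHS](_ : _ = \sum_t (1 + C t) * (\sum_t `|v 0 t| + 1) / Num.sqrt k.+1%:R); last first.
  by rewrite -!mulr_suml mulrAC.
rewrite big_mkcond; apply: ler_sum => t _.
have [C0 Ht] := HC t.
case: ifP => [Qt|_]; last by rewrite divr_ge0 ?mulr_ge0 ?addr_ge0// ltW.
have vt : `|v 0 t| <= \sum_t `|v 0 t|.
  by rewrite (bigD1 t)//= lerDl sumr_ge0.
have r1 : 1 <= `|v 0 t| + 1 by rewrite lerDr.
apply: le_trans (lerD (lexx et) (Ht Qt k M (b t) _ x (le_trans skn nM) r1)) _.
have e1 : et <= (Num.sqrt k.+1%:R)^-1.
  by apply: le_trans etn _; rewrite lef_pV2.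
apply: (@le_trans _ _ ((1 + C t * (`|v 0 t| + 1)) / Num.sqrt k.+1%:R)).
  by rewrite mulrDl mul1r lerD2r.
rewrite ler_wpM2r ?invr_ge0 ?(ltW sk0)//.
have : C t * (`|v 0 t| + 1) <= C t * (\sum_t `|v 0 t| + 1) by rewrite ler_wpM2l// lerD2r.
by lra.
Qed.

End walk_testfun.

(** * Orthant probabilities *)

Section integral_indicators.
Context d (T : measurableType d) (R : realType) (P : probability T R).

Lemma Rintegral_indic (S : set T) : measurable S -> \int[P]_w (\1_S w) = fine (P S).
Proof. by move=> mS; rewrite /Rintegral integral_indic// setIT. Qed.

Lemma integrable_indic (S : set T) : measurable S ->
  P.-integrable setT (EFin \o (\1_S : T -> R)).
Proof.
move=> mS; apply: (bounded_integrable P (K := 1)) => [|w].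
  exact: measurable_indic.
by rewrite indicE ger0_norm ?ler0n// lern1 leq_b1.
Qed.

Lemma le_Rintegral_indic_sum (I : Type) (r : seq I) (S : I -> set T) (g f : T -> R) (c : R) :
  (forall i, measurable (S i)) ->
  P.-integrable setT (EFin \o g) -> P.-integrable setT (EFin \o f) ->
  (forall w, g w <= f w + c + \sum_(i <- r) \1_(S i) w) ->
  \int[P]_w g w <= \int[P]_w f w + c + \sum_(i <- r) fine (P (S i)).
Proof.
move=> mS ig; elim: r f => [|i r IH] f intf H.
  rewrite big_nil addr0.
  have ic : P.-integrable setT (EFin \o (fun=> c)) by exact: finite_measure_integrable_cst.
  have -> : \int[P]_w f w + c = \int[P]_w (f w + c).
    rewrite RintegralD// Rintegral_cst// (_ : fine _ = 1) ?mulr1//.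
    exact: (congr1 fine (probability_setT P)).
  apply: le_Rintegral => //; last by move=> w _; have := H w; rewrite big_nil addr0.
  by have := integrableD measurableT intf ic; apply: eq_integrable.
have iS := integrable_indic (mS i).
have intf' : P.-integrable setT (EFin \o (fun w => f w + \1_(S i) w)).
  by have := integrableD measurableT intf iS; apply: eq_integrable.
have := IH _ intf'; rewrite RintegralD// Rintegral_indic// big_cons => H'.
rewrite (_ : _ + c + _ = \int[P]_w f w + fine (P (S i)) + c + \sum_(j <- r) fine (P (S j))); last by ring.
apply: H' => w; have := H w; rewrite big_cons.
by move: (\sum_(i <- r) _) => s; lra.
Qed.

End integral_indicators.

Section bounded_walk.
Variables (R : realType) (d m : nat) (p : 'I_m -> R) (y : 'I_m -> 'rV[R]_d) (Y : R).
Hypothesis p_ge0 : forall a, 0 <= p a.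
Hypothesis yY : forall a t, `|y a 0 t| <= Y.

(** Bounded steps keep the walk in a known box, so functions need to be compared only there. This is
    how the period of the test functions stays invisible. *)
Lemma iter_walkT_le_bounded k f g (r : R) :
  (forall x : 'rV[R]_d, (forall t, `|x 0 t| <= r + k%:R * Y) -> f x <= g x) ->
  forall x : 'rV[R]_d, (forall t, `|x 0 t| <= r) ->
  iter k (walkT p y) f x <= iter k (walkT p y) g x.
Proof.
elim: k r => [|k IH] r fg x xr /=.
  by apply: fg => t; rewrite mul0r addr0.
apply: ler_sum => a _; rewrite ler_wpM2l//; apply: (IH (r + Y)) => [x' H|t].
  by apply: fg => t; apply: le_trans (H t) _; rewrite -natr1; lra.
by rewrite mxE; apply: le_trans (ler_normD _ _) _; rewrite lerD.
Qed.

End bounded_walk.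

Section orthant.
Context (R : realType) (dO : measure_display) (O : measurableType dO) (P : probability O R).
Variables (d : nat) (Z : 'I_d -> {RV P >-> R}) (V : 'M[R]_d).
Hypothesis HG : centered_gaussian Z V.
Hypothesis Vsym : V^T = V.
Hypothesis Vpsd : forall u, 0 <= dot u (u *m V).
Variables (m : nat) (p : 'I_m -> R) (y u : 'I_m -> 'rV[R]_d).
Hypothesis p_ge0 : forall a, 0 <= p a.
Hypothesis p_sum1 : \sum_a p a = 1.
Hypothesis y_mean0 : forall w, \sum_a p a * dot w (y a) = 0.
Hypothesis y_cov : forall w, dot w (w *m V) = \sum_a p a * dot w (y a) ^+ 2.
Hypothesis y_range : forall a, p a != 0 -> y a = u a *m V.
Variable z : 'I_d -> R.

Local Notation walkT := (walkT p y).
Let v (t : 'I_d) := \sum_a p a * y a 0 t ^+ 2.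
Let Q (t : 'I_d) := 0 < v t.

Let mZ t : measurable_fun setT (Z t). Proof. exact: measurable_funPT. Qed.

Let law t (B : set R) : measurable B -> P (Z t @^-1` B) = gauss1 (v t) B.
Proof.
move=> mB; have := dot_zvec_law HG (delta_mx 0 t) mB.
rewrite y_cov; under eq_bigr do rewrite dot_delta.
rewrite -/(v t) => <-; congr (P _).
by apply/seteqP; split => w; rewrite /= dot_delta mxE.
Qed.

Let v0 t : 0 <= v t.
Proof. by apply: sumr_ge0 => a _; rewrite mulr_ge0// sqr_ge0. Qed.

Let mtail (l : R) t : measurable [set w | (l <= `|Z t w|)%R].
Proof.
rewrite (_ : [set w | _] = (fun w => `|Z t w|) @^-1` `[l, +oo[%classic).
  by rewrite -[X in measurable X]setTI; apply: measurableT_comp.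
by apply/seteqP; split => w /=; rewrite in_itv/= andbT.
Qed.

Let mband (a b : R) t : measurable (Z t @^-1` `[a, b]).
Proof. by rewrite -[X in measurable X]setTI; exact: mZ. Qed.

Let E t := \int[P]_w expR `|Z t w|.

Let tail (l : R) t : fine (P [set w | (l <= `|Z t w|)%R]) <= E t * expR (- l).
Proof.
rewrite -lee_fin fineK ?fin_num_measure//.
exact: (gaussian_tail (mZ t) (v0 t) (@law t)).
Qed.

Let band (a b : R) t : Q t -> a <= b ->
  fine (P (Z t @^-1` `[a, b])) <= (b - a) * normal_peak (Num.sqrt (v t)).
Proof.
move=> Qt ab; rewrite -lee_fin fineK ?fin_num_measure//.
by apply: (gaussian_anticoncentration (v0 t) (@law t)) => //; rewrite gt_eqF.
Qed.

Definition orthant_event := [set w | forall t, Q t -> (z t <= Z t w)%R].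

Lemma measurable_orthant_event : measurable orthant_event.
Proof.
rewrite (_ : orthant_event = \bigcap_(t in [set t | Q t]) (Z t @^-1` `[z t, +oo[)).
  apply: fin_bigcap_measurable => // t _.
  by rewrite -[X in measurable X]setTI; exact: mZ.
apply/seteqP; split => w.
  by move=> H t /= Qt; rewrite in_itv/= andbT; exact: H.
by move=> H t Qt; have := H t Qt; rewrite /= in_itv/= andbT.
Qed.

Let ymean t : \sum_a p a * y a 0 t = 0.
Proof.
by have := y_mean0 (delta_mx 0 t); under eq_bigr do rewrite dot_delta.
Qed.

Let E_ge0 t : 0 <= E t.
Proof. by apply: Rintegral_ge0 => w _; exact: expR_ge0. Qed.

(** The cosine is at least 1/2 on [0, 1]. Hence with ze = 1 / (2 M) a distance of one unit from the
    threshold already leaves the transition band. *)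
Let sin_half_le (M r : R) : 0 < M -> 1 <= r -> r <= M -> (2 * M)^-1 <= sin (r / M).
Proof.
move=> M0 r1 rM; have rM0 : 0 <= r / M by rewrite divr_ge0 ?(ltW M0)//; lra.
have rM1 : r / M <= 1 by rewrite ler_pdivrMr ?mul1r.
have [c /andP[c0 cr] ->] := sin_mvt rM0.
have c1 := cos_ge_quadratic c.
have c2 : 2^-1 <= cos c by nra.
have MrM : M^-1 <= r / M by rewrite -[leLHS]mul1r ler_wpM2r// invr_ge0 ltW.
have Mi : 0 <= M^-1 by rewrite invr_ge0 ltW.
by rewrite invfM; nra.
Qed.

(** If some coordinate has x_t < a_t, the noise must exceed [lam] to bring it within one unit of b_t
    = a_t + lam + 1; otherwise that factor of the test function is at most [et]. *)
Let upper_half (q : R -> R) (M ze et : R) (a b : 'I_d -> R) (lam Yn : R) l :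
  0 < M -> ze = (2 * M)^-1 -> 0 < et ->
  (forall r, -1 <= r <= 1 -> 0 <= q r <= 1) ->
  (forall r, -1 <= r <= - ze -> q r <= et) ->
  (forall r, ze <= r <= 1 -> 1 - et <= q r) ->
  (forall t, b t = a t + lam + 1) ->
  (forall t, Yn + `|b t| + lam <= M) ->
  testfun q M Q b = tpeval l ->
  forall x : 'rV[R]_d, (forall t, `|x 0 t| <= Yn) ->
  tpeval (tpQ V 1 l) x <= [forall t, Q t ==> (a t <= x 0 t)%R]%:R +
    (et + \sum_t E t * expR (- lam)).
Proof.
move=> M0 zeE et0 q01 qs ql bE bM fE x xY.
rewrite -(tpeval_Q_integral HG Vpsd)// sqrtr1.
set I : R := _%:R.
apply: (@le_trans _ _ (\int[P]_w I + et + \sum_t fine (P [set w | (lam <= `|Z t w|)%R]))).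
  apply: (le_Rintegral_indic_sum (S := fun t => [set w | (lam <= `|Z t w|)%R])) => //.
  - exact: (tpeval_integrable Z l x 1).
  - exact: finite_measure_integrable_cst.
  move=> w; rewrite -fE scale1r.
  have sum0 : 0 <= \sum_t \1_[set w | (lam <= `|Z t w|)%R] w :> R.
    by apply: sumr_ge0 => t _; rewrite indicE.
  have /andP[f0 f1] := testfun01 M q01 Q b (x + zvec Z w).
  rewrite /I; case: (boolP [forall t, _]) => [_|] /=.
    by rewrite mulr1n; move: sum0 f1; move: (\sum_t _) (testfun _ _ _ _ _) => S f; lra.
  rewrite negb_forall => /existsP[t]; rewrite negb_imply -ltNge => /andP[Qt xa].
  have [lamZ|Zlam] := leP lam `|Z t w|.
    have : 1 <= \sum_t \1_[set w | (lam <= `|Z t w|)%R] w :> R.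
      rewrite (bigD1 t)//= indicE mem_set// mulr1n lerDl.
      by apply: sumr_ge0 => k _; rewrite indicE.
    by move: f1; move: (\sum_t _) (testfun _ _ _ _ _) => S f; lra.
  suff : testfun q M Q b (x + zvec Z w) <= et.
    by move: sum0; move: (\sum_t _) (testfun _ _ _ _ _) => S f; lra.
  apply: (testfun_small q01 qs Qt).
  rewrite sin_geN1/= mxE [zvec _ _ _ _]mxE.
  rewrite -[X in sin (X / M)]opprK mulNr sinN lerN2 zeE.
  move: Zlam; rewrite ltr_norml => /andP[Z1 Z2].
  have := xY t; rewrite ler_norml => /andP[x1 x2].
  have := bM t; have := ler_norm (b t); have := bE t => b1 b2 b3.
  by apply: sin_half_le => //; lra.
rewrite Rintegral_cst// (_ : fine _ = 1) ?mulr1 -?addrA; last first.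
  exact: (congr1 fine (probability_setT P)).
by rewrite lerD2l lerD2l; apply: ler_sum => t _; exact: tail.
Qed.

(** On the orthant event the test function is nearly 1 unless some Z_t is large or lies in the band
    of width [ga t] above z_t. The band is the margin for the shifted threshold, and its mass is
    bounded by the density. *)
Let lower_half (q : R -> R) (M ze et : R) (b ga : 'I_d -> R) (lam rt : R) l :
  0 < M -> ze = (2 * M)^-1 -> 0 < et -> 0 < rt ->
  (forall r, -1 <= r <= 1 -> 0 <= q r <= 1) ->
  (forall r, -1 <= r <= - ze -> q r <= et) ->
  (forall r, ze <= r <= 1 -> 1 - et <= q r) ->
  (forall t, 0 <= ga t) ->
  (forall t, b t + 1 <= rt * (z t + ga t)) ->
  (forall t, rt * lam + `|b t| <= M) ->
  testfun q M Q b = tpeval l ->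
  fine (P orthant_event) <= \int[P]_w tpeval l (0 + rt *: zvec Z w) + d%:R * et +
    \sum_t (E t * expR (- lam) + ga t * normal_peak (Num.sqrt (v t))).
Proof.
move=> M0 zeE et0 rt0 q01 qs ql ga0 bz bM fE.
have ze0 : 0 < ze by rewrite zeE invr_gt0 mulr_gt0.
pose S t := [set w | (lam <= `|Z t w|)%R] `|` (if Q t then Z t @^-1` `[z t, z t + ga t] else set0).
have mB t : measurable (if Q t then Z t @^-1` `[z t, z t + ga t] else set0).
  by case: (Q t) => //; exact: mband.
have mS t : measurable (S t) by apply: measurableU.
rewrite -(Rintegral_indic P measurable_orthant_event).
apply: (@le_trans _ _ (\int[P]_w tpeval l (0 + rt *: zvec Z w) + d%:R * et +
    \sum_t fine (P (S t)))).
  apply: le_Rintegral_indic_sum => //.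
  - exact: integrable_indic measurable_orthant_event.
  - exact: tpeval_integrable.
  move=> w; rewrite -fE add0r.
  have /andP[f0 f1] := testfun01 M q01 Q b (rt *: zvec Z w).
  have det : 0 <= d%:R * et by rewrite mulr_ge0// ltW.
  have sum0 : 0 <= \sum_t \1_(S t) w :> R.
    by apply: sumr_ge0 => t _; rewrite indicE.
  rewrite [leLHS]indicE; case: (boolP (w \in orthant_event)) => [|_] /=; last first.
    by move: sum0 f0; move: (\sum_t _) (testfun _ _ _ _ _) => s f; lra.
  rewrite inE => wA.
  have [/existsP[t /asboolP St]|] := boolP [exists t, `[< S t w >]].
    have : 1 <= \sum_t \1_(S t) w :> R.
      rewrite (bigD1 t)//= indicE mem_set// mulr1n lerDl.
      by apply: sumr_ge0 => k _; rewrite indicE.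
    by move: f0; rewrite mulr1n; move: (\sum_t _) (testfun _ _ _ _ _) => s f; lra.
  rewrite negb_exists => /forallP NS.
  suff : 1 - d%:R * et <= testfun q M Q b (rt *: zvec Z w).
    by move: sum0; rewrite mulr1n; move: (\sum_t _) (testfun _ _ _ _ _) => s f; lra.
  apply: (testfun_large q01 ql) => // t Qt.
  have := NS t; rewrite -asbool_neg => /asboolP; rewrite /S Qt => /not_orP[/negP].
  rewrite -ltNge ltr_norml => /andP[Z1 Z2] /=; rewrite in_itv/= => /negP.
  rewrite wA//= -ltNge => Z3.
  rewrite zeE mxE [zvec _ _ _ _]mxE.
  have r1 : rt * (z t + ga t) <= rt * Z t w by rewrite ler_wpM2l ?ltW.
  have r2 : rt * Z t w <= rt * lam by rewrite ler_wpM2l ?ltW.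
  have := bz t; have := bM t; have := ler_norm (- b t); rewrite normrN => b1 b2 b3.
  by apply: sin_half_le => //; lra.
rewrite lerD2l; apply: ler_sum => t _.
apply: (@le_trans _ _ (fine (P [set w | (lam <= `|Z t w|)%R]) +
    fine (P (if Q t then Z t @^-1` `[z t, z t + ga t] else set0)))).
  rewrite -lee_fin EFinD !fineK ?fin_num_measure//.
  exact: measureU2.
apply: lerD; first exact: tail.
case: (boolP (Q t)) => Qt; last by rewrite measure0/= mulr_ge0// normal_peak_ge0.
by apply: le_trans (band Qt _) _; rewrite ?lerDl// addrAC subrr add0r.
Qed.

Lemma walk_orthant_lower : exists C : R, forall n, (2 <= n)%N ->
  fine (P orthant_event) <=
    iter n walkT (fun x : 'rV[R]_d => [forall t, Q t ==> (Num.sqrt n%:R * z t <= x 0 t)%R]%:R) 0 +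
    C * (ln n%:R / Num.sqrt n%:R).
Proof.
have [CL CL0 HL] := walk_testfun_lip p_ge0 p_sum1 ymean.
pose B0 := \sum_a steinC Z (u a).
pose CB := 3 * B0 ^+ 3 + 8 * B0 ^+ 4.
pose D := \sum_t E t.
pose Pk := \sum_t (5 + 2 * `|z t|) * normal_peak (Num.sqrt (v t)).
exists (14 * CB * CL + 2 * (1 + d%:R) + 4 * D + Pk) => n n2.
have n0 : 0 < n%:R :> R by rewrite ltr0n; lia.
set s := Num.sqrt n%:R.
have s0 : 0 < s by rewrite sqrtr_gt0.
have ss : s ^+ 2 = n%:R by rewrite sqr_sqrtr// ltW.
have s1 : 1 <= s by rewrite -[leLHS]sqrtr1 ler_sqrt// ler1n; lia.
set L := ln n%:R.
have L2 : 2^-1 <= L by exact: ln_nat_ge_half.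
set X := L / s.
have si : s^-1 <= 2 * X by rewrite /X mulrA -[leLHS]mul1r ler_wpM2r ?invr_ge0 ?(ltW s0)//; lra.
have eL : expR (- L) <= s^-1.
  by rewrite expRN lnK ?posrE// lef_pV2 ?posrE// -ss; nra.
(* The n steps together with the extra unit of noise give n + 1 units of Gaussian time. *)
pose rt := Num.sqrt n.+1%:R : R.
have rt0 : 0 < rt by rewrite sqrtr_gt0 ltr0n.
have rts : s <= rt by rewrite ler_sqrt ?ler_nat.
have rts1 : rt <= s + 1.
  have sp : 0 <= s + 1 by lra.
  rewrite -(@ler_pXn2r _ 2)// ?nnegrE ?(ltW rt0)//.
  by rewrite sqrrD1 ss sqr_sqrtr// -natr1 mulr2n; lra.
pose Y := \sum_a \sum_t `|y a 0 t|.
have yY a t : `|y a 0 t| <= Y.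
  rewrite /Y (bigD1 a)//= (bigD1 t)//= -addrA lerDl addr_ge0 ?sumr_ge0// => k _.
  exact: sumr_ge0.
have Y0 : 0 <= Y by apply: sumr_ge0 => a _; apply: sumr_ge0.
pose b t := s * z t + L + 1.
pose bs := \sum_t `|b t|.
have bs0 : 0 <= bs by exact: sumr_ge0.
have bbs t : `|b t| <= bs by rewrite /bs (bigD1 t)//= lerDl sumr_ge0.
have nY : 0 <= n%:R * Y by rewrite mulr_ge0.
have rL : 0 <= rt * L by rewrite mulr_ge0 ?(ltW rt0)//; lra.
(* Large enough for concentration (M >= sqrt n), for every position of the walk plus its noise, and
   for the Gaussian range rt * L; every sine argument that matters then stays in [-1, 1]. *)
pose M := s + n%:R * Y + bs + (rt * L + L).
have M0 : 0 < M by rewrite /M; lra.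
pose ze := (2 * M)^-1.
have ze0 : 0 < ze by rewrite invr_gt0 mulr_gt0.
have zeM : ze <= M^-1 by rewrite lef_pV2 ?posrE ?mulr_gt0//; lra.
have si0 : 0 < s^-1 by rewrite invr_gt0.
have [q [q01 qs ql qtp]] := exists_smooth_sign ze0 si0.
have [l fE] := is_tp_testfun p y M b (qtp d).
have sM : s <= M by rewrite /M; lra.
have lip := HL n M ze s^-1 q b (ltnW n2) sM ze0 zeM si0 (lexx _) q01 qs ql.
rewrite fE in lip.
(* Here L + 1 is the shift in [b], another 1 is the unit margin, and |z_t| covers the change from
   sqrt n to sqrt (n + 1). *)
pose ga t := (L + 2 + `|z t|) / s.
have ga0 t : 0 <= ga t by rewrite divr_ge0 ?(ltW s0)// addr_ge0//; lra.
have bz t : b t + 1 <= rt * (z t + ga t).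
  have h1 : L + 2 + `|z t| <= rt * ga t.
    rewrite /ga mulrA ler_pdivlMr// [leRHS]mulrC ler_wpM2l//.
    by rewrite addr_ge0//; lra.
  have h2 : s * z t - `|z t| <= rt * z t.
    rewrite lerBlDl -lerBlDr -mulrBl.
    apply: le_trans (ler_norm _) _; rewrite normrM distrC (@ger0_norm _ (rt - s)) ?subr_ge0//.
    by rewrite ler_piMl// lerBlDl.
  by rewrite mulrDr /b; lra.
have bM1 t : rt * L + `|b t| <= M by have := bbs t; rewrite /M; lra.
have bM2 t : 0 + n%:R * Y + `|b t| + L <= M by have := bbs t; rewrite /M; lra.
have low := lower_half M0 erefl si0 rt0 q01 qs ql ga0 bz bM1 fE.
rewrite (tpeval_Q_integral HG Vpsd l 0 (ler0n R n.+1)) in low.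
have up : iter n walkT (tpeval (tpQ V 1 l)) 0 <=
    iter n walkT (fun x : 'rV[R]_d => [forall t, Q t ==> (s * z t <= x 0 t)%R]%:R) 0 +
    (s^-1 + \sum_t E t * expR (- L)).
  rewrite -[X in _ <= _ + X](congr1 (fun f => f 0) (iter_walkT_cst y p_sum1 n _)).
  rewrite -[leRHS](congr1 (fun f => f 0) (iter_walkTD p y n _ _)).
  apply: (@iter_walkT_le_bounded R d m p y Y p_ge0 yY n _ _ 0); last first.
    by move=> t; rewrite mxE normr0.
  by move=> x Hx; apply: (upper_half M0 erefl si0 q01 qs ql _ bM2 fE Hx) => t.
have K0 k : 0 <= CL / Num.sqrt k.+1%:R by rewrite divr_ge0// sqrtr_ge0.
have lin := lindeberg_telescope HG Vsym Vpsd p_ge0 p_sum1 y_mean0 y_cov y_range K0 lip.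
rewrite -/B0 -/CB in lin.
have {}lin : tpeval (tpQ V n.+1%:R l) 0 <= iter n walkT (tpeval (tpQ V 1 l)) 0 + 14 * CB * CL * X.
  have B00 : 0 <= B0 by apply: sumr_ge0 => a _; exact: steinC_ge0.
  have CB0 : 0 <= CB by rewrite addr_ge0// mulr_ge0// exprn_ge0.
  have : CB * \sum_(0 <= k < n) CL / Num.sqrt k.+1%:R / (n - k)%:R <= 14 * CB * CL * X.
    under eq_bigr do rewrite -mulrA.
    rewrite -mulr_sumr (_ : 14 * CB * CL * X = CB * (CL * (14 * X))); last by ring.
    by rewrite ler_wpM2l// ler_wpM2l// lindeberg_sum_le.
  move: lin; rewrite ler_norml => /andP[lin _].
  by move: lin; move: (iter n _ _ _) (\sum_(0 <= k < n) _) (tpeval _ _) => i1 i2 i3; lra.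
have D0 : 0 <= D by exact: sumr_ge0.
have DE : \sum_t E t * expR (- L) <= 2 * D * X.
  rewrite -mulr_suml -/D (_ : 2 * D * X = D * (2 * X)); last by ring.
  by rewrite ler_wpM2l// (le_trans eL si).
have GE : \sum_t (E t * expR (- L) + ga t * normal_peak (Num.sqrt (v t))) <= 2 * D * X + Pk * X.
  rewrite big_split lerD//= /Pk mulr_suml; apply: ler_sum => t _.
  rewrite [leRHS]mulrAC ler_wpM2r ?normal_peak_ge0// /ga /X mulrA ler_wpM2r ?invr_ge0 ?(ltW s0)//.
  by have := normr_ge0 (z t); nra.
have dE : d%:R / s <= 2 * d%:R * X.
  by rewrite (_ : 2 * d%:R * X = d%:R * (2 * X)) ?ler_wpM2l//; ring.
apply: le_trans low _; apply: le_trans (lerD (lerD lin dE) GE) _.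
have := le_trans up (lerD (lexx _) (lerD si DE)).
by lra.
Qed.

End orthant.

(** * Exponential concentration of types *)

Section cosh.
Variable R : realType.
Implicit Types x : R.

Lemma mvt_ge0 (f f' : R -> R) x : (forall x : R, is_derive x 1 f (f' x)) -> 0 <= x ->
  exists2 c, 0 <= c & f x - f 0 = f' c * x.
Proof.
move=> df x0.
have [c] := @MVT_segment R f f' 0 x x0 (fun y _ => df y)
  (derivable_within_continuous (fun y _ => @ex_derive _ _ _ _ _ _ _ (df y))).
by rewrite in_itv/= subr0 => /andP[c0 _] ->; exists c.
Qed.

(** For x >= 0 the quotient of the two sides is nonincreasing, because x cosh x >= sinh x, itself
    obtained by differentiating. *)
Lemma cosh_le_expR x : expR x + expR (- x) <= 2 * expR (x ^+ 2 / 2).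
Proof.
wlog x0 : x / 0 <= x.
  move=> H; have [/H//|/ltW x0] := leP 0 x.
  by have := H (- x); rewrite opprK sqrrN addrC; apply; rewrite oppr_ge0.
have expN (z : R) : 0 <= z -> expR (- z) <= expR z by move=> z0; rewrite ler_expR; lra.
have tanh (z : R) : 0 <= z -> 0 <= z * (expR z + expR (- z)) - (expR z - expR (- z)).
  move=> z0; pose k (z : R) := z * (expR z + expR (- z)) - (expR z - expR (- z)).
  pose k' (z : R) := z * (expR z - expR (- z)).
  have dk (w : R) : is_derive w 1 k (k' w).
    by apply: is_derive_eq; rewrite /GRing.scale/= /k'; ring.
  have [c c0] := mvt_ge0 dk z0; rewrite /k mul0r oppr0 subrr subr0 subr0 => ->.
  by rewrite mulr_ge0// mulr_ge0// subr_ge0 expN.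
pose r (z : R) := (expR z + expR (- z)) * expR (- (z ^+ 2 / 2)).
pose r' (z : R) := - ((z * (expR z + expR (- z)) - (expR z - expR (- z))) * expR (- (z ^+ 2 / 2))).
have dr (w : R) : is_derive w 1 r (r' w).
  by apply: is_derive_eq; rewrite /GRing.scale/= /r'; field.
have [c c0] := mvt_ge0 dr x0.
rewrite {2}/r expr0n/= mul0r oppr0 expR0 mulr1 => H.
have : r x <= 2.
  have : r' c * x <= 0 by rewrite /r' mulNr oppr_le0 mulr_ge0// mulr_ge0 ?expR_ge0// tanh.
  by rewrite -H; lra.
by rewrite /r [expR (- (x ^+ 2 / 2))]expRN ler_pdivrMr ?expR_gt0.
Qed.

Lemma ln2_le : ln 2 <= 4 / 5 :> R.
Proof.
rewrite -ler_expR lnK ?posrE//.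
have -> : expR (4 / 5) = expR 5^-1 ^+ 4 :> R by rewrite -expRM_natl.
apply: (@le_trans _ _ ((1 + 5^-1) ^+ 4)); first lra.
by rewrite lerXn2r ?nnegrE ?expR_ge0 ?expR_ge1Dx//; lra.
Qed.

End cosh.

Lemma dot_sqrD (R : realType) (m : nat) (x w : 'rV[R]_m) :
  dot (x + w) (x + w) = dot x x + 2 * dot x w + dot w w.
Proof. by rewrite !dotDl !dotDr (dotC w x); ring. Qed.

Section type_concentration.
Variables (R : realType) (m : nat) (p : 'rV[R]_m).
Hypothesis p_ge0 : forall a, 0 <= p 0 a.
Hypothesis p_sum1 : \sum_a p 0 a = 1.

Definition tstep (a : 'I_m) : 'rV[R]_m := delta_mx 0 a - p.

Local Notation walkT := (walkT (fun a => p 0 a) tstep).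

Let p_le1 a : p 0 a <= 1.
Proof. by rewrite -p_sum1 (bigD1 a)//= lerDl sumr_ge0. Qed.

Let dot_tstep_sqr a : dot (tstep a) (tstep a) <= 2.
Proof.
have -> : dot (tstep a) (tstep a) = 1 - 2 * p 0 a + dot p p.
  have tE w : dot (tstep a) w = w 0 a - dot p w.
    by rewrite /tstep dotDl dot_delta (dotC (- p)) dotNr (dotC w).
  by rewrite tE (dotC p) tE /tstep !mxE !eqxx /= mulr1n; ring.
have : dot p p <= 1.
  rewrite -p_sum1; apply: ler_sum => b _; rewrite ler_piMr//.
by have := p_ge0 a; lra.
Qed.

(** Jensen's inequality, through the tangent line of exp, replaces the mean by an independent copy.
    The difference is then symmetric, so exp becomes cosh and [cosh_le_expR] applies. *)
Let exp_sym (c : 'I_m -> R) :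
  \sum_a p 0 a * expR (c a - \sum_b p 0 b * c b) <=
  \sum_a \sum_b p 0 a * p 0 b * expR ((c a - c b) ^+ 2 / 2).
Proof.
set cb := \sum_b p 0 b * c b.
have jensen : expR (- cb) <= \sum_b p 0 b * expR (- c b).
  apply: (@le_trans _ _ (\sum_b p 0 b * (expR (- cb) * (1 + (cb - c b))))).
    rewrite le_eqVlt; apply/predU1P; left.
    under eq_bigr do rewrite mulrCA mulrDr mulr1 mulrBr.
    rewrite -mulr_sumr big_split/= sumrB -mulr_suml p_sum1 mul1r -/cb.
    by ring.
  apply: ler_sum => b _; rewrite ler_wpM2l//.
  rewrite [X in _ <= expR X](_ : _ = - cb + (cb - c b)); last by ring.
  by rewrite expRD ler_wpM2l ?expR_ge0// expR_ge1Dx.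
apply: (@le_trans _ _ (\sum_a \sum_b p 0 a * p 0 b * expR (c a - c b))).
  apply: ler_sum => a _.
  under eq_bigr do rewrite expRD -mulrA.
  rewrite -mulr_sumr ler_wpM2l// expRD.
  under eq_bigr do rewrite mulrCA.
  by rewrite -mulr_sumr ler_wpM2l ?expR_ge0.
have sym : \sum_a \sum_b p 0 a * p 0 b * expR (c a - c b) =
    \sum_a \sum_b p 0 a * p 0 b * expR (- (c a - c b)).
  rewrite exchange_big; apply: eq_bigr => a _; apply: eq_bigr => b _.
  by rewrite opprB [p 0 b * _]mulrC.
have : \sum_a \sum_b p 0 a * p 0 b * (expR (c a - c b) + expR (- (c a - c b))) <=
    \sum_a \sum_b p 0 a * p 0 b * (2 * expR ((c a - c b) ^+ 2 / 2)).
  by apply: ler_sum => a _; apply: ler_sum => b _; rewrite ler_wpM2l ?mulr_ge0// cosh_le_expR.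
under eq_bigr do (under eq_bigr do rewrite mulrDr; rewrite big_split/=).
rewrite big_split/= -sym.
under [X in _ <= X -> _]eq_bigr do (under eq_bigr do rewrite mulrCA; rewrite -mulr_sumr).
rewrite -mulr_sumr.
by move: (\sum_a \sum_b _) (\sum_a \sum_b _) => i1 i2; lra.
Qed.

(** In |x + Y|^2 the square of the step is at most 2, and the cross term is handled by [exp_sym],
    where 2 th^2 (x_a - x_b)^2 <= 4 th^2 |x|^2. *)
Let walk_exp (th : R) x : 0 <= th ->
  walkT (fun x => expR (th * dot x x)) x <= expR (2 * th) * expR ((th + 4 * th ^+ 2) * dot x x).
Proof.
move=> th0.
apply: (@le_trans _ _ (expR (2 * th) * expR (th * dot x x) *
   \sum_a p 0 a * expR (2 * th * x 0 a - \sum_b p 0 b * (2 * th * x 0 b)))).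
  rewrite /walkT mulr_sumr; apply: ler_sum => a _; rewrite mulrCA ler_wpM2l//.
  rewrite -!expRD ler_expR.
  have -> : dot (x + tstep a) (x + tstep a) =
      dot x x + 2 * (x 0 a - \sum_b p 0 b * x 0 b) + dot (tstep a) (tstep a).
    rewrite dot_sqrD; congr (_ + 2 * _ + _).
    by rewrite /tstep dotDr dotNr (dotC x) dot_delta (dotC x).
  have -> : \sum_b p 0 b * (2 * th * x 0 b) = 2 * th * \sum_b p 0 b * x 0 b.
    by rewrite mulr_sumr; apply: eq_bigr => b _; rewrite mulrCA.
  by have := ler_wpM2l th0 (dot_tstep_sqr a); lra.
rewrite [(th + _) * _]mulrDl [expR (th * _ + _)]expRD [leRHS]mulrA ler_wpM2l ?mulr_ge0 ?expR_ge0//.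
apply: le_trans (exp_sym _) _.
apply: (@le_trans _ _ (\sum_a \sum_b p 0 a * p 0 b * expR (4 * th ^+ 2 * dot x x))).
  apply: ler_sum => a _; apply: ler_sum => b _; rewrite ler_wpM2l ?mulr_ge0// ler_expR.
  have xx : 0 <= dot x x by apply: sumr_ge0 => k _; rewrite -expr2 sqr_ge0.
  have [->|ab] := eqVneq a b.
    by rewrite subrr expr0n/= mul0r !mulr_ge0// sqr_ge0.
  have xab : x 0 a ^+ 2 + x 0 b ^+ 2 <= dot x x.
    rewrite /dot (bigD1 a)//= (bigD1 b)//= 1?eq_sym// -!expr2 addrA lerDl.
    by apply: sumr_ge0 => k _; rewrite -expr2 sqr_ge0.
  rewrite (_ : (2 * th * x 0 a - 2 * th * x 0 b) ^+ 2 / 2 =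
    4 * th ^+ 2 * ((x 0 a - x 0 b) ^+ 2 / 2)); last by field.
  rewrite ler_wpM2l ?mulr_ge0 ?sqr_ge0//.
  by have := sqr_ge0 (x 0 a + x 0 b); nra.
under eq_bigr do rewrite -mulr_suml -mulr_sumr p_sum1 mulr1.
by rewrite -mulr_suml p_sum1 mul1r.
Qed.

(** Each step raises the exponent from th to th + 4 th^2. The sequence 1 / (n + 4 k) dominates this
    recursion backwards, from 1 / (5 n) at k = n to 1 / n at k = 0, and the factors exp (2 th) <=
    exp (2 / n) multiply to at most exp 2. *)
Lemma walk_exp_moment n : (0 < n)%N ->
  iter n walkT (fun x => expR ((5 * n%:R)^-1 * dot x x)) 0 <= expR 2.
Proof.
move=> n0; have nR : 0 < n%:R :> R by rewrite ltr0n.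
pose th k : R := (n%:R + 4 * k%:R)^-1.
have thp k : 0 < n%:R + 4 * k%:R :> R by rewrite ltr_pwDl// mulr_ge0.
have th0 k : 0 <= th k by rewrite invr_ge0 ltW.
have thn k : th k <= n%:R^-1 by rewrite lef_pV2 ?posrE// lerDl mulr_ge0.
have thS k : th k.+1 + 4 * th k.+1 ^+ 2 <= th k.
  rewrite /th -[k.+1%:R]natr1; set B : R := n%:R + 4 * k%:R; have B0 : 0 < B := thp k.
  rewrite (_ : n%:R + 4 * (k%:R + 1) = B + 4); last by rewrite /B; ring.
  rewrite -[leRHS]div1r ler_pdivlMr// (_ : _ * B = 1 - 16 / (B + 4) ^+ 2); last by field; lra.
  by rewrite gerDl oppr_le0 divr_ge0// sqr_ge0.
have main k x : (k <= n)%N -> iter k walkT (fun x => expR (th n * dot x x)) x <=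
    expR (2 * k%:R / n%:R) * expR (th (n - k)%N * dot x x).
  elim: k x => [|k IH] x kn; first by rewrite mulr0 mul0r expR0 mul1r subn0.
  apply: (@le_trans _ _ (walkT (fun x => expR (2 * k%:R / n%:R) * expR (th (n - k)%N * dot x x)) x)).
    by apply: ler_sum => a _; rewrite ler_wpM2l// IH// ltnW.
  rewrite -/(iter 1 walkT _) iter_walkTZ /=.
  apply: le_trans (ler_wpM2l (expR_ge0 _) (walk_exp _ (th0 _))) _.
  rewrite mulrA -!expRD ler_expR.
  have xx : 0 <= dot x x by apply: sumr_ge0 => b _; rewrite -expr2 sqr_ge0.
  apply: lerD.
    by have := thn (n - k)%N; rewrite -[k.+1%:R]natr1 (_ : 2 * (k%:R + 1) / n%:R = 2 * k%:R / n%:R + 2 * n%:R^-1) //; [lra|ring].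
  by rewrite ler_wpM2r// -(subnSK kn) thS.
have := main n 0 (leqnn n); rewrite dot0r mulr0 expR0 mulr1.
rewrite mulfK ?gt_eqF// (_ : th n = (5 * n%:R)^-1)// /th; congr (_^-1); ring.
Qed.

Lemma walk_type_tail n (l : R) : (0 < n)%N ->
  iter n walkT (fun x => (l < dot x x)%R%:R) 0 <= expR 2 * expR (- (l / (5 * n%:R))).
Proof.
move=> n0; have nR : 0 < n%:R :> R by rewrite ltr0n.
pose c := expR (- (l / (5 * n%:R))).
apply: (@le_trans _ _ (iter n walkT (fun x => c * expR ((5 * n%:R)^-1 * dot x x)) 0)).
  apply: iter_walkT_le => // x; case: ltP => /= lx; last by rewrite mulr_ge0 ?expR_ge0.
  rewrite mulr1n /c -expRD -[leLHS]expR0 ler_expR [X in - X + _]mulrC -mulrN -mulrDr mulr_ge0//.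
  by rewrite addrC subr_ge0 ltW.
by rewrite iter_walkTZ mulrC ler_wpM2r ?expR_ge0// walk_exp_moment.
Qed.

End type_concentration.

(** * Second-order Taylor expansion *)

Section ffun_walk.
Variables (R : realType) (d m : nat) (p : 'I_m -> R) (y : 'I_m -> 'rV[R]_d).

Let ffun_cons n (ag : 'I_m * {ffun 'I_n -> 'I_m}) : {ffun 'I_n.+1 -> 'I_m} :=
  [ffun i => if unlift ord0 i is Some j then ag.2 j else ag.1].

Let ffun_cons_bij n : bijective (@ffun_cons n).
Proof.
exists (fun f : {ffun 'I_n.+1 -> 'I_m} => (f ord0, [ffun j => f (lift ord0 j)])).
  move=> [a g]; rewrite /ffun_cons/= !ffunE unlift_none; congr (_, _).
  by apply/ffunP => j; rewrite !ffunE liftK.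
move=> f; apply/ffunP => i; rewrite !ffunE/=.
by case: unliftP => [j ->|->]; rewrite ?ffunE.
Qed.

Lemma ffun_sum_walk n (F : 'rV[R]_d -> R) x :
  \sum_(xs : {ffun 'I_n -> 'I_m}) (\prod_k p (xs k)) * F (x + \sum_k y (xs k)) =
  iter n (walkT p y) F x.
Proof.
elim: n x => [|n IH] x /=.
  pose f0 : {ffun 'I_0 -> 'I_m} := ffun0 (card_ord 0).
  rewrite (big_pred1 f0).
    by rewrite !big_ord0 mul1r addr0.
  by move=> f; apply/esym/eqP/ffunP => -[].
rewrite (reindex (@ffun_cons n)); last exact/onW_bij/ffun_cons_bij.
rewrite -(pair_big xpredT xpredT (fun a g => (\prod_k p (ffun_cons (a, g) k)) *
  F (x + \sum_k y (ffun_cons (a, g) k))))/=.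
apply: eq_bigr => a _; rewrite -IH mulr_sumr; apply: eq_bigr => g _.
rewrite !big_ord_recl !ffunE unlift_none/= mulrA; congr (_ * _ * F _).
  by apply: eq_bigr => k _; rewrite ffunE liftK.
rewrite addrA; congr (_ + _).
by apply: eq_bigr => k _; rewrite ffunE liftK.
Qed.

End ffun_walk.

Section spectral_norm.
Variables (R : realType) (m : nat).

Lemma l2norm_ge0 (w : 'cV[R]_m) : 0 <= l2norm w.
Proof. exact: sqrtr_ge0. Qed.

Lemma l2norm_sqr (w : 'cV[R]_m) : l2norm w ^+ 2 = \sum_i w i 0 ^+ 2.
Proof. by rewrite sqr_sqrtr// sumr_ge0// => i _; rewrite sqr_ge0. Qed.

Lemma specnorm_ub (A : 'M[R]_m) (w : 'cV[R]_m) : l2norm w = 1 -> l2norm (A *m w) <= specnorm A.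
Proof.
move=> w1; apply: ub_le_sup; last by exists w.
(* The supremum bounds its elements only for a bounded set; coordinates of a unit vector are at most
   1, which gives this bound by row sums. *)
exists (Num.sqrt (\sum_i (\sum_j `|A i j|) ^+ 2)) => _ [v /= v1 <-].
rewrite ler_sqrt; last by rewrite sumr_ge0// => i _; rewrite sqr_ge0.
apply: ler_sum => i _; rewrite -(real_normK (num_real _)) ler_sqr ?nnegrE ?sumr_ge0//.
rewrite mxE; apply: le_trans (ler_norm_sum _ _ _) _; apply: ler_sum => j _.
rewrite normrM ler_piMr// -(@ler_pXn2r _ 2)// ?nnegrE// expr1n real_normK ?num_real//.
rewrite -[leRHS](expr1n _ 2) -v1 l2norm_sqr (bigD1 j)//= lerDl sumr_ge0// => k _.
exact: sqr_ge0.
Qed.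

(** Normalize [h] and apply Cauchy-Schwarz in the weighted form |a b| <= N a^2 / 2 + b^2 / (2 N).
    The cases h = 0 and N = 0, which exclude the divisions, are treated apart. *)
Lemma specnorm_quad (A : 'M[R]_m) (h : 'rV[R]_m) :
  `|\sum_x \sum_y h 0 x * h 0 y * A x y| <= specnorm A * dot h h.
Proof.
set s := dot h h.
have sE : s = \sum_x h 0 x ^+ 2 by apply: eq_bigr => x _; rewrite expr2.
have s0 : 0 <= s by rewrite sE sumr_ge0// => x _; rewrite sqr_ge0.
have [s00|sn0] := eqVneq s 0.
  rewrite s00 mulr0 big1 ?normr0// => x _; rewrite big1// => k _.
  suff -> : h 0 x = 0 by rewrite !mul0r.
  have /eqP := s00; rewrite sE psumr_eq0 => [/allP/(_ x)|j _]; last exact: sqr_ge0.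
  by rewrite mem_index_enum => /(_ isT); rewrite sqrf_eq0 => /eqP.
pose r := Num.sqrt s.
have r0 : 0 < r by rewrite sqrtr_gt0 lt_neqAle eq_sym sn0.
have rs : r ^+ 2 = s by rewrite sqr_sqrtr.
pose v : 'cV[R]_m := \col_x (h 0 x / r).
have v2 : \sum_x v x 0 ^+ 2 = 1.
  under eq_bigr do rewrite mxE expr_div_n rs.
  by rewrite -mulr_suml -sE divff.
have v1 : l2norm v = 1 by rewrite /l2norm v2 sqrtr1.
have := specnorm_ub A v1; set N := specnorm A => Av.
have N0 : 0 <= N by apply: le_trans Av; exact: l2norm_ge0.
have AvN : \sum_x (A *m v) x 0 ^+ 2 <= N ^+ 2.
  by rewrite -l2norm_sqr ler_sqr ?nnegrE ?l2norm_ge0.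
have -> : \sum_x \sum_y h 0 x * h 0 y * A x y = s * \sum_x v x 0 * (A *m v) x 0.
  rewrite mulr_sumr; apply: eq_bigr => x _; rewrite [(A *m v) x 0]mxE !mulr_sumr.
  apply: eq_bigr => k _; rewrite !mxE -rs.
  by field; rewrite gt_eqF.
rewrite normrM (ger0_norm s0) mulrC ler_wpM2r//.
have [N00|Nn0] := eqVneq N 0.
  rewrite N00 big1 ?normr0// => x _; suff -> : (A *m v) x 0 = 0 by rewrite mulr0.
  have : \sum_x (A *m v) x 0 ^+ 2 = 0.
    apply/eqP; rewrite eq_le; apply/andP; split; first by apply: le_trans AvN _; rewrite N00 expr0n.
    by apply: sumr_ge0 => k _; exact: sqr_ge0.
  move=> /eqP; rewrite psumr_eq0 => [/allP/(_ x)|j _]; last exact: sqr_ge0.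
  by rewrite mem_index_enum => /(_ isT); rewrite sqrf_eq0 => /eqP.
have Np : 0 < N by rewrite lt_neqAle eq_sym Nn0.
apply: le_trans (ler_norm_sum _ _ _) _.
apply: (@le_trans _ _ (\sum_x (N / 2 * v x 0 ^+ 2 + (2 * N)^-1 * (A *m v) x 0 ^+ 2))).
  apply: ler_sum => x _; set a := v x 0; set b := (A *m v) x 0.
  rewrite normrM -(real_normK (num_real a)) -(real_normK (num_real b)).
  rewrite -subr_ge0 (_ : _ - _ = (2 * N)^-1 * (N * `|a| - `|b|) ^+ 2); last by field; rewrite gt_eqF.
  by rewrite mulr_ge0 ?sqr_ge0// invr_ge0 mulr_ge0.
rewrite big_split -!mulr_sumr v2 mulr1 /=.
have : (2 * N)^-1 * \sum_x (A *m v) x 0 ^+ 2 <= (2 * N)^-1 * N ^+ 2.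
  by rewrite ler_wpM2l// invr_ge0 mulr_ge0.
rewrite (_ : (2 * N)^-1 * N ^+ 2 = N / 2); last by field; rewrite gt_eqF.
by move: (_ * \sum_x _) => i; lra.
Qed.

End spectral_norm.

Section path_mvt.
Variables (R : realType) (m : nat).
Implicit Types (f : 'rV[R]_m -> R) (q h c b : 'rV[R]_m).

Definition box c (e : R) q := forall x, `|q 0 x - c 0 x| < e.

Lemma is_derive_line f b (v : 'rV[R]_m) (s : R) : derivable f (b + s *: v) v ->
  is_derive s 1 (fun s => f (b + s *: v)) (derive f (b + s *: v) v).
Proof.
have E : (fun h : R => h^-1 *: (((fun s => f (b + s *: v)) \o shift s) (h *: 1) - f (b + s *: v))) =
    (fun h : R => h^-1 *: ((f \o shift (b + s *: v)) (h *: v) - f (b + s *: v))).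
  apply/funext => h /=; congr (_ *: (f _ - _)).
  by rewrite [h *: 1]mulr1 scalerDl addrCA.
by move=> df; apply: DeriveDef; rewrite /derivable /derive E.
Qed.

Lemma coord_mvt f b (x : 'I_m) (a : R) :
  (forall s, 0 <= s <= 1 -> derivable f (b + (s * a) *: ebasis R x) (ebasis R x)) ->
  exists2 s, 0 <= s <= 1 &
    f (b + a *: ebasis R x) - f b = a * pderiv f x (b + (s * a) *: ebasis R x).
Proof.
move=> df.
pose psi (r : R) := f (b + r *: ebasis R x).
pose phi (s : R) := psi (s * a).
have dphi (s : R) : s \in `[0, 1]%R ->
    is_derive s 1 phi (a * pderiv f x (b + (s * a) *: ebasis R x)).
  rewrite in_itv/= => s01.
  have H := is_derive_line (df s s01).
  have H2 : is_derive s 1 (fun s : R => s * a) a.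
    by apply: is_derive_eq; rewrite /GRing.scale/= mulr0 add0r mulr1.
  have := @is_derive1_comp R psi (fun s : R => s * a) s _ _ H H2.
  by rewrite mulrC.
pose F (s : R) := a * pderiv f x (b + (s * a) *: ebasis R x).
have A (s : R) : s \in `]0, 1[%R -> is_derive s 1 phi (F s).
  by move=> s01; apply: dphi; exact: subset_itv_oo_cc s01.
have B : {within `[0, 1], continuous phi}.
  apply: derivable_within_continuous => s s01.
  by have [] := dphi s s01.
have [s] := @MVT_segment R phi F 0 1 ler01 A B.
rewrite in_itv/= => s01; rewrite /phi /psi mul1r mul0r scale0r addr0 subr0 mulr1 => E.
by exists s.
Qed.

Let trunc (k : nat) h : 'rV[R]_m := \row_x (if (x < k)%N then h 0 x else 0).

(** The increment is made one coordinate at a time along a staircase, which stays in the box. Only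
    partial derivatives are used, as [C2_on] provides nothing else. *)
Lemma path_mvt f c (e : R) q h :
  (forall q', box c e q' -> forall x, derivable f q' (ebasis R x)) ->
  box c e q -> box c e (q + h) ->
  exists xi : 'I_m -> 'rV[R]_m, (forall x k, `|xi x 0 k - q 0 k| <= `|h 0 k|) /\
    f (q + h) - f q = \sum_x h 0 x * pderiv f x (xi x).
Proof.
move=> df bq bqh.
have truncS (x : 'I_m) : trunc x.+1 h = trunc x h + h 0 x *: ebasis R x.
  apply/rowP => k; rewrite !mxE eqxx/= ltnS leq_eqVlt.
  have [kx|kx] := eqVneq k x.
    by rewrite kx ltnn eqxx/= mulr1 add0r.
  by rewrite -(inj_eq val_inj) in kx; rewrite (negbTE kx)/= mulr0 addr0.
have between (a b s : R) (cc : R) : 0 <= s <= 1 -> `|a - cc| < e -> `|a + b - cc| < e -> `|a + s * b - cc| < e.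
  move=> /andP[s0 s1]; rewrite !ltr_norml => /andP[h1 h2] /andP[h3 h4].
  have [b0|b0] := leP 0 b.
    have : s * b <= b by rewrite ler_piMl.
    have : 0 <= s * b by rewrite mulr_ge0.
    by move=> *; apply/andP; split; lra.
  have : b <= s * b by rewrite ler_niMl// ltW.
  have : s * b <= 0 by rewrite mulr_ge0_le0// ltW.
  by move=> *; apply/andP; split; lra.
have tr01 (j : nat) k : exists2 s, 0 <= s <= 1 & trunc j h 0 k = s * h 0 k.
  rewrite mxE; case: ifP => _; first by exists 1; rewrite ?mul1r ?lexx ?ler01.
  by exists 0; rewrite ?mul0r ?lexx ?ler01.
have step (x : 'I_m) : exists xi : 'rV[R]_m, (forall k, `|xi 0 k - q 0 k| <= `|h 0 k|) /\
    f (q + trunc x.+1 h) - f (q + trunc x h) = h 0 x * pderiv f x xi.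
  have pt s k : 0 <= s <= 1 -> exists2 r, 0 <= r <= 1 &
      (q + trunc x h + (s * h 0 x) *: ebasis R x) 0 k = q 0 k + r * h 0 k.
    move=> s01; have [kx|kx] := eqVneq k x.
      by exists s => //; rewrite !mxE kx ltnn !eqxx/= mulr1 addr0.
    have [r r01 rE] := tr01 x k; exists r => //.
    by rewrite mxE [X in X + _]mxE rE !mxE (negbTE kx) andbF mulr0 addr0.
  have [s s01|s s01 E] := @coord_mvt f (q + trunc x h) x (h 0 x).
    apply: df => k; have [r r01 ->] := pt s k s01.
    by apply: between => //; have := bqh k; rewrite mxE.
  exists (q + trunc x h + (s * h 0 x) *: ebasis R x); split.
    move=> k; have [r /andP[r0 r1] ->] := pt s k s01.
    by rewrite addrAC subrr add0r normrM (ger0_norm r0) ler_piMl.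
  by rewrite truncS addrA.
have /choice [xi Hxi] := step.
exists xi; split; first by move=> x; case: (Hxi x).
under eq_bigr do rewrite -(Hxi _).2.
rewrite -(big_mkord xpredT (fun k => f (q + trunc k.+1 h) - f (q + trunc k h))) telescope_sumr//.
congr (f (_ + _) - f _).
  by apply/rowP => k; rewrite mxE ltn_ord.
by rewrite (_ : trunc 0 h = 0) ?addr0//; apply/rowP => k; rewrite !mxE.
Qed.

End path_mvt.

Section taylor_half.
Variable R : realType.

(** Unlike in the telescope, the factor 1/2 matters here, because b_n fixes the constant. The mean
    value theorem is applied to f - s f1(0), with either sign, minus B s^2 / 2. *)
Lemma taylor2_half (f f1 f2 : R -> R) (B : R) :
  (forall s : R, 0 <= s <= 1 -> is_derive s 1 f (f1 s)) ->
  (forall s : R, 0 <= s <= 1 -> is_derive s 1 f1 (f2 s)) ->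
  (forall s, 0 <= s <= 1 -> `|f2 s| <= B) ->
  `|f 1 - f 0 - f1 0| <= B / 2.
Proof.
move=> df df1 Bf.
have mvt (F F' : R -> R) (a : R) : 0 <= a <= 1 ->
    (forall s : R, 0 <= s <= 1 -> is_derive s 1 F (F' s)) ->
    exists2 c, 0 <= c <= a & F a - F 0 = F' c * a.
  move=> /andP[a0 a1] dF.
  have sub (s : R) : s \in `[0, a]%R -> 0 <= s <= 1.
    by rewrite in_itv/= => /andP[-> /le_trans]; apply.
  have [|c] := @MVT_segment R F F' 0 a a0 (fun s sI => dF s (sub s (subset_itv_oo_cc sI))).
    by apply: derivable_within_continuous => s /sub/dF[].
  by rewrite in_itv/= subr0 => ca ->; exists c.
have d1 s : 0 <= s <= 1 -> `|f1 s - f1 0| <= B * s.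
  move=> s01; have [c /andP[c0 cs] ->] := mvt f1 f2 s s01 df1.
  have /andP[s0 s1] := s01.
  by rewrite normrM (ger0_norm s0) ler_wpM2r// Bf// c0 (le_trans cs).
have one : 0 <= (1 : R) <= 1 by rewrite ler01 lexx.
have key (e : R) : e = 1 \/ e = -1 -> e * (f 1 - f 0 - f1 0) <= B / 2.
  move=> ee.
  have dp (s : R) : 0 <= s <= 1 -> is_derive s 1 (fun s => e * (f s - s * f1 0) - B / 2 * s ^+ 2)
      (e * (f1 s - f1 0) - B * s).
    move=> s01; have := df s s01 => ?.
    by apply: is_derive_eq; rewrite /GRing.scale/=; field.
  have [c /andP[c0 c1]] := mvt _ _ 1 one dp.
  rewrite expr1n expr0n/= mulr1 mul1r mul0r !subr0 mulr0 subr0 mulr1 => H.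
  have : e * (f1 c - f1 0) <= B * c.
    apply: le_trans (ler_norm _) _; rewrite normrM (_ : `|e| = 1) ?mul1r ?d1 ?c0//.
    by case: ee => ->; rewrite ?normrN normr1.
  by move: H; case: ee => ->; lra.
rewrite ler_norml; apply/andP; split.
  by have := key (-1) (or_intror erefl); lra.
by have := key 1 (or_introl erefl); lra.
Qed.

End taylor_half.

Lemma is_derive_lincomb (R : realType) (I : Type) (l : seq I) (a : I -> R)
    (F : I -> R -> R) (dF : I -> R) (s : R) :
  (forall x, is_derive s 1 (F x) (dF x)) ->
  is_derive s 1 (fun s => \sum_(x <- l) a x * F x s) (\sum_(x <- l) a x * dF x).
Proof.
move=> dx; elim: l => [|x l IH].
  rewrite big_nil (_ : (fun s => _) = cst 0); first exact: is_derive_cst.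
  by apply/funext => w; rewrite big_nil.
rewrite big_cons (_ : (fun s => _) = (fun s => a x * F x s + \sum_(x <- l) a x * F x s)).
  by have := dx x => ?; apply: is_derive_eq.
by apply/funext => w; rewrite big_cons.
Qed.

Section C2_taylor.
Variables (R : realType) (m : nat).
Implicit Types (f : 'rV[R]_m -> R) (q h c b p : 'rV[R]_m).

Lemma nbhs_box q (A : set 'rV[R]_m) :
  nbhs q A -> exists2 e : R, 0 < e & forall q', box q e q' -> A q'.
Proof.
move=> /nbhs_ballP[e /= e0 eA]; exists e => // q' H; apply: eA; split => // i j.
by rewrite (ord1 i) /ball/= distrC.
Qed.

Lemma box_nbhs q (e : R) : 0 < e -> nbhs q (box q e).
Proof.
move=> e0; apply/nbhs_ballP; exists e => //= q' [_ H] x.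
by have := H 0 x; rewrite /ball/= distrC.
Qed.

(** The chain rule from continuous partial derivatives: [path_mvt] writes the difference quotient
    with partials at points near [q], which converge to those at [q]. *)
Lemma is_derive_segment f c (e : R) b h (s : R) :
  (forall q', box c e q' -> forall x, derivable f q' (ebasis R x)) ->
  box c e (b + s *: h) ->
  (forall x, {for b + s *: h, continuous (pderiv f x)}) ->
  is_derive s 1 (fun s => f (b + s *: h)) (\sum_x h 0 x * pderiv f x (b + s *: h)).
Proof.
move=> df bq cf; set q := b + s *: h in bq cf *.
suff lim : (fun r : R => r^-1 *: (((fun s => f (b + s *: h)) \o shift s) (r *: 1) - f (b + s *: h)))
    @ 0^' --> \sum_x h 0 x * pderiv f x q.
  by apply: DeriveDef; [exact/cvgP/lim|exact: cvg_lim lim].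
apply/cvgrPdist_le => /= e1 e10.
have H0 : 0 <= \sum_x `|h 0 x| by exact: sumr_ge0.
pose e2 := e1 / (1 + \sum_x `|h 0 x|).
have e20 : 0 < e2 by rewrite divr_gt0//; lra.
have [de de0 Hde] : exists2 de : R, 0 < de & forall q', box q de q' ->
    box c e q' /\ forall x, `|pderiv f x q - pderiv f x q'| < e2.
  apply: nbhs_box.
  have n1 : nbhs q (fun q' : 'rV[R]_m => forall x, `|q' 0 x - c 0 x| < e).
    apply: (@filter_forall _ 'I_m (fun x (q' : 'rV[R]_m) => `|q' 0 x - c 0 x| < e) (nbhs q) (nbhs_filter q)) => x.
    have ex : 0 < e - `|q 0 x - c 0 x| by rewrite subr_gt0.
    apply: filterS (box_nbhs q ex) => q' H.
    have := ler_distD (q 0 x) (q' 0 x) (c 0 x); have := H x.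
    by move: (`|q' 0 x - q 0 x|) => i1; lra.
  have n2 : \forall q' \near q, forall x, `|pderiv f x q - pderiv f x q'| < e2.
    apply: (@filter_forall _ 'I_m (fun x q' => `|pderiv f x q - pderiv f x q'| < e2)
      (nbhs q) (nbhs_filter q)) => x.
    by have /cvgrPdist_lt := cf x; apply.
  by apply: filterS2 n1 n2 => q' H1 H2; split.
near=> r.
have r0 : r != 0 by near: r; exact: nbhs_dnbhs_neq.
have rde : `|r| < de / (1 + \sum_x `|h 0 x|).
  by near: r; apply: dnbhs0_lt; rewrite divr_gt0//; lra.
have hr x : `|(r *: h) 0 x| < de.
  rewrite mxE normrM.
  have hx : `|h 0 x| <= 1 + \sum_x `|h 0 x|.
    rewrite (bigD1 x)//= [leRHS](_ : _ = `|h 0 x| + (1 + \sum_(i < m | i != x) `|h 0 i|)); last by ring.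
    by rewrite lerDl addr_ge0// sumr_ge0.
  apply: le_lt_trans (ler_wpM2l (normr_ge0 r) hx) _.
  by rewrite -ltr_pdivlMr//; lra.
have bqr : box q de (q + r *: h).
  by move=> x; rewrite mxE addrAC subrr add0r hr.
have [xi [xi1 xi2]] := path_mvt df bq (Hde _ bqr).1.
have E : f (b + (r *: 1 + s) *: h) - f q = \sum_x (r *: h) 0 x * pderiv f x (xi x).
  by rewrite -xi2 [r *: 1]mulr1 scalerDl addrCA addrC.
rewrite /= E (_ : r^-1 *: _ = \sum_x h 0 x * pderiv f x (xi x)); last first.
  rewrite /GRing.scale/= mulr_sumr; apply: eq_bigr => x _.
  by rewrite mxE mulrA mulrA mulVf// mul1r.
rewrite -sumrB; apply: le_trans (ler_norm_sum _ _ _) _.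
apply: (@le_trans _ _ (\sum_x `|h 0 x| * e2)).
  apply: ler_sum => x _; rewrite -mulrBr normrM ler_wpM2l// ltW//.
  by apply: (Hde _ _).2 => k; apply: le_lt_trans (xi1 x k) (hr k).
rewrite -mulr_suml /e2 mulrCA ler_piMr ?(ltW e10)// ler_pdivrMr; lra.
Unshelve. all: by end_near. Qed.

Lemma C2_taylor (U : set 'rV[R]_m) f p : C2_on U f -> U p ->
  exists2 r : R, 0 < r & forall q, box p r q ->
    `|f q - f p - \sum_x (q - p) 0 x * pderiv f x p| <=
    (specnorm (hessian f p) + 1) * dot (q - p) (q - p) / 2.
Proof.
move=> [oU C2] Up.
(* A variation of each Hessian entry by [e0] changes the quadratic form by at most m e0 |h|^2 <=
   |h|^2; this is the 1 in kappa + 1. *)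
pose e0 : R := m.+1%:R^-1.
have e00 : 0 < e0 by rewrite invr_gt0 ltr0n.
have [r r0 Hr] : exists2 r : R, 0 < r & forall q, box p r q -> U q /\
    forall x y, `|pderiv (pderiv f x) y q - pderiv (pderiv f x) y p| <= e0.
  apply: nbhs_box.
  have n1 : \forall q \near p, U q by exact: open_nbhs_nbhs.
  have n2 : \forall q \near p, forall x y,
      `|pderiv (pderiv f x) y q - pderiv (pderiv f x) y p| <= e0.
    apply: (@filter_forall _ 'I_m (fun x q => forall y, 
      `|pderiv (pderiv f x) y q - pderiv (pderiv f x) y p| <= e0) (nbhs p) (nbhs_filter p)) => x.
    apply: (@filter_forall _ 'I_m (fun y q =>
      `|pderiv (pderiv f x) y q - pderiv (pderiv f x) y p| <= e0) (nbhs p) (nbhs_filter p)) => y.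
    have [_ /(_ x y)[_ [_ [_ H]]]] := C2 p Up.
    have /cvgrPdist_le/(_ e0 e00) := H; apply: filterS => q.
    by rewrite distrC.
  by apply: filterS2 n1 n2 => q H1 H2; split.
exists r => // q bq; set h := q - p.
have qE : q = p + h by rewrite addrC subrK.
have seg s : 0 <= s <= 1 -> box p r (p + s *: h).
  move=> /andP[s0 s1] x; rewrite !mxE addrAC subrr add0r normrM (ger0_norm s0).
  by apply: le_lt_trans (bq x); rewrite ler_piMl.
have D1 q' : box p r q' -> forall x, derivable f q' (ebasis R x).
  by move=> /Hr[Uq' _] x; have [_ /(_ x x)[]] := C2 q' Uq'.
have D2 z q' : box p r q' -> forall x, derivable (pderiv f z) q' (ebasis R x).
  by move=> /Hr[Uq' _] x; have [_ /(_ z x)[_ [_ []]]] := C2 q' Uq'.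
have df (s : R) : 0 <= s <= 1 -> is_derive s 1 (fun s => f (p + s *: h))
    (\sum_x h 0 x * pderiv f x (p + s *: h)).
  move=> s01; apply: (is_derive_segment D1) => [|x]; first exact: seg.
  by have [Uq _] := Hr _ (seg s s01); have [_ /(_ x x)[_ []]] := C2 _ Uq.
have df1 (s : R) : 0 <= s <= 1 -> is_derive s 1 (fun s => \sum_x h 0 x * pderiv f x (p + s *: h))
    (\sum_x h 0 x * \sum_y h 0 y * pderiv (pderiv f x) y (p + s *: h)).
  move=> s01.
  have dx x : is_derive s 1 (fun s => pderiv f x (p + s *: h))
      (\sum_y h 0 y * pderiv (pderiv f x) y (p + s *: h)).
    apply: (is_derive_segment (D2 x)) => [|y]; first exact: seg.
    by have [Uq _] := Hr _ (seg s s01); have [_ /(_ x y)[_ [_ []]]] := C2 _ Uq.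
  exact: (is_derive_lincomb _ _ dx).
have hh0 : 0 <= dot h h by apply: sumr_ge0 => x _; rewrite -expr2 sqr_ge0.
have B2 s : 0 <= s <= 1 -> `|\sum_x h 0 x * \sum_y h 0 y * pderiv (pderiv f x) y (p + s *: h)| <=
    (specnorm (hessian f p) + 1) * dot h h.
  move=> s01; have [_ Hs] := Hr _ (seg s s01).
  have -> : \sum_x h 0 x * \sum_y h 0 y * pderiv (pderiv f x) y (p + s *: h) =
      \sum_x \sum_y h 0 x * h 0 y * hessian f p x y +
      \sum_x \sum_y h 0 x * h 0 y *
        (pderiv (pderiv f x) y (p + s *: h) - pderiv (pderiv f x) y p).
    rewrite -big_split; apply: eq_bigr => x _; rewrite mulr_sumr -big_split.
    by apply: eq_bigr => y _; rewrite /= [hessian f p x y]mxE; ring.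
  apply: le_trans (ler_normD _ _) _; rewrite mulrDl mul1r lerD ?specnorm_quad//.
  apply: (@le_trans _ _ (\sum_(x < m) \sum_(y < m) (h 0 x ^+ 2 + h 0 y ^+ 2) / 2 * e0)).
    apply: le_trans (ler_norm_sum _ _ _) _; apply: ler_sum => x _.
    apply: le_trans (ler_norm_sum _ _ _) _; apply: ler_sum => y _.
    rewrite normrM; apply: ler_pM => //.
    rewrite normrM -(real_normK (num_real (h 0 x))) -(real_normK (num_real (h 0 y))).
    by have := sqr_ge0 (`|h 0 x| - `|h 0 y|); nra.
  have sE : dot h h = \sum_x h 0 x ^+ 2 by apply: eq_bigr => x _; rewrite expr2.
  have -> : \sum_(x < m) \sum_(y < m) (h 0 x ^+ 2 + h 0 y ^+ 2) / 2 * e0 = m%:R * e0 * dot h h.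
    transitivity (\sum_(x < m) (m%:R * h 0 x ^+ 2 + dot h h) / 2 * e0).
      apply: eq_bigr => x _.
      by rewrite -!mulr_suml big_split/= sumr_const card_ord -sE mulr_natl.
    rewrite -!mulr_suml big_split/= sumr_const card_ord -mulr_sumr -sE.
    by rewrite -[dot h h *+ m]mulr_natl; field.
  by rewrite ler_piMl// ler_pdivrMr ?ltr0n// mul1r ler_nat.
have := taylor2_half df df1 B2.
by rewrite scale1r scale0r addr0 -qE.
Qed.

End C2_taylor.

(** * Proof of the theorem *)

Section types.
Variables (R : realType) (m d n : nat) (p : 'rV[R]_m) (g : 'I_d -> 'rV[R]_m -> R).
Hypothesis p_simplex : in_simplex p.
Hypothesis n_gt0 : (0 < n)%N.
Implicit Types xs : {ffun 'I_n -> 'I_m}.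

Definition gstep (a : 'I_m) : 'rV[R]_d := \row_t (gder g p t a - gmean g p t).

Lemma sum_count (xs : {ffun 'I_n -> 'I_m}) (f : 'I_m -> R) :
  \sum_k f (xs k) = n%:R * \sum_a ptype R xs 0 a * f a.
Proof.
rewrite (partition_big xs xpredT)//= mulr_sumr; apply: eq_bigr => a _.
rewrite (eq_bigr (fun=> f a)); last by move=> k /eqP ->.
rewrite sumr_const mxE mulrA mulrCA divff ?pnatr_eq0 -?lt0n// mulr1 mulr_natl.
congr (_ *+ _); apply: eq_card => k; rewrite [LHS]unfold_in.
by apply/idP/idP => [H|/set_mem H]; [exact/mem_set|exact: H].
Qed.

Lemma sum_tstep xs : \sum_k tstep p (xs k) = n%:R *: (ptype R xs - p).
Proof.
apply/rowP => a; rewrite summxE mxE [(ptype R xs - p) 0 a]mxE mulrDr.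
under eq_bigr do rewrite mxE.
rewrite big_split/= (sum_count xs (fun b => delta_mx 0 b 0 a)); congr (_ + _).
  rewrite (bigD1 a)//= [delta_mx _ _ _ _]mxE !eqxx mulr1 big1 ?addr0// => b ba.
  by rewrite [delta_mx _ _ _ _]mxE eq_sym (negbTE ba) andbF mulr0.
by rewrite sumr_const card_ord !mxE mulr_natl.
Qed.

Lemma sum_gstep xs t :
  (\sum_k gstep (xs k)) 0 t = n%:R * \sum_a (ptype R xs - p) 0 a * gder g p t a.
Proof.
rewrite summxE; under eq_bigr do rewrite mxE.
rewrite sumrB (sum_count xs (fun a => gder g p t a)) sumr_const card_ord -[gmean g p t *+ n]mulr_natl -mulrBr.
congr (_ * _); rewrite /gmean -sumrB; apply: eq_bigr => a _.
by rewrite [(ptype R xs - p) 0 a]mxE [(- p) 0 a]mxE mulrBl.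
Qed.

End types.

Section covariance.
Variables (R : realType) (m d : nat) (p : 'rV[R]_m) (g : 'I_d -> 'rV[R]_m -> R).
Hypothesis p_simplex : in_simplex p.
Local Notation V := (covV g p).
Local Notation y := (gstep p g).

Lemma gstep_mean w : \sum_a p 0 a * dot w (y a) = 0.
Proof.
have [_ p1] := p_simplex.
under eq_bigr do rewrite mulr_sumr.
rewrite exchange_big big1// => t _ /=.
under eq_bigr do rewrite mulrCA mxE mulrBr.
rewrite -mulr_sumr sumrB -mulr_suml p1 mul1r subrr mulr0//.
Qed.

Lemma covV_sym : V^T = V.
Proof.
by apply/matrixP => s t; rewrite !mxE; apply: eq_bigr => a _; ring.
Qed.

Lemma covV_dot w : dot w (w *m V) = \sum_a p 0 a * dot w (y a) ^+ 2.
Proof.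
transitivity (\sum_t \sum_s \sum_a p 0 a * (w 0 t * y a 0 t) * (w 0 s * y a 0 s)).
  apply: eq_bigr => t _; rewrite mxE mulr_sumr; apply: eq_bigr => s _.
  rewrite mxE !mulr_sumr; apply: eq_bigr => a _.
  by rewrite [y a 0 t]mxE [y a 0 s]mxE; ring.
under eq_bigr do rewrite exchange_big.
rewrite exchange_big; apply: eq_bigr => a _ /=.
rewrite expr2 /dot big_distrlr/= mulr_sumr; apply: eq_bigr => t _.
by rewrite mulr_sumr; apply: eq_bigr => s _; ring.
Qed.

Lemma covV_psd w : 0 <= dot w (w *m V).
Proof.
rewrite covV_dot; apply: sumr_ge0 => a _; rewrite mulr_ge0 ?sqr_ge0//.
by case: p_simplex.
Qed.

(* The kernel of V is orthogonal to every atom of positive mass. *)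
Lemma gstep_range a : p 0 a != 0 -> exists u, y a = u *m V.
Proof.
move=> pa; suff /submxP[u ->] : (y a <= V)%MS by exists u.
rewrite submxE; apply/eqP/rowP => j; rewrite mxE [RHS]mxE.
pose w : 'rV[R]_d := (col j (cokermx V))^T.
have wV : w *m V = 0.
  apply: trmx_inj; rewrite trmx_mul trmxK covV_sym trmx0.
  rewrite colE mulmxA mulmx_coker mul0mx//.
have := covV_dot w; rewrite wV dot0r => /esym/eqP.
rewrite psumr_eq0 => [/allP/(_ a)|b _]; last by rewrite mulr_ge0 ?sqr_ge0//; case: p_simplex.
rewrite mem_index_enum => /(_ isT); rewrite mulf_eq0 (negbTE pa)/= sqrf_eq0 => /eqP.
rewrite /dot => E; rewrite -[RHS]E; apply: eq_bigr => t _.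
have -> : w 0 t = cokermx V t j by rewrite /w [LHS]mxE [LHS]mxE.
by rewrite mulrC.
Qed.

End covariance.

(** * Numerical thresholds in n *)

Section large_n.
Variable R : realType.

(** From ln n <= 2 sqrt n and 1 / ln 2 <= 2 the left side is at most 8 / sqrt n. It places typical
    types in the box where the Taylor bound holds. *)
Lemma log2_div_small (r : R) n : 0 < r -> 64 / r ^+ 4 < n%:R -> (2 <= n)%N ->
  2 * log2 n%:R / n%:R < r ^+ 2.
Proof.
move=> r0 nr n2; have n0 : 0 < n%:R :> R by rewrite ltr0n; lia.
pose s : R := Num.sqrt n%:R; have s0 : 0 < s by rewrite sqrtr_gt0.
have ss : s ^+ 2 = n%:R by rewrite sqr_sqrtr// ltW.
have lns : ln n%:R <= 2 * s.
  by rewrite -ss lnXn// -[ln s *+ 2]mulr_natl ler_wpM2l// ltW// ln_sublinear.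
have L0 : 0 <= ln n%:R :> R by have := @ln_nat_ge_half R n n2; lra.
have l2 := @ln2_ge_half R.
have log_le : log2 n%:R <= 2 * ln n%:R :> R.
  by rewrite /log2 ler_pdivrMr; nra.
have sr : 8 < s * r ^+ 2.
  rewrite -(@ltr_pXn2r _ 2)// ?nnegrE ?(mulr_ge0 (ltW s0) (sqr_ge0 r))//.
  have e4 : (r ^+ 2) ^+ 2 = r ^+ 4 by rewrite -exprM.
  by rewrite exprMn ss e4; move: nr; rewrite ltr_pdivrMr ?exprn_gt0//; lra.
have : 8 * s < s * r ^+ 2 * s by rewrite ltr_pM2r.
by rewrite ltr_pdivrMr// -ss => H; rewrite (_ : r ^+ 2 * s ^+ 2 = s * r ^+ 2 * s); [rewrite ss; lra|ring].
Qed.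

Lemma tail_rate n : (2 <= n)%N ->
  expR (- (2 * n%:R * log2 n%:R / (5 * n%:R))) <= (Num.sqrt n%:R)^-1 :> R.
Proof.
move=> n2; have n0 : 0 < n%:R :> R by rewrite ltr0n; lia.
have L0 : 0 <= ln n%:R :> R by have := @ln_nat_ge_half R n n2; lra.
have l2 := @ln2_ge_half R; have l2' := @ln2_le R.
have s0 : 0 < Num.sqrt n%:R :> R by rewrite sqrtr_gt0.
rewrite -[X in _ <= X^-1](@lnK R (Num.sqrt n%:R)) ?posrE// -expRN ler_expR lerN2.
have -> : ln (Num.sqrt n%:R) = ln n%:R / 2 :> R.
  have : ln (Num.sqrt n%:R ^+ 2) = ln (Num.sqrt n%:R) *+ 2 :> R by rewrite lnXn.
  by rewrite sqr_sqrtr ?(ltW n0)// => ->; rewrite -[ln _ *+ 2]mulr_natr mulfK.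
rewrite (_ : 2 * n%:R * log2 n%:R / (5 * n%:R) = ln n%:R * (2 / 5 / ln 2)); last first.
  by rewrite /log2; field; rewrite !gt_eqF//; lra.
rewrite ler_wpM2l// ler_pdivlMr; lra.
Qed.

End large_n.

Section main.
Context (R : realType) (m d : nat) (p : 'rV[R]_m) (g : 'I_d -> 'rV[R]_m -> R).
Variables (U : set 'rV[R]_m) (z : 'I_d -> R).
Hypothesis p_simplex : in_simplex p.
Hypothesis simplexU : forall q : 'rV[R]_m, in_simplex q -> U q.
Hypothesis gC2 : forall t, C2_on U (g t).

Local Notation y := (gstep p g).
Let v (t : 'I_d) := \sum_a p 0 a * y a 0 t ^+ 2.
Let Q (t : 'I_d) := 0 < v t.

Let p_ge0 a : 0 <= p 0 a. Proof. by case: p_simplex. Qed.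
Let p_sum1 : \sum_a p 0 a = 1. Proof. by case: p_simplex. Qed.

Let weight n (xs : {ffun 'I_n -> 'I_m}) := \prod_(k < n) p 0 (xs k).

Let weight_ge0 n (xs : {ffun 'I_n -> 'I_m}) : 0 <= weight xs.
Proof. exact: prodr_ge0. Qed.

Lemma prob_event_ge0 n : 0 <= prob_event g p z n.
Proof. by apply: sumr_ge0 => xs _; exact: weight_ge0. Qed.

Lemma degenerate_gstep t a : ~~ Q t -> p 0 a != 0 -> y a 0 t = 0.
Proof.
rewrite /Q -leNgt => vt pa.
have /eqP : v t = 0.
  apply/eqP; rewrite eq_le vt/=; apply: sumr_ge0 => b _.
  by rewrite mulr_ge0 ?sqr_ge0.
rewrite psumr_eq0 => [/allP/(_ a)|b _]; last by rewrite mulr_ge0 ?sqr_ge0.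
by rewrite mem_index_enum => /(_ isT); rewrite mulf_eq0 (negbTE pa)/= sqrf_eq0 => /eqP.
Qed.

Lemma specnorm_le_kappa t : specnorm (hessian (g t) p) <= kappa g p.
Proof. exact: le_bigmax. Qed.

Lemma taylor_uniform : exists2 r : R, 0 < r & forall t q, box p r q ->
  `|g t q - g t p - \sum_x (q - p) 0 x * pderiv (g t) x p| <=
    (kappa g p + 1) * dot (q - p) (q - p) / 2.
Proof.
have /choice[r Hr] : forall t, exists r : R, 0 < r /\ forall q, box p r q ->
    `|g t q - g t p - \sum_x (q - p) 0 x * pderiv (g t) x p| <=
    (kappa g p + 1) * dot (q - p) (q - p) / 2.
  move=> t; have [r r0 H] := C2_taylor (gC2 t) (simplexU p_simplex).
  exists r; split=> // q /H{}H; apply: le_trans H _.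
  rewrite ler_wpM2r// ler_wpM2r ?lerD2r ?specnorm_le_kappa//.
  by apply: sumr_ge0 => x _; rewrite -expr2 sqr_ge0.
exists (\big[Num.min/1]_t r t).
  by rewrite lt_bigmin// => t _; case: (Hr t).
move=> t q bq; apply: (Hr t).2 => x; apply: lt_le_trans (bq x) _.
exact: bigmin_le.
Qed.

(** The normalized sum of gradient steps is the linear Taylor term of [g t] at the type, so the
    orthant condition gives the claim up to the remainder, which [bn] covers. *)
Lemma event_inclusion (r : R) n (xs : {ffun 'I_n -> 'I_m}) : 0 < r -> (2 <= n)%N ->
  64 / r ^+ 4 < n%:R ->
  (forall t q, box p r q ->
    `|g t q - g t p - \sum_x (q - p) 0 x * pderiv (g t) x p| <=
      (kappa g p + 1) * dot (q - p) (q - p) / 2) ->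
  (forall t, ~~ Q t -> z t <= 0) ->
  weight xs != 0 ->
  [forall t, Q t ==> (Num.sqrt n%:R * z t <= (\sum_k y (xs k)) 0 t)] ->
  dot (\sum_k tstep p (xs k)) (\sum_k tstep p (xs k)) <= 2 * n%:R * log2 n%:R ->
  [forall t, g t p + z t / Num.sqrt n%:R - bn g p n <= g t (ptype R xs)].
Proof.
move=> r0 n2 nr H zQ wn orth small.
have n1 : (0 < n)%N by lia.
have n0 : 0 < n%:R :> R by rewrite ltr0n.
have s0 : 0 < Num.sqrt n%:R :> R by rewrite sqrtr_gt0.
have ss : Num.sqrt n%:R ^+ 2 = n%:R :> R by rewrite sqr_sqrtr// ltW.
set h := ptype R xs - p.
have hh : dot h h <= 2 * log2 n%:R / n%:R.
  move: small; rewrite sum_tstep// -/h dotZl dotZr ler_pdivlMr// => small.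
  by rewrite -(ler_pM2l n0); lra.
have bx : box p r (ptype R xs).
  move=> x; have hx : h 0 x ^+ 2 <= dot h h.
    rewrite /dot (bigD1 x)//= expr2 lerDl sumr_ge0// => k _.
    by rewrite -expr2 sqr_ge0.
  have : h 0 x ^+ 2 < r ^+ 2 by apply: le_lt_trans (log2_div_small r0 nr n2); exact: le_trans hh.
  rewrite -(real_normK (num_real (h 0 x))) ltr_sqr ?nnegrE ?(ltW r0)//.
  by rewrite /h mxE [(- p) 0 x]mxE.
have k1 : 0 <= kappa g p + 1.
  suff : 0 <= kappa g p by lra.
  by rewrite /kappa; apply: bigmax_ge_id.
apply/forallP => t.
have := H t _ bx; rewrite -/h ler_norml => /andP[Ht _].
(* The 1/2 of the Taylor remainder cancels the 2 of the threshold 2 log2 n. *)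
have bE : (kappa g p + 1) * dot h h / 2 <= bn g p n.
  rewrite /bn -!mulrA ler_wpM2l// ler_pdivrMr//.
  by apply: le_trans hh _; rewrite /log2 le_eqVlt; apply/predU1P; left; ring.
have SE : \sum_x h 0 x * pderiv (g t) x p = (\sum_k y (xs k)) 0 t / n%:R.
  by rewrite sum_gstep// mulrC mulKf ?gt_eqF.
have zS : Num.sqrt n%:R * z t <= (\sum_k y (xs k)) 0 t.
  have [Qt|nQt] := boolP (Q t).
    by have /forallP/(_ t) := orth; rewrite Qt.
  (* In a coordinate of zero variance every letter of positive mass contributes 0, and a word of
     nonzero weight has no other letters. *)
  rewrite summxE big1 => [|k _]; first by rewrite mulr_ge0_le0// ?zQ// ltW.
  apply: degenerate_gstep => //; apply: contraNneq wn => pk0.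
  by rewrite /weight (bigD1 k)//= pk0 mul0r.
have zs : z t / Num.sqrt n%:R <= (\sum_k y (xs k)) 0 t / n%:R.
  rewrite ler_pdivlMr// -[X in _ * X]ss expr2 mulrA divfK ?gt_eqF//.
  by rewrite mulrC.
by move: Ht; rewrite SE; lra.
Qed.

Lemma prob_event_lower : (forall t, ~~ Q t -> z t <= 0) -> exists2 N : nat, (2 <= N)%N &
  forall n, (N <= n)%N ->
  iter n (walkT (fun a => p 0 a) y)
    (fun x : 'rV[R]_d => [forall t, Q t ==> (Num.sqrt n%:R * z t <= x 0 t)%R]%:R) 0 <=
  prob_event g p z n + expR 2 / Num.sqrt n%:R.
Proof.
move=> zQ; have [r r0 H] := taylor_uniform.
exists (2 + (Num.trunc (64 / r ^+ 4)).+1)%N; first by rewrite leq_addr.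
move=> n Nn; have n2 : (2 <= n)%N by lia.
have nr : 64 / r ^+ 4 < n%:R.
  apply: lt_le_trans (Num.Theory.truncnS_gt _) _; by rewrite ler_nat; apply: leq_trans Nn; exact: leq_addl.
have n1 : (0 < n)%N by lia.
have tail : \sum_(xs : {ffun 'I_n -> 'I_m}) weight xs *
    (2 * n%:R * log2 n%:R < dot (\sum_k tstep p (xs k)) (\sum_k tstep p (xs k)))%R%:R <=
    expR 2 / Num.sqrt n%:R.
  have := walk_type_tail p_ge0 p_sum1 (2 * n%:R * log2 n%:R) n1.
  rewrite -ffun_sum_walk; under eq_bigr do rewrite add0r.
  move=> W; apply: le_trans W _.
  by rewrite ler_wpM2l ?expR_ge0// tail_rate.
rewrite -ffun_sum_walk; under eq_bigr do rewrite add0r.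
(* The comparison is now word by word: either the quadratic deviation is large and [tail] pays for
   the word, or [event_inclusion] applies. *)
apply: le_trans (lerD (lexx _) tail); rewrite /prob_event [X in _ <= X + _]big_mkcond -big_split/=.
apply: ler_sum => xs _; rewrite -/(weight xs).
set I1 := [forall t, Q t ==> _]; set I2 := [forall t, _ <= _].
have w0 := weight_ge0 xs.
have [->|wn] := eqVneq (weight xs) 0; first by rewrite !mul0r addr0; case: I2.
have [I1t|] := boolP I1; last by move=> _ /=; rewrite mulr0 addr_ge0 ?mulr_ge0//; case: I2.
case: leP => [small|_] /=; last by rewrite !mulr1 lerDr; case: I2.
rewrite mulr0 addr0 mulr1.
by rewrite /I2 (event_inclusion r0 n2 nr H zQ wn I1t small).
Qed.

End main.

Lemma degenerate_coordinate (R : realType) (m d : nat) (p : 'rV[R]_m)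
    (g : 'I_d -> 'rV[R]_m -> R) (dO : measure_display) (O : measurableType dO)
    (P : probability O R) (Z : 'I_d -> {RV P >-> R}) (t : 'I_d) (a : R) :
  centered_gaussian Z (covV g p) ->
  \sum_b p 0 b * gstep p g b 0 t ^+ 2 = 0 -> 0 < a ->
  P (Z t @^-1` `[a, +oo[) = 0%E.
Proof.
move=> HG v0 a0.
have mB : measurable (`[a, +oo[%classic : set R) by exact: measurable_itv.
have := dot_zvec_law HG (delta_mx 0 t) mB.
rewrite covV_dot; under eq_bigr do rewrite dot_delta.
rewrite v0 /gauss1 eqxx => E.
rewrite (_ : Z t @^-1` `[a, +oo[ = (fun w => dot (delta_mx 0 t) (zvec Z w)) @^-1` `[a, +oo[).
  by rewrite [LHS]E diracE memNset//= in_itv/= andbT; apply/negP; rewrite -ltNge.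
by apply/seteqP; split => w; rewrite /= dot_delta mxE.
Qed.

Unset Implicit Arguments.

(** Replacing log2 by [ln] in the error only rescales [C]. The range starts at n = 2 because the
    error term vanishes at n = 1. *)
Theorem theorem6 (R : realType) (m d : nat) (p : 'rV[R]_m)
  (g : 'I_d -> 'rV[R]_m -> R) (U : set 'rV[R]_m) (z : 'I_d -> R)
  (dO : measure_display) (O : measurableType dO) (P : probability O R)
  (Z : 'I_d -> {RV P >-> R}) :
  in_simplex p ->
  (forall q : 'rV[R]_m, in_simplex q -> U q) ->
  (forall t, C2_on U (g t)) ->
  (1 <= \rank (covV g p))%N ->
  centered_gaussian Z (covV g p) ->
  exists C : R, forall n : nat, (2 <= n)%N ->
    (P [set w | forall t, (z t <= Z t w)%R]
       - (C * (ln n%:R / Num.sqrt n%:R))%:E <= (prob_event g p z n)%:E)%E.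
Proof.
move=> ps sU gC2 _ HG.
have [p_ge0 p_sum1] := ps.
have /choice[u y_range] : forall a, exists u, p 0 a != 0 -> gstep p g a = u *m covV g p.
  move=> a; have [_|/(gstep_range g ps)[u uE]] := eqVneq (p 0 a) 0; first by exists 0.
  by exists u.
have [C1 HC1] := walk_orthant_lower HG (covV_sym p g) (covV_psd g ps) p_ge0 p_sum1
  (gstep_mean g ps) (covV_dot p g) y_range z.
set A := [set w | forall t, (z t <= Z t w)%R].
have mZ t (B : set R) : measurable B -> measurable (Z t @^-1` B).
  by move=> mB; rewrite -[X in measurable X]setTI; exact: (measurable_funPT (Z t)).
have mA : measurable A.
  rewrite (_ : A = \bigcap_(t in [set: 'I_d]) (Z t @^-1` `[z t, +oo[)).
    by apply: fin_bigcap_measurable => // t _; apply: mZ.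
  apply/seteqP; split => w.
    by move=> H t _; rewrite /= in_itv/= andbT; exact: H.
  by move=> H t; have := H t I; rewrite /= in_itv/= andbT.
pose v t := \sum_a p 0 a * gstep p g a 0 t ^+ 2.
have v0 t : 0 <= v t by apply: sumr_ge0 => a _; rewrite mulr_ge0 ?sqr_ge0.
have X0 n : (2 <= n)%N -> 0 <= ln n%:R / Num.sqrt n%:R :> R.
  by move=> n2; rewrite divr_ge0 ?sqrtr_ge0//; have := @ln_nat_ge_half R n n2; lra.
(* A coordinate of zero variance with positive threshold makes the Gaussian probability zero, and C
   = 0 works. *)
have [/existsP[t /andP[vt zt]]|] := boolP [exists t, ~~ (0 < v t) && (0 < z t)].
  have PA : P A = 0%E.
    apply/eqP; rewrite eq_le measure_ge0 andbT.
    have vt0 : v t = 0 by apply/eqP; rewrite eq_le v0 andbT leNgt.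
    rewrite -(degenerate_coordinate HG vt0 zt); apply: le_measure; rewrite ?inE//.
      by apply: mZ.
    by move=> w /= /(_ t); rewrite in_itv/= andbT.
  by exists 0 => n n2; rewrite PA mul0r sube0 lee_fin prob_event_ge0.
rewrite negb_exists => /forallP H.
have zQ t : ~~ (0 < v t) -> z t <= 0.
  by move=> vt; have := H t; rewrite vt/= -leNgt.
have [N N2 HN] := prob_event_lower ps sU gC2 zQ.
(* The three terms pay for the orthant comparison, for atypical types, and for n < N, where 2 sqrt N
   ln n / sqrt n >= 1 already exceeds any probability gap. *)
exists (`|C1| + 2 * expR 2 + 2 * Num.sqrt N%:R) => n n2.
rewrite -[P A]fineK ?fin_num_measure// -EFinB lee_fin lerBlDr.
have n0 : 0 < n%:R :> R by rewrite ltr0n; lia.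
have s0 : 0 < Num.sqrt n%:R :> R by rewrite sqrtr_gt0.
have L2 := @ln_nat_ge_half R n n2.
set X := ln n%:R / Num.sqrt n%:R; have X00 : 0 <= X := X0 n n2.
have e0 : 0 <= expR 2 :> R by exact: expR_ge0.
have si : (Num.sqrt n%:R)^-1 <= 2 * X.
  rewrite /X mulrA -[leLHS]mul1r ler_wpM2r ?invr_ge0 ?(ltW s0)//.
  by move: L2; move: (ln n%:R) => L; lra.
have C1X : C1 * X <= `|C1| * X by rewrite ler_wpM2r// ler_norm.
have sN0 : 0 <= Num.sqrt N%:R :> R by exact: sqrtr_ge0.
have e2X : 0 <= expR 2 * X by rewrite mulr_ge0.
have CX : 0 <= `|C1| * X by rewrite mulr_ge0.
have sNX : 0 <= Num.sqrt N%:R * X by rewrite mulr_ge0.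
have [Nn|nN] := leqP N n.
  have PAle : fine (P A) <= fine (P (orthant_event Z (fun a => p 0 a) (gstep p g) z)).
    have mO := measurable_orthant_event Z (fun a => p 0 a) (gstep p g) z.
    apply: fine_le; rewrite ?fin_num_measure//; apply: le_measure; rewrite ?inE//.
    by move=> w Aw t _; exact: Aw.
  have esX : expR 2 / Num.sqrt n%:R <= 2 * (expR 2 * X).
    by rewrite mulrCA ler_wpM2l.
  by have := HC1 n n2; have := HN n Nn; rewrite -/X; lra.
have PA1 : fine (P A) <= 1.
  by rewrite -lee_fin fineK ?fin_num_measure// probability_le1.
have : 1 <= 2 * (Num.sqrt N%:R * X).
  have : 1 <= 2 * (Num.sqrt n%:R * X).
    rewrite /X [Num.sqrt n%:R * _]mulrCA divff ?gt_eqF// mulr1.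
    by move: L2; move: (ln n%:R) => L; lra.
  move=> /le_trans; apply; rewrite ler_wpM2l// ler_wpM2r//.
  by rewrite ler_sqrt ?ler_nat// ltnW.
by have := prob_event_ge0 g z ps n; lra.
Qed.
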